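(* If $u_0$ is a (real-valued) real-analytic function on $S^1$, then the Cauchy problem $$u_t+uu_x+\partial_xA^{-1}\Big[2\mu(u)u+\tfrac12u_x^2\Big]=0,\qquad u(0,x)=u_0(x),$$ has a holomorphic solution near $t=0$. More precisely: (i) There exists $\Delta>0$ such that $u_0\in G^{\Delta,s+1}\subset A(\Delta)$ for any $s\ge 0$. (ii) With such a $\Delta$, if $s>1/2$, there exists a positive time $T_\Delta=T(u_0,s,\Delta)$ such that for every $d\in\,]0,1[$, the Cauchy problem has a unique solution which is a holomorphic function valued in $G^{\Delta d,s+1}$ in the disk $D(0,T_\Delta(1-d))$. Furthermore, when $\Delta$ is fixed, the analytic lifespan $T_\Delta$ satisfies, for $u_0\ne0$, $$T_\Delta=\frac{\mathrm{const.}}{\|u_0\|_{\Delta,s+1}},$$ where $\mathrm{const.}$ is a positive constant which does not depend on $u_0$ (it may depend on $s$ and $\Delta$).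
   Context: $S^1=\mathbb R/\mathbb Z$; $L^2(S^1)$ denotes real-valued square-integrable functions; $\hat\varphi(k)=\int_{S^1}\varphi(x)e^{-2k\pi ix}\,dx$; $\langle k\rangle=(1+k^2)^{1/2}$. For $\delta\ge0,s\ge0$, $G^{\delta,s}=\{\varphi\in L^2(S^1):\|\varphi\|_{\delta,s}<\infty\}$ with $\|\varphi\|_{\delta,s}^2=\sum_{k\in\mathbb Z}\langle k\rangle^{2s}e^{4\pi\delta|k|}|\hat\varphi(k)|^2$. For $\delta>0$, $A(\delta)$ is the space of functions $f:S^1\to\mathbb R$ having an analytic continuation to $S(\delta)=\{x+iy\in\mathbb C:|y|<\delta\}$. $\mu(\varphi)=\int_{S^1}\varphi\,dx$ (integration in $x$), $A(\varphi)=\mu(\varphi)-\varphi_{xx}$ (operator, not to be confused with the space $A(\delta)$), whose inverse is $A^{-1}(\varphi)=\hat\varphi(0)+\sum_{k\ne0}\frac{\hat\varphi(k)}{(2\pi k)^2}e^{2k\pi ix}$. $D(0,r)=\{t\in\mathbb C:|t|<r\}$. For complex $t$ the values of a holomorphic function of $t$ are taken in the complexification of $G^{\delta,s+1}$ (complex-valued functions, same norm), with $\mu$, $A^{-1}$, $\partial_x$ and products extended by the same formulas. *)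

(* Defs.v *)
From HB Require Import structures.
From mathcomp Require Import all_boot all_order all_algebra.
From mathcomp Require Import complex.
From mathcomp Require Import all_classical all_reals all_analysis.

Set Implicit Arguments.
Unset Strict Implicit.
Unset Printing Implicit Defensive.

Import Order.TTheory GRing.Theory Num.Theory.
Import numFieldNormedType.Exports.

Local Open Scope classical_set_scope.
Local Open Scope ring_scope.
Local Open Scope complex_scope.

(* Functions on S^1 = R/Z are 1-periodic functions on R. *)
Definition periodic1 (R : realType) (T : Type) (f : R -> T) : Prop :=
  forall x, f (x + 1) = f x.

Definition toC (R : realType) (f : R -> R) : R -> R[i] := fun x => (f x)%:C.

Definition cabs (R : realType) (z : R[i]) : R := ComplexField.Normc.normc z.

Definition expi (R : realType) (theta : R) : R[i] := cos theta +i* sin theta.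

Definition cint (R : realType) (f : R -> R[i]) : R[i] :=
  (\int[lebesgue_measure]_(x in `[0%R, 1%R]) complex.Re (f x))%R +i*
  (\int[lebesgue_measure]_(x in `[0%R, 1%R]) complex.Im (f x))%R.

Definition fhat (R : realType) (phi : R -> R[i]) (k : int) : R[i] :=
  cint (fun x => phi x * expi (- (2 * k%:~R * pi * x))).

(* Representatives of elements of L^2(S^1; C). *)
Definition L2circle (R : realType) (phi : R -> R[i]) : Prop :=
  [/\ periodic1 phi,
      measurable_fun [set: R] (fun x => complex.Re (phi x)),
      measurable_fun [set: R] (fun x => complex.Im (phi x)) &
      (\int[lebesgue_measure]_(x in `[0%R, 1%R]) (cabs (phi x) ^+ 2)%:E < +oo)%E].

Definition jap (R : realType) (k : int) : R := Num.sqrt (1 + k%:~R ^+ 2).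

Definition Gnorm (R : realType) (delta s : R) (phi : R -> R[i]) : \bar R :=
  sqrte (\esum_(k in [set: int])
    (jap R k `^ (2 * s) * expR (4 * pi * delta * `|k%:~R|)
       * cabs (fhat phi k) ^+ 2)%:E).

(* The complexification of G^{delta,s}; a real-valued phi belongs to
   G^{delta,s} iff [GC delta s (toC phi)]. *)
Definition GC (R : realType) (delta s : R) (phi : R -> R[i]) : Prop :=
  L2circle phi /\ (Gnorm delta s phi < +oo)%E.

Definition G (R : realType) (delta s : R) (phi : R -> R) : Prop :=
  GC delta s (toC phi).

Definition Aspace (R : realType) (delta : R) (f : R -> R) : Prop :=
  periodic1 f /\
  exists F : R[i]^o -> R[i]^o,
    (forall z : R[i]^o, `|complex.Im z| < delta -> derivable F z 1) /\
    (forall x : R, F x%:C = (f x)%:C).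

(* Inclusion of spaces of L^2 classes: every element of G^{delta,s} has a
   representative in A(delta). *)
Definition G_sub_A (R : realType) (delta s : R) : Prop :=
  forall phi : R -> R, G delta s phi ->
    exists f : R -> R, Aspace delta f /\
      {ae lebesgue_measure, forall x, phi x = f x}.

Definition real_analytic_circle (R : realType) (f : R -> R) : Prop :=
  periodic1 f /\
  forall x0 : R, exists (a : nat -> R) (r : R), 0 < r /\
    forall x : R, `|x - x0| < r -> pseries a (x - x0) @ \oo --> f x.

Definition admissible (R : realType) (u0 : R -> R) (Delta : R) : Prop :=
  0 < Delta /\
  forall s : R, 0 <= s -> G Delta (s + 1) u0 /\ G_sub_A Delta (s + 1).

Definition is_dx (R : realType) (phi psi : R -> R[i]) : Prop :=
  forall x : R,
    is_derive x 1 (fun y => complex.Re (phi y)) (complex.Re (psi x)) /\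
    is_derive x 1 (fun y => complex.Im (phi y)) (complex.Im (psi x)).

(* The sum over k <> 0 is taken as the limit of the symmetric partial sums
   over 0 < |k| <= N. *)
Definition Ainv (R : realType) (phi : R -> R[i]) (x : R) : R[i] :=
  fhat phi 0 +
  limn (fun N : nat => \sum_(1 <= k < N.+1)
    (fhat phi k%:Z / (2 * pi * k%:R)%:C ^+ 2 * expi (2 * k%:R * pi * x)
     + fhat phi (- k%:Z) / (2 * pi * k%:R)%:C ^+ 2
         * expi (- (2 * k%:R * pi * x))) : R[i]^o).

(* For delta > 0 every class in (the complexification of) G^{delta,s} has
   exactly one continuous representative. An element is given here by that
   representative, so that equality of elements is equality of functions and
   the derivatives in x are classical. *)
Definition GCc (R : realType) (delta s : R) (phi : R -> R[i]) : Prop :=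
  [/\ GC delta s phi,
      continuous (fun x => complex.Re (phi x)) &
      continuous (fun x => complex.Im (phi x))].

(* v is the complex derivative at t of u in the norm of G^{delta,s}. *)
Definition is_dt (R : realType) (delta s : R) (u : R[i] -> R -> R[i])
    (t : R[i]) (v : R -> R[i]) : Prop :=
  GCc delta s v /\
  Gnorm delta s (fun x => (u (t + h) x - u t x) / h - v x)
    @[h --> (0 : R[i]^o)^'] --> 0%E.

Definition holomorphic_G (R : realType) (delta s r : R)
    (u : R[i] -> R -> R[i]) : Prop :=
  forall t : R[i], cabs t < r ->
    GCc delta s (u t) /\ exists v, is_dt delta s u t v.

Definition satisfies_eq (R : realType) (phi phit : R -> R[i]) : Prop :=
  exists phix w : R -> R[i],
    [/\ is_dx phi phix,
        is_dx (Ainv (fun x => 2 * cint phi * phi x + 2^-1 * phix x ^+ 2)) w &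
        forall x, phit x + phi x * phix x + w x = 0].

(* u is only relevant on the disk D(0,r). *)
Definition holomorphic_solution (R : realType) (delta s r : R) (u0 : R -> R)
    (u : R[i] -> R -> R[i]) : Prop :=
  [/\ holomorphic_G delta s r u,
      (forall x, u 0 x = (u0 x)%:C) &
      forall (t : R[i]) (v : R -> R[i]), cabs t < r ->
        is_dt delta s u t v -> satisfies_eq (u t) v].

(* Main.v *)
Require Import Defs.
From HB Require Import structures.
From mathcomp Require Import all_boot all_order all_algebra.
From mathcomp Require Import complex.
From mathcomp Require finmap.
From mathcomp Require Import all_classical all_reals all_analysis.
From mathcomp Require Import ring lra zify.

(** The unknown is replaced by its sequence of Fourier coefficients. On the
    k-th coefficient the equation reads u_k' = Bil u u k, a convolution whose
    symbol (bsym) is bounded by the product of the two frequencies (beta_le):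
    each factor loses one derivative and nothing else. In the weighted l1 norm
    Nw d, with weight (1+|k|) exp(2 pi d |k|), a derivative costs an
    arbitrarily small decrease e of the radius d and a factor of order 1/e
    (om_le_exp), and so does the whole nonlinearity (Bil_bound). This is the
    setting of the autonomous Cauchy-Kovalevskaya theorem.

    Existence is a power series in t, whose coefficients are forced by the
    equation (ucoef). A majorant argument, losing the fraction 1/(n+2) of the
    available radius at order n, shows that the n-th coefficient has norm at
    most M (K M / (Delta - r))^n / (n+1)^2 in radius r, where M bounds the norm
    of the datum in radius Delta and K depends on Delta only (ucoef_bound). For
    r = Delta d the series therefore converges if |t| < T (1 - d) with T =
    Delta / (K M), which is where the form of the lifespan comes from, and it
    solves the equation coefficientwise (flow_ode).

    For uniqueness, two solutions are compared along the segment from 0 to t.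
    Their difference solves a linear equation with coefficients bounded in a
    fixed radius; iterating the integral inequality in the scale of norms gives
    bounds of order q^n with q < 1 on short subsegments whose length does not
    depend on the starting point, so the difference vanishes from one
    subsegment to the next (uniq_bound, uniq_line). Compactness of the segment
    provides the bound on the coefficients.

    The translation between functions and coefficients rests on three facts. A
    continuous function, or up to a null set an integrable one, is determined
    by its Fourier coefficients (fhat_inj_cont, fhat_inj_ae): polynomials in a
    trigonometric polynomial of degree one approximate the indicator functions
    of arcs, so a function orthogonal to all the characters has zero primitive.
    The Gevrey norms and the norms Nw dominate each other after a loss of
    radius (Gn_Nw, Nw_Gn_loss), and for s > 1/2 the norm of index s + 1
    dominates Nw in the same radius by the Cauchy-Schwarz inequality (Nw_Gn),
    which makes M a constant times the norm of the datum. Finally the equation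
    holds for functions if and only if it holds for coefficients
    (satisfies_eqP).

    A real-analytic function on the circle has n-th derivatives bounded by N n!
    N^n, by Cauchy estimates on power series and compactness (analytic_bound);
    n integrations by parts and a summation against the exponential series give
    the exponential decay of its Fourier coefficients (analytic_decay).
    Conversely exponential decay makes the Fourier series holomorphic in a
    strip (synthz_cdiff, G_sub_analytic). *)

Set Implicit Arguments.
Unset Strict Implicit.
Unset Printing Implicit Defensive.

Import Order.TTheory GRing.Theory Num.Theory.
Import numFieldNormedType.Exports.
Import ComplexField.Normc.

Local Open Scope classical_set_scope.
Local Open Scope ring_scope.
Local Open Scope complex_scope.

Local Notation Re := complex.Re.
Local Notation Im := complex.Im.

Arguments cabs : simpl never.

(** * Absolutely convergent complex sums *)

Lemma eq_le_imp disp (T : porderType disp) (x y : T) : x = y -> (x <= y)%O.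
Proof. by move=> ->. Qed.

Section Cabs.
Variable R : realType.
Implicit Types z w : R[i].

Lemma normr_cabs z : `|z| = (cabs z)%:C.
Proof. by []. Qed.

Lemma cabs_ge0 z : 0 <= cabs z.
Proof. by rewrite -lecR -normr_cabs; exact: normr_ge0. Qed.

Lemma cabs0 : cabs (0 : R[i]) = 0.
Proof. exact: normc0. Qed.

Lemma cabs1 : cabs (1 : R[i]) = 1.
Proof. exact: normc1. Qed.

Lemma cabs_eq0 z : cabs z = 0 -> z = 0.
Proof. exact: eq0_normc. Qed.

Lemma cabsM z w : cabs (z * w) = cabs z * cabs w.
Proof. exact: normcM. Qed.

Lemma cabsV z : cabs z^-1 = (cabs z)^-1.
Proof. exact: normcV. Qed.

Lemma cabsN z : cabs (- z) = cabs z.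
Proof. exact: normcN. Qed.

Lemma cabsD z w : cabs (z + w) <= cabs z + cabs w.
Proof. exact: le_normcD. Qed.

Lemma cabsB z w : cabs (z - w) <= cabs z + cabs w.
Proof. by rewrite -[cabs w]cabsN cabsD. Qed.

Lemma cabsX z n : cabs (z ^+ n) = cabs z ^+ n.
Proof. by elim: n => [|n IH]; rewrite ?cabs1// !exprS cabsM IH. Qed.

Lemma cabsR (x : R) : cabs x%:C = `|x|.
Proof. by rewrite /cabs /= expr0n addr0 sqrtr_sqr. Qed.

Lemma cabsn (n : nat) : cabs (n%:R : R[i]) = n%:R.
Proof. by rewrite -(rmorph_nat (real_complex R)) cabsR normr_nat. Qed.

Lemma cabs_Re z : `|Re z| <= cabs z.
Proof. by rewrite -lecR; exact: normc_ge_Re. Qed.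

Lemma cabs_Im z : `|Im z| <= cabs z.
Proof.
case: z => a b /=; rewrite -sqrtr_sqr.
by rewrite /cabs /= ler_wsqrtr// lerDr sqr_ge0.
Qed.

Lemma cabs_sum I (s : seq I) (F : I -> R[i]) :
  cabs (\sum_(i <- s) F i) <= \sum_(i <- s) cabs (F i).
Proof.
elim: s => [|i s IH]; first by rewrite !big_nil cabs0.
by rewrite !big_cons (le_trans (cabsD _ _))// lerD2l.
Qed.

Lemma cReD z w : Re (z + w) = Re z + Re w. Proof. by case: z w => [? ?] []. Qed.
Lemma cImD z w : Im (z + w) = Im z + Im w. Proof. by case: z w => [? ?] []. Qed.
Lemma cReN z : Re (- z) = - Re z. Proof. by case: z. Qed.
Lemma cImN z : Im (- z) = - Im z. Proof. by case: z. Qed.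
Lemma cReM z w : Re (z * w) = Re z * Re w - Im z * Im w.
Proof. by case: z w => [? ?] []. Qed.
Lemma cImM z w : Im (z * w) = Re z * Im w + Im z * Re w.
Proof. by case: z w => [? ?] []. Qed.

Lemma cabs_ReIm z : cabs z <= `|Re z| + `|Im z|.
Proof.
have -> : z = (Re z)%:C + 'i * (Im z)%:C by rewrite -complexE.
rewrite (le_trans (cabsD _ _))// cabsM !cabsR.
rewrite [X in _ <= `|X| + `|_|](_ : _ = Re z); last first.
  by case: z => a b /=; rewrite !(mul0r, mulr0, subr0, addr0, mul1r, add0r).
rewrite [X in _ <= _ + `|X|](_ : _ = Im z); last first.
  by case: z => a b /=; rewrite !(mul0r, mulr0, subr0, addr0, mul1r, add0r).
rewrite lerD2l (_ : cabs 'i = 1) ?mul1r//.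
by rewrite /cabs /= expr0n expr1n add0r sqrtr1.
Qed.

(** Multiplication by a unit complex number makes a given sum real and
    nonnegative; bounds on moduli of sums then follow from bounds on sums of
    real parts. *)
Lemma cabs_rot z : exists2 w : R[i], cabs w = 1 & w * z = (cabs z)%:C.
Proof.
have [->|z0] := eqVneq z 0.
  by exists 1; [exact: cabs1|rewrite mulr0 cabs0].
have cz : cabs z != 0 by apply: contra z0 => /eqP/cabs_eq0 ->.
exists ((cabs z)%:C / z); last by rewrite mulfVK.
by rewrite cabsM cabsV cabsR ger0_norm ?cabs_ge0// mulfV.
Qed.

End Cabs.

Section Sums.
Variable R : realType.

Lemma le_esum_term (T : choiceType) (F : T -> \bar R) a :
  (F a <= \esum_(x in [set: T]) F x)%E.
Proof.
apply: esum_ge; exists [set a]; last by rewrite fsbig_set1.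
by split => //; exact: finite_set1.
Qed.

Section Csum.
Variable T : choiceType.
Implicit Types f g : T -> R[i].

Definition esumR (f : T -> R) : \bar R := \esum_(x in [set: T]) (f x)%:E.

Definition ell1 f : \bar R := esumR (fun x => cabs (f x)).

Definition summ f := (ell1 f < +oo)%E.

(** A sum over an arbitrary index type is a difference of two nonnegative
    extended sums: no enumeration is chosen, so that reindexing and Fubini hold
    for every index type. The value is meaningful for absolutely summable
    families only. *)
Definition rsum (f : T -> R) : R :=
  fine (esumR (fun x => Num.max (f x) 0)) -
  fine (esumR (fun x => Num.max (- f x) 0)).

Definition csum f : R[i] := rsum (fun x => Re (f x)) +i* rsum (fun x => Im (f x)).

Lemma esumR_ge0 (f : T -> R) : (forall x, 0 <= f x) -> (0 <= esumR f)%E.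
Proof. by move=> f0; apply: esum_ge0 => x _; rewrite lee_fin. Qed.

Lemma le_esumR (f g : T -> R) : (forall x, f x <= g x) -> (esumR f <= esumR g)%E.
Proof. by move=> fg; apply: le_esum => x _; rewrite lee_fin. Qed.

Lemma esumRD (f g : T -> R) : (forall x, 0 <= f x) -> (forall x, 0 <= g x) ->
  esumR (fun x => f x + g x) = (esumR f + esumR g)%E.
Proof. by move=> f0 g0; rewrite /esumR -esumD// => x _; rewrite lee_fin. Qed.

Lemma esumRZ (c : R) (f : T -> R) : 0 <= c -> (forall x, 0 <= f x) ->
  esumR (fun x => c * f x) = (c%:E * esumR f)%E.
Proof.
have le (d : R) (g : T -> R) : 0 <= d -> (forall x, 0 <= g x) ->
    (esumR (fun x => (d * g x)%R) <= d%:E * esumR g)%E.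
  move=> d0 g0; apply: ge_ereal_sup => /= _ [X [finX XI]] <-.
  rewrite fsbig_finite//=; under eq_bigr do rewrite EFinM.
  rewrite -ge0_sume_distrr; last by move=> x _; rewrite lee_fin.
  apply: lee_wpmul2l; first by rewrite lee_fin.
  by rewrite -fsbig_finite//; apply: ereal_sup_ubound; exists X.
move=> c0 f0; apply/eqP; rewrite eq_le le//=.
rewrite le_eqVlt in c0; case/orP: c0 => [/eqP<-|c0].
  by rewrite mul0e; apply: esumR_ge0 => x; rewrite mul0r.
have := le c^-1 (fun x => c * f x).
rewrite invr_ge0 ltW// => /(_ isT) H.
have {H} : (esumR f <= c^-1%:E * esumR (fun x => (c * f x)%R))%E.
  rewrite {1}(_ : f = fun x => c^-1 * (c * f x)).
    by apply: H => x; rewrite mulr_ge0// ltW.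
  by apply/funext => x; rewrite mulKf// gt_eqF.
move=> /(lee_wpmul2l (x := c%:E)); rewrite lee_fin (ltW c0) => /(_ isT).
by rewrite muleA -EFinM mulfV ?mul1e// gt_eqF.
Qed.

Lemma esumR_fin (f : T -> R) : (forall x, 0 <= f x) -> (esumR f < +oo)%E ->
  esumR f = (fine (esumR f))%:E.
Proof. by move=> f0 foo; rewrite fineK// ge0_fin_numE// esumR_ge0. Qed.

Lemma le_esumR_fin (f g : T -> R) : (forall x, f x <= g x) ->
  (esumR g < +oo)%E -> (esumR f < +oo)%E.
Proof. by move=> fg; apply: le_lt_trans; exact: le_esumR. Qed.

Lemma esumR_term (f : T -> R) a : ((f a)%:E <= esumR f)%E.
Proof. exact: le_esum_term. Qed.

Lemma esumR_seq (f : T -> R) (s : seq T) : uniq s -> (forall x, 0 <= f x) ->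
  ((\sum_(x <- s) f x)%:E <= esumR f)%E.
Proof.
move=> us f0; apply: esum_ge; exists [set` s].
  by split => //; exact: finite_seq.
by rewrite -sumEFin -fsbig_seq.
Qed.

Lemma ge_esumR (f : T -> R) (M : \bar R) : (forall x, 0 <= f x) ->
  (forall s : seq T, uniq s -> ((\sum_(x <- s) f x)%:E <= M)%E) ->
  (esumR f <= M)%E.
Proof.
move=> f0 H; apply: ge_ereal_sup => /= _ [X [finX XI]] <-.
by rewrite fsbig_finite//= sumEFin; apply: H; exact: finmap.fset_uniq.
Qed.

(** Any decomposition into nonnegative summable parts has the same value;
    linearity is proved by picking a convenient one. *)
Lemma rsumE (f g : T -> R) : (forall x, 0 <= f x) -> (forall x, 0 <= g x) ->
  (esumR f < +oo)%E -> (esumR g < +oo)%E ->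
  rsum (fun x => f x - g x) = fine (esumR f) - fine (esumR g).
Proof.
move=> f0 g0 fo go.
have S (h : T -> R) : (forall x, 0 <= h x) -> (esumR h < +oo)%E ->
    summable [set: T] (fun x => (h x)%:E).
  move=> h0 ho; rewrite /summable (eq_esum (b := fun x => (h x)%:E))//.
  by move=> x _; rewrite /= ger0_norm.
have p0 (h : R) : 0 <= Num.max h 0 by rewrite le_max lexx orbT.
have := esumB (S f f0 fo) (S g g0 go) (fun x _ => f0 x) (fun x _ => g0 x).
rewrite -/(esumR f) -/(esumR g) (esumR_fin f0 fo) (esumR_fin g0 go).
set P := \esum_(i in _) _; set Q := \esum_(i in _) _ => E.
have PE : P = esumR (fun x => Num.max (f x - g x) 0).
  by apply: eq_esum => x _; rewrite funeposE -EFin_max.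
have QE : Q = esumR (fun x => Num.max (- (f x - g x)) 0).
  by apply: eq_esum => x _; rewrite funenegE -EFin_max.
have Po : (P < +oo)%E.
  rewrite PE; apply: le_esumR_fin fo => x; rewrite ge_max f0 andbT.
  by rewrite lerBlDr lerDl.
have Qo : (Q < +oo)%E.
  rewrite QE; apply: le_esumR_fin go => x; rewrite ge_max g0 andbT.
  by rewrite opprB lerBlDr lerDl.
have fP : P = (fine P)%:E by rewrite {1}PE esumR_fin -?PE.
have fQ : Q = (fine Q)%:E by rewrite {1}QE esumR_fin -?QE.
by move: E; rewrite fP fQ -!EFinB => -[E]; rewrite /rsum -PE -QE -E.
Qed.

Lemma eq_rsum (f g : T -> R) : (forall x, f x = g x) -> rsum f = rsum g.
Proof. by move=> /funext ->. Qed.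

Lemma eq_csum f g : (forall x, f x = g x) -> csum f = csum g.
Proof. by move=> /funext ->. Qed.

Let pos (f : T -> R) x := Num.max (f x) 0.
Let neg (f : T -> R) x := Num.max (- f x) 0.

Let pos_ge0 (f : T -> R) x : 0 <= pos f x. Proof. by rewrite le_max lexx orbT. Qed.
Let neg_ge0 (f : T -> R) x : 0 <= neg f x. Proof. by rewrite le_max lexx orbT. Qed.
Let pos_le (f : T -> R) x : pos f x <= `|f x|.
Proof. by rewrite ge_max ler_norm normr_ge0. Qed.
Let neg_le (f : T -> R) x : neg f x <= `|f x|.
Proof. by rewrite /neg ge_max normr_ge0 andbT -normrN ler_norm. Qed.
Let posneg (f : T -> R) x : f x = pos f x - neg f x.
Proof.
rewrite /pos /neg; case: (leP 0 (f x)) => f0.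
  by rewrite (max_r (x := - f x)) ?subr0// oppr_le0.
by rewrite (max_l (x := - f x)) ?sub0r ?opprK// oppr_ge0 ltW.
Qed.

Definition rsummable (f : T -> R) := (esumR (fun x => `|f x|%R) < +oo)%E.

Let pos_fin (f : T -> R) : rsummable f -> (esumR (pos f) < +oo)%E.
Proof. exact: le_esumR_fin. Qed.
Let neg_fin (f : T -> R) : rsummable f -> (esumR (neg f) < +oo)%E.
Proof. exact: le_esumR_fin. Qed.

Lemma rsumD (f g : T -> R) : rsummable f -> rsummable g ->
  rsum (fun x => f x + g x) = rsum f + rsum g.
Proof.
move=> sf sg.
rewrite (eq_rsum (g := fun x => (pos f x + pos g x) - (neg f x + neg g x))).
  rewrite rsumE; last 4 first.
  - by move=> x; rewrite addr_ge0.
  - by move=> x; rewrite addr_ge0.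
  - by rewrite esumRD// lte_add_pinfty ?pos_fin.
  - by rewrite esumRD// lte_add_pinfty ?neg_fin.
  rewrite !esumRD//.
  rewrite (esumR_fin (pos_ge0 f)) ?pos_fin// (esumR_fin (pos_ge0 g)) ?pos_fin//.
  rewrite (esumR_fin (neg_ge0 f)) ?neg_fin// (esumR_fin (neg_ge0 g)) ?neg_fin//.
  by rewrite /rsum -/(pos f) -/(neg f) -/(pos g) -/(neg g) /=; ring.
by move=> x; rewrite (posneg f) (posneg g); ring.
Qed.

Lemma rsumN (f : T -> R) : rsum (fun x => - f x) = - rsum f.
Proof. by rewrite /rsum opprB; congr (_ - fine (esumR _)); apply/funext => x; rewrite opprK. Qed.

Lemma rsumZ (c : R) (f : T -> R) : rsummable f ->
  rsum (fun x => c * f x) = c * rsum f.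
Proof.
move=> sf.
wlog c0 : c / 0 <= c => [H|].
  case: (leP 0 c) => c0; first exact: H.
  have := H (- c); rewrite oppr_ge0 (ltW c0) => /(_ isT) E.
  rewrite -[LHS]opprK -rsumN (eq_rsum (g := fun x => - c * f x)).
    by rewrite E mulNr opprK.
  by move=> x; rewrite mulNr.
rewrite (eq_rsum (g := fun x => c * pos f x - c * neg f x)).
  rewrite rsumE; last 4 first.
  - by move=> x; rewrite mulr_ge0.
  - by move=> x; rewrite mulr_ge0.
  - by rewrite esumRZ// (esumR_fin (pos_ge0 f)) ?pos_fin// ltry.
  - by rewrite esumRZ// (esumR_fin (neg_ge0 f)) ?neg_fin// ltry.
  rewrite !esumRZ//.
  rewrite (esumR_fin (pos_ge0 f)) ?pos_fin// (esumR_fin (neg_ge0 f)) ?neg_fin//.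
  by rewrite /rsum -/(pos f) -/(neg f) /= mulrBr.
by move=> x; rewrite {1}(posneg f) mulrBr.
Qed.

Lemma summ_Re f : summ f -> rsummable (fun x => Re (f x)).
Proof. by apply: le_esumR_fin => x; exact: cabs_Re. Qed.

Lemma summ_Im f : summ f -> rsummable (fun x => Im (f x)).
Proof. by apply: le_esumR_fin => x; exact: cabs_Im. Qed.

Lemma rsummableZ c (f : T -> R) : rsummable f -> rsummable (fun x => c * f x).
Proof.
move=> sf; rewrite /rsummable.
under eq_fun do rewrite normrM.
by rewrite esumRZ// (esumR_fin _ sf)// ltry.
Qed.

Lemma rsum_norm (f : T -> R) : (`|rsum f|%:E <= esumR (fun x => `|f x|%R))%E.
Proof.
have [sf|] := ltP (esumR (fun x => `|f x|%R)) +oo%E; last first.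
  by rewrite leye_eq => /eqP ->; rewrite leey.
rewrite (esumR_fin _ sf)// lee_fin.
have Hp : fine (esumR (pos f)) + fine (esumR (neg f)) = fine (esumR (fun x => `|f x|)).
  have sf' : rsummable f by [].
  have fp := esumR_fin (pos_ge0 f) (pos_fin sf').
  have fn := esumR_fin (neg_ge0 f) (neg_fin sf').
  rewrite -[LHS]/(fine (_%:E + _%:E)%E) -fp -fn -esumRD//.
  congr (fine (esumR _)); apply/funext => x.
  rewrite /pos /neg; case: (leP 0 (f x)) => f0.
    by rewrite (max_r (x := - f x)) ?addr0 ?ger0_norm// oppr_le0.
  by rewrite (max_l (x := - f x)) ?add0r ?ltr0_norm// oppr_ge0 ltW.
rewrite -Hp /rsum -/(pos f) -/(neg f) (le_trans (ler_normB _ _))//.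
by rewrite !ger0_norm ?fine_ge0 ?esumR_ge0.
Qed.

Lemma ge0_rsum (f : T -> R) : (forall x, 0 <= f x) -> rsum f = fine (esumR f).
Proof.
move=> f0; rewrite /rsum (_ : (fun x => Num.max (f x) 0) = f).
  rewrite (_ : (fun x => Num.max (- f x) 0) = fun=> 0); last first.
    by apply/funext => x; rewrite max_r// oppr_le0.
  by rewrite (_ : esumR (fun=> 0) = 0%E) ?subr0//; apply: esum1.
by apply/funext => x; rewrite max_l.
Qed.

Lemma summD f g : summ f -> summ g -> summ (fun x => f x + g x).
Proof.
move=> sf sg; apply: (@le_esumR_fin _ (fun x => cabs (f x) + cabs (g x))).
  by move=> x; exact: cabsD.
by rewrite esumRD ?lte_add_pinfty// => x; exact: cabs_ge0.
Qed.

Lemma ell1Z c f : ell1 (fun x => c * f x) = ((cabs c)%:E * ell1 f)%E.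
Proof.
rewrite /ell1 -esumRZ ?cabs_ge0//; last by move=> x; exact: cabs_ge0.
by congr esumR; apply/funext => x; rewrite cabsM.
Qed.

Lemma ell1_fin f : summ f -> ell1 f = (fine (ell1 f))%:E.
Proof. by move=> sf; rewrite {1}/ell1 esumR_fin// => x; exact: cabs_ge0. Qed.

Lemma ell1_ge0 f : (0 <= ell1 f)%E.
Proof. by apply: esumR_ge0 => x; exact: cabs_ge0. Qed.

Lemma summZ c f : summ f -> summ (fun x => c * f x).
Proof. by move=> sf; rewrite /summ ell1Z (ell1_fin sf) ltry. Qed.

Lemma summN f : summ f -> summ (fun x => - f x).
Proof.
by move=> sf; rewrite /summ/ell1; under eq_fun do rewrite cabsN.
Qed.

Lemma le_summ f g : (forall x, cabs (f x) <= cabs (g x)) -> summ g -> summ f.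
Proof. exact: le_esumR_fin. Qed.

Lemma csumD f g : summ f -> summ g ->
  csum (fun x => f x + g x) = csum f + csum g.
Proof.
move=> sf sg; rewrite /csum.
rewrite (eq_rsum (fun x => cReD (f x) (g x))) (eq_rsum (fun x => cImD (f x) (g x))).
by rewrite !rsumD//; [exact: summ_Im|exact: summ_Im|exact: summ_Re|exact: summ_Re].
Qed.

Lemma csumN f : csum (fun x => - f x) = - csum f.
Proof.
rewrite /csum (eq_rsum (fun x => cReN (f x))) (eq_rsum (fun x => cImN (f x))).
by rewrite !rsumN.
Qed.

Lemma csumB f g : summ f -> summ g ->
  csum (fun x => f x - g x) = csum f - csum g.
Proof. by move=> sf sg; rewrite csumD ?csumN//; exact: summN. Qed.

Lemma csumZ c f : summ f -> csum (fun x => c * f x) = c * csum f.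
Proof.
move=> sf; rewrite /csum.
rewrite (eq_rsum (fun x => cReM c (f x))) (eq_rsum (fun x => cImM c (f x))).
have sR := summ_Re sf; have sI := summ_Im sf.
have sN : rsummable (fun x => - (Im c * Im (f x))).
  have := rsummableZ (Im c) sI; rewrite /rsummable.
  by under eq_fun do rewrite -normrN.
rewrite (rsumD (rsummableZ (Re c) sR) sN) rsumN (rsumZ _ sR) (rsumZ _ sI).
rewrite (rsumD (rsummableZ (Re c) sI) (rsummableZ (Im c) sR)).
by rewrite (rsumZ _ sR) (rsumZ _ sI); case: c {sN}.
Qed.

(** Rotate the total onto the positive axis: it becomes a sum of real parts,
    each at most the modulus of its term. *)
Lemma csum_cabs f : ((cabs (csum f))%:E <= ell1 f)%E.
Proof.
have [sf|] := ltP (ell1 f) +oo%E; last first.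
  by rewrite leye_eq => /eqP ->; rewrite leey.
have [w w1 Hw] := cabs_rot (csum f).
have -> : cabs (csum f) = rsum (fun x => Re (w * f x)).
  by have := csumZ w sf; rewrite Hw /csum => -[].
apply: (@le_trans _ _ (`|rsum (fun x => Re (w * f x))|%:E)).
  by rewrite lee_fin ler_norm.
apply: (le_trans (rsum_norm _)); apply: le_esumR => x.
by rewrite (le_trans (cabs_Re _))// cabsM w1 mul1r.
Qed.

Lemma csum_le f (M : R) : (ell1 f <= M%:E)%E -> cabs (csum f) <= M.
Proof. by move=> H; rewrite -lee_fin (le_trans (csum_cabs _)). Qed.

Lemma summ0 : summ (fun _ : T => 0).
Proof. by rewrite /summ/ell1/esumR esum1// => x _; rewrite cabs0. Qed.

Lemma csum0 : csum (fun _ : T => 0) = 0.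
Proof.
rewrite -[RHS](mul0r (csum (fun _ : T => 0))) -(csumZ 0 summ0).
by apply: eq_csum => x; rewrite mul0r.
Qed.

Lemma csum_sum I (s : seq I) (F : I -> T -> R[i]) :
  (forall i, summ (F i)) ->
  summ (fun x => \sum_(i <- s) F i x) /\
  csum (fun x => \sum_(i <- s) F i x) = \sum_(i <- s) csum (F i).
Proof.
move=> sF; elim: s => [|i s [IH1 IH2]].
  split; first by under eq_fun do rewrite big_nil; exact: summ0.
  by rewrite big_nil -[RHS]csum0; apply: eq_csum => x; rewrite big_nil.
split; first by under eq_fun do rewrite big_cons; exact: summD.
rewrite big_cons -IH2 -csumD//; apply: eq_csum => x; by rewrite big_cons.
Qed.

Lemma summ_pred1 a (c : R[i]) : summ (fun x => if x == a then c else 0) /\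
  csum (fun x => if x == a then c else 0) = c.
Proof.
have E (d : R) : 0 <= d -> esumR (fun x => if x == a then d else 0) = d%:E.
  move=> d0; rewrite -[RHS](@esum_set1 _ _ a (fun=> d%:E)) ?lee_fin//.
  rewrite [RHS]esum_mkcond; apply: eq_esum => x _.
  by rewrite in_set1 /=; case: ifP.
have s1 (b : R[i]) : summ (fun x => if x == a then b else 0).
  rewrite /summ /ell1 (_ : (fun x => _) = fun x => if x == a then cabs b else 0).
    by rewrite E ?ltry// cabs_ge0.
  by apply/funext => x; case: eqP; rewrite ?cabs0.
split => //.
rewrite (eq_csum (g := fun x => c * (if x == a then 1 else 0))).
  rewrite csumZ//; suff -> : csum (fun x => if x == a then 1 else 0) = 1 by rewrite mulr1.
  rewrite /csum !ge0_rsum; last 2 first.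
  - by move=> x; case: ifP.
  - by move=> x; case: ifP => //=; rewrite ler01.
  rewrite (_ : (fun x => _) = fun x => if x == a then 1 else 0); last first.
    by apply/funext => x; case: ifP.
  rewrite E ?ler01// (_ : (fun x => _) = fun=> 0); last first.
    by apply/funext => x; case: ifP.
  by rewrite /esumR esum1.
by move=> x; case: eqP; rewrite ?mulr1 ?mulr0.
Qed.

Lemma csum_seq f (s : seq T) : uniq s ->
  summ (fun x => if x \in s then f x else 0) /\
  csum (fun x => if x \in s then f x else 0) = \sum_(x <- s) f x.
Proof.
move=> us.
have -> : (fun x => if x \in s then f x else 0) =
    fun x => \sum_(y <- s) (if x == y then f y else 0).
  apply/funext => x; case: ifPn => xs.
    rewrite (bigD1_seq x)//= eqxx big1 ?addr0// => y; rewrite eq_sym.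
    by move=> /negPf ->.
  rewrite big_seq big1// => y ys; case: eqP => // E; by rewrite E ys in xs.
have [H1 H2] := csum_sum s (fun y => (summ_pred1 y (f y)).1).
by split => //; rewrite H2; apply: eq_bigr => y _; rewrite (summ_pred1 _ _).2.
Qed.

(** The finite set is chosen to leave an absolute tail below e. The tail bound
    is part of the conclusion because it also serves the families with terms of
    the same moduli, such as a Fourier series at all points simultaneously. *)
Lemma csum_approx f : summ f -> forall e : R, 0 < e ->
  exists2 s : seq T, uniq s &
  forall s', uniq s' -> {subset s <= s'} ->
    (ell1 (fun x => if x \in s' then 0%R else f x) <= e%:E)%E /\
    cabs (csum f - \sum_(x <- s') f x) <= e.
Proof.
move=> sf e e0.
have [s us Hs] : exists2 s : seq T, uniq s &
    (ell1 f - e%:E <= (\sum_(x <- s) cabs (f x))%:E)%E.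
  apply: contrapT => H.
  have : (ell1 f <= ell1 f - e%:E)%E.
    apply: ge_esumR => [x|s us]; first exact: cabs_ge0.
    rewrite leNgt; apply/negP => h; apply: H; exists s => //; exact: ltW.
  by rewrite (ell1_fin sf) -EFinB lee_fin lerBDr gerDl leNgt e0.
exists s => // s' us' ss'.
have H1 : (ell1 (fun x => if x \in s' then 0%R else f x) <= e%:E)%E.
  have E : ell1 f = (ell1 (fun x => if x \in s' then 0%R else f x) +
                     ell1 (fun x => if x \in s' then f x else 0%R))%E.
    rewrite /ell1 -esumRD; try by move=> x; exact: cabs_ge0.
    congr esumR; apply/funext => x.
    by case: ifP; rewrite cabs0 ?add0r ?addr0.
  have L : ((\sum_(x <- s) cabs (f x))%:E <=
      ell1 (fun x => if x \in s' then f x else 0%R))%E.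
    rewrite (eq_big_seq (fun x => cabs (if x \in s' then f x else 0))).
      by apply: esumR_seq => // x; exact: cabs_ge0.
    by move=> x /ss' ->.
  have /ell1_fin F1 : summ (fun x => if x \in s' then 0%R else f x).
    by apply: le_summ sf => x; case: ifP => // _; rewrite cabs0 cabs_ge0.
  have /ell1_fin F2 : summ (fun x => if x \in s' then f x else 0%R).
    by apply: le_summ sf => x; case: ifP => // _; rewrite cabs0 cabs_ge0.
  rewrite F1 F2 (ell1_fin sf) -EFinD in E; case: E => E.
  rewrite (ell1_fin sf) -EFinB lee_fin E in Hs; rewrite F2 lee_fin in L.
  rewrite F1 lee_fin -(lerD2r (fine (ell1 (fun x => if x \in s' then f x else 0%R)))).
  by rewrite -lerBlDl (le_trans _ L)// (le_trans _ Hs).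
split => //; have [S1 S2] := csum_seq f us'.
rewrite -S2 -csumB//; apply: csum_le; apply: le_trans H1.
apply: le_esumR => x; case: ifP; by rewrite ?subrr ?subr0.
Qed.

End Csum.

Arguments csum : simpl never.

Lemma esumR_pair (A B : choiceType) (f : A * B -> R) : (forall p, 0 <= f p) ->
  esumR f = \esum_(a in [set: A]) esumR (fun b => f (a, b)).
Proof.
move=> f0; rewrite /esumR esum_esum; last by move=> *; rewrite lee_fin.
rewrite (_ : [set: A] `*`` (fun=> [set: B]) = setT).
  by apply: eq_esum => -[].
by apply/seteqP; split.
Qed.

Lemma esumR_reindex (A B : choiceType) (g : A -> B) (f : B -> R) : bijective g ->
  esumR f = esumR (fun a => f (g a)).
Proof.
move=> [h gK hK]; apply: (@reindex_esum _ _ _ setT setT g (fun x => (f x)%:E)).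
split => //; first by move=> x y _ _; exact: (can_inj gK).
by move=> b _; exists (h b).
Qed.

Lemma csum_reindex (A B : choiceType) (g : A -> B) (f : B -> R[i]) :
  bijective g -> csum f = csum (fun a => f (g a)).
Proof. by move=> bg; rewrite /csum /rsum !(esumR_reindex _ bg). Qed.

Lemma ell1_reindex (A B : choiceType) (g : A -> B) (f : B -> R[i]) :
  bijective g -> ell1 f = ell1 (fun a => f (g a)).
Proof. by move=> bg; rewrite /ell1 (esumR_reindex _ bg). Qed.

Lemma swap_bij (A B : choiceType) : bijective (fun p : A * B => (p.2, p.1)).
Proof. by exists (fun p => (p.2, p.1)) => -[]. Qed.

Lemma ell1_pair (A B : choiceType) (f : A * B -> R[i]) :
  ell1 f = \esum_(a in [set: A]) ell1 (fun b => f (a, b)).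
Proof. by rewrite /ell1 esumR_pair// => p; exact: cabs_ge0. Qed.

Lemma summ_slice (A B : choiceType) (f : A * B -> R[i]) a :
  summ f -> summ (fun b => f (a, b)).
Proof.
rewrite /summ ell1_pair; apply: le_lt_trans.
exact: le_esum_term.
Qed.

(** Tonelli for the positive and for the negative part. *)
Lemma rsum_pair (A B : choiceType) (f : A * B -> R) :
  rsummable f -> rsum f = rsum (fun a => rsum (fun b => f (a, b))).
Proof.
move=> sf.
have sl a : rsummable (fun b => f (a, b)).
  move: sf; rewrite /rsummable esumR_pair//; apply: le_lt_trans.
  exact: le_esum_term.
pose p (x : R) := Num.max x 0; pose n (x : R) := Num.max (- x) 0.
have p0 x : 0 <= p x by rewrite le_max lexx orbT.
have n0 x : 0 <= n x by rewrite le_max lexx orbT.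
have pl x : p x <= `|x| by rewrite ge_max ler_norm normr_ge0.
have nl x : n x <= `|x| by rewrite /n ge_max normr_ge0 andbT -normrN ler_norm.
have pf a : (esumR (fun b => p (f (a, b))) < +oo)%E by apply: le_esumR_fin (sl a).
have nf a : (esumR (fun b => n (f (a, b))) < +oo)%E by apply: le_esumR_fin (sl a).
have pF : (esumR (fun x => p (f x)) < +oo)%E by apply: le_esumR_fin sf.
have nF : (esumR (fun x => n (f x)) < +oo)%E by apply: le_esumR_fin sf.
have pE : esumR (fun x => p (f x)) = esumR (fun a => fine (esumR (fun b => p (f (a, b))))).
  rewrite esumR_pair//; apply: eq_esum => a _; exact: esumR_fin.
have nE : esumR (fun x => n (f x)) = esumR (fun a => fine (esumR (fun b => n (f (a, b))))).
  rewrite esumR_pair//; apply: eq_esum => a _; exact: esumR_fin.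
rewrite [RHS](rsumE (f := fun a => fine (esumR (fun b => p (f (a, b)))))
  (g := fun a => fine (esumR (fun b => n (f (a, b))))))//.
- by rewrite -pE -nE.
- by move=> a; rewrite fine_ge0// esumR_ge0.
- by move=> a; rewrite fine_ge0// esumR_ge0.
- by rewrite -pE.
- by rewrite -nE.
Qed.

Lemma csum_pair (A B : choiceType) (f : A * B -> R[i]) :
  summ f -> csum f = csum (fun a => csum (fun b => f (a, b))).
Proof.
by move=> sf; rewrite /csum (rsum_pair (summ_Re sf)) (rsum_pair (summ_Im sf)).
Qed.

Lemma csum_swap (A B : choiceType) (f : A -> B -> R[i]) :
  summ (fun p : A * B => f p.1 p.2) ->
  csum (fun a => csum (fun b => f a b)) = csum (fun b => csum (fun a => f a b)).
Proof.
move=> sf; rewrite -(csum_pair sf) (csum_reindex _ (swap_bij B A)) csum_pair//.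
by rewrite /summ -(ell1_reindex (fun p : A * B => f p.1 p.2) (swap_bij B A)).
Qed.

Lemma summ_csum (A B : choiceType) (f : A * B -> R[i]) :
  summ f -> summ (fun a => csum (fun b => f (a, b))).
Proof.
move=> sf; apply: le_lt_trans sf; rewrite ell1_pair.
by apply: le_esum => a _; exact: csum_cabs.
Qed.

Lemma ell1M (A B : choiceType) (f : A -> R[i]) (g : B -> R[i]) :
  summ g -> ell1 (fun p : A * B => f p.1 * g p.2) = (ell1 f * ell1 g)%E.
Proof.
move=> sg; rewrite ell1_pair.
under eq_esum => a _ do rewrite (ell1Z (f a) g).
rewrite muleC (ell1_fin sg) /ell1 -esumRZ.
- by apply: eq_esum => a _; rewrite -EFinM mulrC.
- by rewrite fine_ge0// ell1_ge0.
- by move=> x; exact: cabs_ge0.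
Qed.

Lemma summM (A B : choiceType) (f : A -> R[i]) (g : B -> R[i]) :
  summ f -> summ g -> summ (fun p : A * B => f p.1 * g p.2).
Proof.
by move=> sf sg; rewrite /summ ell1M// (ell1_fin sf) (ell1_fin sg) -EFinM ltry.
Qed.

Lemma csumM (A B : choiceType) (f : A -> R[i]) (g : B -> R[i]) :
  summ f -> summ g -> csum (fun p : A * B => f p.1 * g p.2) = csum f * csum g.
Proof.
move=> sf sg; rewrite csum_pair; last exact: summM.
under eq_csum => a do rewrite (csumZ (f a) sg).
rewrite mulrC -csumZ//; apply: eq_csum => x; by rewrite mulrC.
Qed.

End Sums.

(** * Weighted sums of coefficients and the quadratic symbol *)

Section Weights.
Variable R : realType.
Implicit Types (k m : int) (a b : int -> R[i]) (d : R).

Local Notation ab k := (`|(k : int)%:~R : R|).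

Definition om k : R := 1 + ab k.
Definition wt d k : R := om k * expR (2 * pi * d * ab k).
(** A weighted l1 norm of coefficient sequences, of radius of analyticity d:
    the exponential makes it submultiplicative for convolution, and [om]
    controls one derivative. *)
Definition Nw d a : \bar R := esumR (fun k => wt d k * cabs (a k)).

Lemma ab_ge0 k : 0 <= ab k. Proof. exact: normr_ge0. Qed.

Lemma abD k m : ab (k + m) <= ab k + ab m.
Proof. by rewrite intrD ler_normD. Qed.

Lemma om_ge1 k : 1 <= om k. Proof. by rewrite /om lerDl. Qed.

Lemma om_gt0 k : 0 < om k. Proof. exact: lt_le_trans (om_ge1 k). Qed.

Lemma wt_gt0 d k : 0 < wt d k. Proof. by rewrite mulr_gt0 ?om_gt0 ?expR_gt0. Qed.

Lemma wt_ge0 d k : 0 <= wt d k. Proof. exact: ltW (wt_gt0 d k). Qed.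

Lemma twopi_ge0 : 0 <= 2 * pi :> R. Proof. by rewrite mulr_ge0// pi_ge0. Qed.

Lemma le_wt d d' k : d <= d' -> wt d k <= wt d' k.
Proof.
move=> dd'; rewrite ler_pM2l ?om_gt0// ler_expR ler_wpM2r//.
by rewrite ler_wpM2l// twopi_ge0.
Qed.

Lemma wt_ge1 d k : 0 <= d -> 1 <= wt d k.
Proof.
move=> d0; apply: (le_trans (om_ge1 k)); rewrite ler_peMr ?(ltW (om_gt0 k))//.
by rewrite -expR0 ler_expR !mulr_ge0// pi_ge0.
Qed.

Lemma wt_term_ge0 d a k : 0 <= wt d k * cabs (a k).
Proof. by rewrite mulr_ge0 ?wt_ge0 ?cabs_ge0. Qed.

Lemma Nw_ge0 d a : (0 <= Nw d a)%E.
Proof. by apply: esumR_ge0 => k; exact: wt_term_ge0. Qed.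

Lemma le_Nw d d' a : d <= d' -> (Nw d a <= Nw d' a)%E.
Proof.
by move=> dd'; apply: le_esumR => k; rewrite ler_wpM2r ?cabs_ge0// le_wt.
Qed.

Lemma Nw_ell1 d a : 0 <= d -> (ell1 a <= Nw d a)%E.
Proof.
by move=> d0; apply: le_esumR => k; rewrite ler_peMl ?cabs_ge0// wt_ge1.
Qed.

Lemma Nw_summ d a : 0 <= d -> (Nw d a < +oo)%E -> summ a.
Proof. by move=> d0; apply: le_lt_trans; exact: Nw_ell1. Qed.

Lemma Nw_fin d a : (Nw d a < +oo)%E -> Nw d a = (fine (Nw d a))%:E.
Proof. by move=> h; rewrite {1}/Nw esumR_fin// => k; exact: wt_term_ge0. Qed.

Lemma NwD d a b : (Nw d (fun k => a k + b k)%R <= Nw d a + Nw d b)%E.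
Proof.
rewrite /Nw -esumRD; try by move=> k; exact: wt_term_ge0.
by apply: le_esumR => k; rewrite -mulrDr ler_wpM2l ?wt_ge0// cabsD.
Qed.

Lemma NwZ d (c : R[i]) a : Nw d (fun k => c * a k) = ((cabs c)%:E * Nw d a)%E.
Proof.
rewrite /Nw -esumRZ ?cabs_ge0//; last by move=> k; exact: wt_term_ge0.
by congr esumR; apply/funext => k; rewrite cabsM mulrCA.
Qed.

Lemma NwN d a : Nw d (fun k => - a k) = Nw d a.
Proof. by rewrite /Nw; congr esumR; apply/funext => k; rewrite cabsN. Qed.

Lemma NwB d a b : (Nw d (fun k => a k - b k)%R <= Nw d a + Nw d b)%E.
Proof. by rewrite -[X in (_ + X)%E]NwN; exact: NwD. Qed.

Lemma Nw_term d a k : ((wt d k * cabs (a k))%:E <= Nw d a)%E.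
Proof.
exact: (esumR_term (fun k => wt d k * cabs (a k)) k).
Qed.

Lemma conv_bij : bijective (fun p : int * int => (p.2, p.1 - p.2)).
Proof.
exists (fun p => (p.1 + p.2, p.1)) => -[x y] /=; first by rewrite addrC subrK.
by rewrite addrC addKr.
Qed.

(** The change of variables (k, m) -> (m, k - m) turns a sum of convolutions
    into a product. *)
Lemma esumR_conv (f g : int -> R) : (forall k, 0 <= f k) -> (forall k, 0 <= g k) ->
  (esumR g < +oo)%E ->
  \esum_(k in [set: int]) esumR (fun m => f m * g (k - m)) = (esumR f * esumR g)%E.
Proof.
move=> f0 g0 go.
have p0 p : 0 <= f p.2 * g (p.1 - p.2) by rewrite mulr_ge0.
rewrite -(esumR_pair p0).
rewrite -[LHS](esumR_reindex (fun p => f p.1 * g p.2) conv_bij).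
rewrite esumR_pair; last by move=> p; rewrite mulr_ge0.
under eq_esum => k _ do rewrite (esumRZ (f0 k) g0).
rewrite (esumR_fin g0 go) muleC -esumRZ ?fine_ge0 ?esumR_ge0//.
by apply: eq_esum => k _; rewrite -EFinM mulrC.
Qed.

(** The equation on the k-th coefficient is u_k' = sum over m of beta k m u_m
    u_(k-m). The first summand is the symbol of half the derivative of u^2, the
    second that of the nonlocal term, in which the mean of u only appears
    through m = 0. As the inverse of 0 is 0, the symbol vanishes at k = 0, in
    accordance with the conservation of the mean. *)
Definition bsym k m : R :=
  pi * k%:~R + (2 * pi * k%:~R)^-1 *
    ((if m == 0 then 2 else 0) - 2 * pi ^+ 2 * (m%:~R * (k - m)%:~R)).
Definition beta k m : R[i] := - 'i * (bsym k m)%:C.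

Definition Bil a b k : R[i] := csum (fun m => beta k m * (a m * b (k - m))).

Lemma cabs_i : cabs ('i : R[i]) = 1.
Proof. by rewrite /cabs /= expr0n expr1n add0r sqrtr1. Qed.

Lemma pi_le4 : pi <= 4 :> R.
Proof. by have := @pihalf_lt2 R; lra. Qed.

(** The local part is of order |k| <= |m| + |k - m|, and the inverse of the
    frequency k leaves m (k - m) in the nonlocal part: one derivative is lost
    on each factor. The constant is an upper bound of pi. *)
Lemma beta_le k m : cabs (beta k m) <= 4 * (om m * om (k - m)).
Proof.
rewrite cabsM cabsN cabs_i mul1r cabsR /bsym /om.
pose x : R := ab m; pose y : R := ab (k - m); rewrite -/x -/y.
have kxy : ab k <= x + y by rewrite -[k in ab k](subrK m) addrC abD.
have x0 : 0 <= x by exact: ab_ge0. have y0 : 0 <= y by exact: ab_ge0.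
have p2 := pi_ge2 R; have p4 := pi_le4; have p0 : 0 < pi :> R by lra.
rewrite (le_trans (ler_normD _ _))// !normrM (ger0_norm (ltW p0)).
have E : `|(2 * pi * k%:~R)^-1 : R| <= (2 * pi)^-1.
  rewrite normfV !normrM (ger0_norm (ltW p0)) normr_nat.
  have [->|k0] := eqVneq k 0.
    by rewrite normr0 mulr0 invr0 invr_ge0 mulr_ge0// ltW.
  rewrite lef_pV2 ?posrE ?mulr_gt0 ?normr_gt0 ?intr_eq0//.
  rewrite ler_peMr ?mulr_ge0 ?(ltW p0)// -intr_norm ler1z.
  by move: k0; rewrite -normr_gt0.
have F : `|(if m == 0 then 2 else 0) - 2 * pi ^+ 2 * (m%:~R * (k - m)%:~R) : R|
    <= 2 + 2 * pi ^+ 2 * (x * y).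
  rewrite (le_trans (ler_normB _ _))// lerD//.
    by case: ifP; rewrite ?normr0// normr_nat.
  by rewrite !normrM normr_nat (ger0_norm (ltW p0)).
apply: (@le_trans _ _ (pi * (x + y) + (2 * pi)^-1 * (2 + 2 * pi ^+ 2 * (x * y)))).
  by rewrite lerD// ?ler_pM2l// ler_pM.
have -> : (2 * pi)^-1 * (2 + 2 * pi ^+ 2 * (x * y)) = pi^-1 + pi * (x * y).
  have pn : pi != 0 :> R by rewrite gt_eqF.
  by move: pn; move: (pi : R) => p pn; field.
have xy : 0 <= x * y by rewrite mulr_ge0.
have pV : pi^-1 <= 1 :> R by rewrite invf_le1//; lra.
have : pi * (x + y + x * y) <= 4 * (x + y + x * y) by rewrite ler_wpM2r// !addr_ge0.
lra.
Qed.

(** A derivative costs an arbitrarily small loss r of radius, at the price 1/r.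
    The upper bound D on r makes the remaining constant uniform. *)
Lemma om_le_exp (r D : R) k : 0 < r -> r <= D ->
  om k <= (D + 1) / r * expR (2 * pi * r * ab k).
Proof.
move=> r0 rD; have p2 := pi_ge2 R; rewrite mulrAC ler_pdivlMr// /om.
have := expR_ge1Dx (2 * pi * r * ab k).
pose z : R := ab k; rewrite -/z; set e := expR _ => H.
have z0 : 0 <= z by exact: ab_ge0.
have rz : 0 <= r * z by rewrite mulr_ge0// ltW.
have e1 : 1 + r * z <= e.
  apply: le_trans H; rewrite lerD2l -!mulrA mulrA ler_peMl// ; lra.
have : (D + 1) * (1 + r * z) <= (D + 1) * e by rewrite ler_wpM2l//; lra.
apply: le_trans.
have : 0 <= D * (r * z) by rewrite mulr_ge0//; lra.
lra.
Qed.

Lemma wt_split (d r D : R) k m : 0 <= d -> 0 < r -> r <= D ->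
  wt d k * (om m * om (k - m)) <=
  (D + 1) / r * (wt (d + r) m * wt (d + r) (k - m)).
Proof.
move=> d0 r0 rD.
have D0 : 0 <= (D + 1) / r by rewrite divr_ge0//; lra.
have H : wt d k <= (D + 1) / r * (expR (2 * pi * (d + r) * ab m) *
    expR (2 * pi * (d + r) * ab (k - m))).
  apply: (@le_trans _ _ ((D + 1) / r * expR (2 * pi * (d + r) * ab k))).
    rewrite /wt (mulrDr (2 * pi)) (mulrDl _ _ (ab k)) expRD.
    rewrite [expR (2 * pi * d * _) * _]mulrC mulrA.
    by rewrite ler_wpM2r ?expR_ge0// om_le_exp.
  rewrite ler_wpM2l// -expRD ler_expR -mulrDr.
  rewrite ler_wpM2l; last by rewrite -[k in ab k](subrK m) addrC abD.
    by [].
  by apply: mulr_ge0; [exact: twopi_ge0|lra].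
have o0 : 0 <= om m * om (k - m) by rewrite mulr_ge0// ltW// om_gt0.
apply: (le_trans (ler_wpM2r o0 H)).
by rewrite /wt; apply: eq_le_imp; ring.
Qed.

(** The two derivatives lost in [beta_le] are already present in the weights of
    the two factors; only the derivative in the norm of the product remains to
    be paid, by the loss r of radius. *)
Lemma Bil_bound (d r D : R) a b : 0 <= d -> 0 < r -> r <= D ->
  (Nw (d + r) b < +oo)%E ->
  (Nw d (Bil a b) <= (4 * (D + 1) / r)%:E * (Nw (d + r) a * Nw (d + r) b))%E.
Proof.
move=> d0 r0 rD bo.
have c0 : 0 <= 4 * (D + 1) / r by rewrite divr_ge0//; lra.
rewrite -esumR_conv//; try by move=> k; exact: wt_term_ge0.
have p0 p : 0 <= wt (d + r) p.2 * cabs (a p.2) *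
   (wt (d + r) (p.1 - p.2) * cabs (b (p.1 - p.2))).
  by rewrite mulr_ge0// wt_term_ge0.
rewrite -(esumR_pair p0) -esumRZ// esumR_pair; last by move=> p; rewrite mulr_ge0.
apply: le_esum => k _ /=.
rewrite EFinM.
apply: (@le_trans _ _ ((wt d k)%:E *
    ell1 (fun m => beta k m * (a m * b (k - m)))%R)%E).
  by rewrite lee_wpmul2l ?lee_fin ?wt_ge0// csum_cabs.
rewrite /ell1 -esumRZ ?wt_ge0//; last by move=> m; exact: cabs_ge0.
apply: le_esumR => m; rewrite !cabsM.
have ca : 0 <= cabs (a m) * cabs (b (k - m)) by rewrite mulr_ge0 ?cabs_ge0.
rewrite -cabsM.
apply: (@le_trans _ _ (4 * (wt d k * (om m * om (k - m))) * (cabs (a m) * cabs (b (k - m))))).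
  rewrite mulrA ler_wpM2r// [in leRHS]mulrCA ler_wpM2l ?wt_ge0//; exact: beta_le.
apply: (@le_trans _ _ (4 * ((D + 1) / r * (wt (d + r) m * wt (d + r) (k - m))) * (cabs (a m) * cabs (b (k - m))))).
  by rewrite ler_wpM2r// ler_wpM2l// wt_split.
by apply: eq_le_imp; ring.
Qed.

Lemma Bil_summ a b k : (Nw 0 a < +oo)%E -> (Nw 0 b < +oo)%E ->
  summ (fun m => beta k m * (a m * b (k - m))).
Proof.
move=> ao bo.
have fa m : 0 <= wt 0 m * cabs (a m) by exact: wt_term_ge0.
have fb m : 0 <= wt 0 m * cabs (b m) by exact: wt_term_ge0.
have H : (esumR (fun m => 4 * (wt 0 m * cabs (a m) * (wt 0 (k - m) * cabs (b (k - m)))))%R < +oo)%E.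
  rewrite esumRZ//; last by move=> m; rewrite mulr_ge0.
  rewrite [X in (_ * X)%E](_ : _ = (fine (esumR (fun m => wt 0 m * cabs (a m) * (wt 0 (k - m) * cabs (b (k - m))))))%:E).
    by rewrite -EFinM ltry.
  rewrite -esumR_fin//; first by move=> m; rewrite mulr_ge0.
  have := esumR_conv fa fb bo; rewrite -/(Nw 0 a) -/(Nw 0 b) (Nw_fin ao) (Nw_fin bo).
  move=> E; have := ltry (fine (Nw 0 a) * fine (Nw 0 b)).
  rewrite EFinM -E; apply: le_lt_trans.
  exact: le_esum_term.
apply: le_esumR_fin H => m; rewrite cabsM.
apply: (le_trans (ler_wpM2r (cabs_ge0 _) (beta_le k m))).
rewrite cabsM /wt !mulr0 !mul0r expR0 !mulr1.
by apply: eq_le_imp; ring.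
Qed.

Lemma BilBl a a' b k : (Nw 0 a < +oo)%E -> (Nw 0 a' < +oo)%E -> (Nw 0 b < +oo)%E ->
  Bil (fun m => a m - a' m) b k = Bil a b k - Bil a' b k.
Proof.
move=> ao a'o bo; rewrite /Bil -csumB; try exact: Bil_summ.
by apply: eq_csum => m; rewrite mulrBl mulrBr.
Qed.

Lemma BilBr a b b' k : (Nw 0 a < +oo)%E -> (Nw 0 b < +oo)%E -> (Nw 0 b' < +oo)%E ->
  Bil a (fun m => b m - b' m) k = Bil a b k - Bil a b' k.
Proof.
move=> ao a'o bo; rewrite /Bil -csumB; try exact: Bil_summ.
by apply: eq_csum => m; rewrite !mulrBr.
Qed.

End Weights.

(** * Taylor coefficients in time *)

Ltac nneg := intros; repeat first [ assumption | apply: ltW; assumption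
  | exact: expR_ge0 | exact: ler0n | exact: pi_ge0 | exact: normr_ge0
  | exact: cabs_ge0 | apply: mulr_ge0 | rewrite invr_ge0 | apply: exprn_ge0
  | apply: addr_ge0 ].

Section Recursion.
Variable R : realType.
Implicit Types (k m : int) (a b : int -> R[i]) (d : R).

(** Course-of-values recursion: [usteps a0 n] is the table of the coefficients
    of index at most n, its later entries repeating the n-th one. *)
Fixpoint usteps (a0 : int -> R[i]) (n : nat) : nat -> int -> R[i] :=
  match n with
  | 0 => fun _ => a0
  | n'.+1 => fun j => if (j <= n')%N then usteps a0 n' j else
      fun k => n'.+1%:R^-1 *
        \sum_(0 <= i < n'.+1) Bil (usteps a0 n' i) (usteps a0 n' (n' - i)) k
  end.

Definition ucoef a0 n := usteps a0 n n.

Lemma ustepsE a0 n j : (j <= n)%N -> usteps a0 n j = ucoef a0 j.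
Proof.
elim: n => [|n IH]; first by rewrite leqn0 => /eqP ->.
rewrite leq_eqVlt => /orP[/eqP ->//|]; rewrite ltnS => jn.
by rewrite /= jn IH.
Qed.

Lemma ucoef0 a0 : ucoef a0 0 = a0. Proof. by []. Qed.

Lemma ucoefS a0 n k : ucoef a0 n.+1 k =
  n.+1%:R^-1 * \sum_(0 <= i < n.+1) Bil (ucoef a0 i) (ucoef a0 (n - i)) k.
Proof.
rewrite /ucoef /= ltnn; congr (_ * _); apply: eq_big_nat => i /andP[_ ni].
by rewrite !ustepsE ?leq_subr.
Qed.

Lemma Nw_sum d (F : nat -> int -> R[i]) n :
  (Nw d (fun k => \sum_(0 <= i < n) F i k)%R <= \sum_(0 <= i < n) Nw d (F i))%E.
Proof.
elim: n => [|n IH].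
  rewrite big_geq// /Nw /esumR esum1// => k _.
  by rewrite big_geq// cabs0 mulr0.
rewrite big_nat_recr//=; apply: (@le_trans _ _ (Nw d (fun k => \sum_(0 <= i < n) F i k)%R + Nw d (F n))%E).
  by rewrite (le_trans _ (NwD _ _ _))//; apply: le_esumR => k; rewrite big_nat_recr.
by rewrite leeD2r.
Qed.

(** Telescoping, since 1/(n+2)^2 <= 1/(n+1) - 1/(n+2). *)
Lemma sum_invsq n : \sum_(0 <= i < n.+1) (i.+1%:R ^+ 2)^-1 <= 2 - n.+1%:R^-1 :> R.
Proof.
elim: n => [|n IH]; first by rewrite big_nat1 expr1n invr1; lra.
rewrite big_nat_recr//= (le_trans (lerD IH (lexx _)))//.
have n1 : 0 < n.+1%:R :> R by [].
rewrite -addrA lerD2l -lerBrDl opprK -subr_ge0.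
have -> : n.+2%:R = n.+1%:R + 1 :> R by rewrite -natr1.
move: n1; set x := _%:R => n1.
have -> : - (x + 1)^-1 + x^-1 - ((x + 1) ^+ 2)^-1 = (x * (x + 1) ^+ 2)^-1.
  by field; rewrite ?gt_eqF//; lra.
by rewrite invr_ge0 mulr_ge0 ?sqr_ge0// ltW.
Qed.

(** The sequence 1/(n+1)^2 is reproduced by convolution with itself, up to the
    factor 8: this keeps a majorant of this form stable under the quadratic
    recursion. *)
Lemma sum_conv_invsq n :
  \sum_(0 <= i < n.+1) ((i.+1%:R ^+ 2)^-1 * ((n - i).+1%:R ^+ 2)^-1)
    <= 8 / n.+2%:R ^+ 2 :> R.
Proof.
pose s (i : nat) : R := (i.+1%:R ^+ 2)^-1.
apply: (@le_trans _ _ (\sum_(0 <= i < n.+1) (2 / n.+2%:R ^+ 2) * (s i + s (n - i)%N))).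
  apply: ler_sum_nat => i /andP[_ ni]; rewrite /s.
  have -> : n.+2%:R = i.+1%:R + (n - i).+1%:R :> R.
    by rewrite -natrD; congr (_%:R); lia.
  have x0 : 0 < i.+1%:R :> R by []. have y0 : 0 < (n - i).+1%:R :> R by [].
  move: x0 y0; set x := i.+1%:R; set y := _%:R => x0 y0.
  have xy : 0 < x + y by lra.
  rewrite -subr_ge0.
  have -> : 2 / (x + y) ^+ 2 * ((x ^+ 2)^-1 + (y ^+ 2)^-1) - (x ^+ 2)^-1 * (y ^+ 2)^-1
    = (x - y) ^+ 2 / ((x + y) ^+ 2 * x ^+ 2 * y ^+ 2).
    by field; rewrite !gt_eqF.
  by apply: divr_ge0; [exact: sqr_ge0|rewrite -!exprMn; exact: sqr_ge0].
rewrite -big_distrr/= big_split/=.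
have -> : \sum_(0 <= i < n.+1) s (n - i)%N = \sum_(0 <= i < n.+1) s i.
  by rewrite big_nat_rev/=; apply: eq_big_nat => i /andP[_ ni]; congr s; lia.
have H : \sum_(0 <= i < n.+1) s i <= 2.
  by apply: (le_trans (sum_invsq n)); rewrite gerBl invr_ge0.
have c : 0 <= 2 / n.+2%:R ^+ 2 :> R by rewrite divr_ge0// sqr_ge0.
apply: (@le_trans _ _ (2 / n.+2%:R ^+ 2 * (2 + 2))).
  by rewrite ler_wpM2l// lerD.
by apply: eq_le_imp; ring.
Qed.

Lemma ratio_le_e n i : (i <= n)%N -> (n.+2%:R / n.+1%:R) ^+ i <= expR 1 :> R.
Proof.
move=> ni.
have r1 : n.+2%:R / n.+1%:R = 1 + n.+1%:R^-1 :> R.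
  by rewrite -(natr1 n.+1) mulrDl divff// mul1r.
apply: (@le_trans _ _ ((n.+2%:R / n.+1%:R) ^+ n.+1)).
  by rewrite ler_weXn2l ?(leqW ni)// r1 lerDl invr_ge0.
rewrite r1; apply: (@le_trans _ _ (expR (n.+1%:R^-1) ^+ n.+1)).
  by rewrite lerXn2r ?nnegrE ?expR_ge0 ?addr_ge0 ?expR_ge1Dx.
by rewrite -expRM_natl mulfV.
Qed.

Section Bound.
Variables (D M : R) (a0 : int -> R[i]).
Hypotheses (D0 : 0 < D) (M0 : 0 < M) (a0M : (Nw D a0 <= M%:E)%E).

(** The constants of [Bil_bound] and of the geometric growth of the Taylor
    coefficients. The factor 16 e collects the 8 of [sum_conv_invsq], the e of
    [ratio_le_e] and (n+2)/(n+1) <= 2. *)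
Definition bil_const : R := 4 * (D + 1).
Definition growth : R := 16 * expR 1 * bil_const * M.

Lemma bil_const_gt0 : 0 < bil_const. Proof. by apply: mulr_gt0 => //; apply: addr_gt0. Qed.
Lemma growth_gt0 : 0 < growth.
Proof.
apply: mulr_gt0 => //; apply: mulr_gt0; last exact: bil_const_gt0.
by apply: mulr_gt0 => //; exact: expR_gt0.
Qed.

(** Induction on n, using [Bil_bound] with the loss r = (D - d)/(n+2):
    enlarging the radius by r multiplies the geometric majorant by at most e,
    and the factor n+2 in 1/r is compensated by the division by n+1 in the
    recursion. *)
Lemma ucoef_bound n d : 0 <= d -> d < D ->
  (Nw d (ucoef a0 n) <= (M * (growth / (D - d)) ^+ n / n.+1%:R ^+ 2)%:E)%E.
Proof.
elim/ltn_ind: n d => -[_|n IH] d d0 dD.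
  rewrite ucoef0 expr0 mulr1 expr1n divr1.
  by apply: le_trans a0M; apply: le_Nw; exact: ltW.
set e := D - d; have e0 : 0 < e by rewrite subr_gt0.
pose r := e / n.+2%:R; have r0 : 0 < r by rewrite divr_gt0.
have n1 : 0 < n.+1%:R :> R by []. have n2 : 0 < n.+2%:R :> R by [].
have n2E : n.+2%:R = n.+1%:R + 1 :> R by rewrite -natr1.
have rD : r <= D.
  rewrite /r ler_pdivrMr// (@le_trans _ _ D)//; first by rewrite /e gerBl.
  by rewrite ler_peMr ?(ltW D0)// n2E lerDr ltW.
have er : D - (d + r) = e * (n.+1%:R / n.+2%:R).
  by rewrite opprD addrA -/e /r n2E; field; rewrite gt_eqF//; lra.
have drD : d + r < D by rewrite -subr_gt0 er mulr_gt0// divr_gt0.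
have dr0 : 0 <= d + r by rewrite addr_ge0// ltW.
have K00 := growth_gt0; have C00 := bil_const_gt0.
pose q := growth / e; have q0 : 0 <= q by rewrite divr_ge0// ltW.
have IH' i : (i <= n)%N -> (Nw (d + r) (ucoef a0 i) <=
    (M * (q ^+ i * (n.+2%:R / n.+1%:R) ^+ i) / i.+1%:R ^+ 2)%:E)%E.
  move=> ni; have := IH i ni (d + r) dr0 drD.
  suff -> : growth / (D - (d + r)) = q * (n.+2%:R / n.+1%:R) by rewrite exprMn.
  by rewrite er /q; field; rewrite !gt_eqF//; lra.
have fin i : (i <= n)%N -> (Nw (d + r) (ucoef a0 i) < +oo)%E.
  by move=> /IH' /le_lt_trans; apply; exact: ltry.
have B i : (i < n.+1)%N -> (Nw d (Bil (ucoef a0 i) (ucoef a0 (n - i))) <=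
   (bil_const / r * (M ^+ 2 * q ^+ n * expR 1) * ((i.+1%:R ^+ 2)^-1 * ((n - i).+1%:R ^+ 2)^-1))%:E)%E.
  move=> ni; apply: (le_trans (Bil_bound _ d0 r0 rD (fin _ (leq_subr _ _)))).
  have H1 := IH' i ni; have H2 := IH' (n - i)%N (leq_subr _ _).
  rewrite (Nw_fin (fin _ ni)) (Nw_fin (fin _ (leq_subr i n))) -!EFinM lee_fin.
  rewrite (Nw_fin (fin _ ni)) lee_fin in H1.
  rewrite (Nw_fin (fin _ (leq_subr i n))) lee_fin in H2.
  have := ler_pM (fine_ge0 (Nw_ge0 _ _)) (fine_ge0 (Nw_ge0 _ _)) H1 H2.
  have Cr : 0 <= bil_const / r by apply: divr_ge0; exact: ltW.
  move=> /(ler_wpM2l Cr) H.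
  apply: (le_trans H); rewrite -!(mulrA (bil_const / r)) ler_wpM2l//.
  have := ratio_le_e (leqnn n).
  have split x : x ^+ n = x ^+ i * x ^+ (n - i) :> R by rewrite -exprD subnKC.
  rewrite (split q) split => Hr.
  set P := (i.+1%:R ^+ 2)^-1; set Q := (_ ^+ 2)^-1.
  set x := q ^+ i; set y := q ^+ _; move: Hr; set u := _ ^+ i; set v := _ ^+ _ => Hr.
  have -> : M * (x * u) * P * (M * (y * v) * Q) = M ^+ 2 * (x * y) * (P * Q) * (u * v) by ring.
  have -> : M ^+ 2 * (x * y) * expR 1 * (P * Q) = M ^+ 2 * (x * y) * (P * Q) * expR 1 by ring.
  by apply: ler_wpM2l => //; rewrite /x /y /P /Q; nneg.
rewrite (_ : ucoef a0 n.+1 = fun k => n.+1%:R^-1 *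
  \sum_(0 <= i < n.+1) Bil (ucoef a0 i) (ucoef a0 (n - i)) k); last first.
  by apply/funext => k; rewrite ucoefS.
rewrite NwZ cabsV cabsn.
apply: (@le_trans _ _ (n.+1%:R^-1%:E * (\sum_(0 <= i < n.+1)
   (bil_const / r * (M ^+ 2 * q ^+ n * expR 1) * ((i.+1%:R ^+ 2)^-1 * ((n - i).+1%:R ^+ 2)^-1)))%:E)%E).
  apply: lee_wpmul2l; first by rewrite lee_fin invr_ge0.
  apply: (le_trans (Nw_sum _ _ _)); rewrite -sumEFin big_nat_cond [leRHS]big_nat_cond.
  by apply: lee_sum => i /andP[/andP[_ ni] _]; exact: B.
rewrite -EFinM lee_fin -big_distrr/=.
have c1 : 0 <= bil_const / r * (M ^+ 2 * q ^+ n * expR 1).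
  by nneg.
apply: (@le_trans _ _ (n.+1%:R^-1 * (bil_const / r * (M ^+ 2 * q ^+ n * expR 1) * (8 / n.+2%:R ^+ 2)))).
  by rewrite ler_wpM2l ?invr_ge0// ler_wpM2l// sum_conv_invsq.
rewrite -/q (exprSr q n) -subr_ge0.
have -> : M * (q ^+ n * q) / n.+2%:R ^+ 2 - n.+1%:R^-1 * (bil_const / r * (M ^+ 2 * q ^+ n * expR 1) * (8 / n.+2%:R ^+ 2))
  = M ^+ 2 * q ^+ n * expR 1 * bil_const / e / n.+2%:R ^+ 2 * (8 * (n%:R / n.+1%:R)).
  rewrite /r {2}/q /growth n2E -(natr1 n); move: (q ^+ n) (expR 1) bil_const => y E c.
  have x0 : 0 <= n%:R :> R by []. move: x0; move: (n%:R : R) => x x0.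
  by field; rewrite !gt_eqF//; lra.
by nneg.
Qed.

End Bound.
End Recursion.

(** * The power series in time *)

Section MoreSums.
Variable R : realType.

(** Reindexing along an injection whose image contains the support. *)
Lemma esumR_inj (A B : choiceType) (g : A -> B) (f : B -> R) : injective g ->
  (forall b, f b != 0 -> exists a, g a = b) ->
  esumR f = esumR (fun a => f (g a)).
Proof.
move=> gi fg; rewrite /esumR -[RHS](@esum_image _ _ _ setT g (fun b => (f b)%:E)).
  rewrite [RHS]esum_mkcond; apply: eq_esum => b _.
  case: ifPn => // bg; congr EFin; apply/eqP; apply: contraNT bg => /fg[a <-].
  by rewrite inE; exists a.
by move=> x y _ _; exact: gi.
Qed.

Lemma csum_inj (A B : choiceType) (g : A -> B) (f : B -> R[i]) : injective g ->
  (forall b, f b != 0 -> exists a, g a = b) ->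
  csum f = csum (fun a => f (g a)).
Proof.
move=> gi fg.
have H (F : R[i] -> R) : F 0 = 0 -> esumR (fun b => F (f b)) = esumR (fun a => F (f (g a))).
  move=> F0; apply: (esumR_inj gi) => b Fb; apply: fg.
  by apply: contra_neq Fb => ->.
rewrite /csum /rsum.
by rewrite (H (fun z => Num.max (Re z) 0)) ?(H (fun z => Num.max (- Re z) 0))
  ?(H (fun z => Num.max (Im z) 0)) ?(H (fun z => Num.max (- Im z) 0))//= ?oppr0 maxxx.
Qed.

(** The indicator function of the antidiagonal turns the grouping of pairs by
    their sum into an exchange of two summations. *)
Lemma csum_cauchy (H : nat * nat -> R[i]) : summ H ->
  csum H = csum (fun n => \sum_(0 <= i < n.+1) H (i, n - i)%N).
Proof.
move=> sH.
pose s n := [seq (i, n - i)%N | i <- index_iota 0 n.+1].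
have us n : uniq (s n).
  by rewrite map_inj_uniq ?iota_uniq// => i j [].
have ms n p : (p \in s n) = (n == p.1 + p.2)%N.
  apply/mapP/eqP => [[j]|np].
    by rewrite mem_index_iota => /andP[_ ni] -> /=; rewrite subnKC.
  exists p.1; first by rewrite mem_index_iota np ltnS leq_addr.
  by rewrite np addKn; case: p {np}.
pose G n p := if n == (p.1 + p.2)%N then H p else 0.
have GE n : \sum_(0 <= i < n.+1) H (i, n - i)%N = csum (G n).
  transitivity (\sum_(p <- s n) H p); first by rewrite big_map.
  rewrite -(csum_seq H (us n)).2; apply: eq_csum => p; by rewrite /G ms.
under [RHS]eq_csum => n do rewrite GE.
rewrite csum_swap.
  apply: eq_csum => p; rewrite /G.
  by rewrite (summ_pred1 (p.1 + p.2)%N (H p)).2.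
rewrite /summ (ell1_reindex _ (swap_bij _ _)) ell1_pair /=.
move: sH; rewrite /summ /ell1 /esumR; apply: le_lt_trans; apply: le_esum => p _.
rewrite -[leRHS](@esum_set1 _ _ (p.1 + p.2)%N (fun=> (cabs (H p))%:E)) ?lee_fin ?cabs_ge0//.
rewrite [leRHS]esum_mkcond; apply: le_esum => x _.
by rewrite in_set1 /G /=; case: ifP => // _; rewrite cabs0.
Qed.

Lemma esumRM (A B : choiceType) (f : A -> R) (g : B -> R) :
  (forall x, 0 <= f x) -> (forall x, 0 <= g x) -> (esumR g < +oo)%E ->
  esumR (fun p : A * B => f p.1 * g p.2) = (esumR f * esumR g)%E.
Proof.
move=> f0 g0 go; rewrite esumR_pair; last by move=> p; rewrite mulr_ge0.
under eq_esum => a _ do rewrite (esumRZ (f0 a) g0).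
rewrite (esumR_fin g0 go) muleC -esumRZ ?fine_ge0 ?esumR_ge0//.
by apply: eq_esum => a _; rewrite -EFinM mulrC.
Qed.

Lemma esumR_swap (A B : choiceType) (f : A * B -> R) : (forall p, 0 <= f p) ->
  \esum_(b in [set: B]) esumR (fun a => f (a, b)) = esumR f.
Proof.
move=> f0; rewrite (esumR_reindex _ (swap_bij B A)) esumR_pair//.
Qed.

End MoreSums.

Section Evolution.
Variable R : realType.
Variables (c : nat -> int -> R[i]) (d r U : R).
Hypotheses (d0 : 0 <= d) (r0 : 0 <= r).

(** The norm of the power series with coefficients [c] on the disk of radius
    [r], all terms being taken in absolute value. *)
Definition mass : \bar R :=
  esumR (fun p : nat * int => r ^+ p.1 * (wt d p.2 * cabs (c p.1 p.2))).

Hypothesis HU : (mass <= U%:E)%E.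

Let massT_ge0 (p : nat * int) : 0 <= r ^+ p.1 * (wt d p.2 * cabs (c p.1 p.2)).
Proof. by apply: mulr_ge0; [exact: exprn_ge0|exact: wt_term_ge0]. Qed.

Lemma comb_summ (f : nat -> R[i]) (B : R) k : 0 <= B ->
  (forall n, cabs (f n) <= B * r ^+ n) -> summ (fun n => f n * c n k).
Proof.
move=> B0 fB; apply: (@le_esumR_fin _ _ _ (fun n => B * (r ^+ n * (wt d k * cabs (c n k))))).
  move=> n; rewrite cabsM mulrA; apply: ler_pM; rewrite ?cabs_ge0//.
  by rewrite ler_peMl ?cabs_ge0// wt_ge1.
rewrite esumRZ//; last by move=> n; exact: (massT_ge0 (n, k)).
have Ho : (esumR (fun n => r ^+ n * (wt d k * cabs (c n k)))%R <= U%:E)%E.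
  apply: le_trans HU; rewrite /mass -esumR_swap//.
  exact: le_esum_term.
rewrite (esumR_fin (fun n => massT_ge0 (n, k))) -?EFinM ?ltry//.
exact: le_lt_trans Ho (ltry _).
Qed.

(** Arbitrary multipliers f n dominated by B r^n are allowed in order to treat
    at once the values of the power series, its derivative and its difference
    quotients. *)
Lemma comb_Nw (f : nat -> R[i]) (B : R) : 0 <= B ->
  (forall n, cabs (f n) <= B * r ^+ n) ->
  (Nw d (fun k => csum (fun n => f n * c n k)%R) <= (B * U)%:E)%E.
Proof.
move=> B0 fB; apply: (@le_trans _ _ (B%:E * mass)%E); last first.
  by rewrite EFinM; apply: lee_wpmul2l => //; rewrite lee_fin.
rewrite /mass -esumRZ// -esumR_swap; last by move=> p; rewrite mulr_ge0.
apply: le_esum => k _ /=.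
rewrite EFinM; apply: (@le_trans _ _ ((wt d k)%:E * ell1 (fun n => f n * c n k)%R)%E).
  by apply: lee_wpmul2l; [rewrite lee_fin wt_ge0|exact: csum_cabs].
rewrite /ell1 -esumRZ ?wt_ge0//; last by move=> n; exact: cabs_ge0.
apply: le_esumR => n; rewrite cabsM mulrCA [B * _]mulrA.
apply: ler_wpM2r (fB n); exact: wt_term_ge0.
Qed.

End Evolution.

Section PowerDerivative.
Variable R : realType.

(** The remainder is h^2 times a polynomial in t and h with nonnegative
    coefficients, hence is dominated by its value at the positive numbers |t|
    and e. Multiplying out the denominators gives a form that passes through
    the induction. *)
Lemma pow_rem (t h : R[i]) (e : R) n : 0 <= e -> cabs h <= e ->
  cabs ((t + h) ^+ n - t ^+ n - n%:R * t ^+ n.-1 * h) * e ^+ 2 <=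
  cabs h ^+ 2 * ((cabs t + e) ^+ n - cabs t ^+ n - n%:R * cabs t ^+ n.-1 * e).
Proof.
move=> e0 he; elim: n => [|n IH].
  by rewrite !expr0 mul0r subrr sub0r mul0r oppr0 cabs0 mul0r mul0r mul0r subrr subr0 mulr0.
set P := _ - _ - _ in IH; set Q := _ - _ - _ in IH.
have -> : (t + h) ^+ n.+1 - t ^+ n.+1 - n.+1%:R * t ^+ n.+1.-1 * h =
    (t + h) * P + n%:R * t ^+ n.-1 * h ^+ 2.
  rewrite /P; case: n {IH P Q} => [|n]; first by rewrite !expr0 !expr1; ring.
  by rewrite -(natr1 n.+1) /= !exprS; ring.
have -> : (cabs t + e) ^+ n.+1 - cabs t ^+ n.+1 - n.+1%:R * cabs t ^+ n.+1.-1 * e =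
    (cabs t + e) * Q + n%:R * cabs t ^+ n.-1 * e ^+ 2.
  rewrite /Q; case: n {IH P Q} => [|n]; first by rewrite !expr0 !expr1; ring.
  by rewrite -(natr1 n.+1) /= !exprS; ring.
apply: (@le_trans _ _ ((cabs t + e) * (cabs P * e ^+ 2) + n%:R * cabs t ^+ n.-1 * cabs h ^+ 2 * e ^+ 2)).
  rewrite mulrA -mulrDl; apply: ler_wpM2r; first exact: sqr_ge0.
  apply: (le_trans (cabsD _ _)); rewrite !cabsM !cabsX cabsn; apply: lerD => //.
  apply: ler_wpM2r; first exact: cabs_ge0.
  by apply: (le_trans (cabsD _ _)); rewrite lerD2l.
have te : 0 <= cabs t + e by rewrite addr_ge0// cabs_ge0.
have := ler_wpM2l te IH.
set X := _ * (_ * e ^+ 2); set Y := (_ + _) * (_ * Q); move=> XY.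
rewrite mulrDr.
have -> : cabs h ^+ 2 * ((cabs t + e) * Q) = Y by rewrite /Y; ring.
rewrite lerD//; apply: eq_le_imp; ring.
Qed.

Lemma pow_quot (t h : R[i]) (e r : R) n : 0 < e -> cabs h <= e -> h != 0 ->
  cabs t + e <= r ->
  cabs (((t + h) ^+ n - t ^+ n) / h - n%:R * t ^+ n.-1) <= cabs h / e ^+ 2 * r ^+ n.
Proof.
move=> e0 he h0 ter.
have ch : 0 < cabs h.
  by rewrite lt_def cabs_ge0 andbT; apply: contra h0 => /eqP/cabs_eq0 ->.
have -> : ((t + h) ^+ n - t ^+ n) / h - n%:R * t ^+ n.-1 =
   ((t + h) ^+ n - t ^+ n - n%:R * t ^+ n.-1 * h) / h.
  by rewrite [RHS]mulrBl mulfK.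
rewrite cabsM cabsV ler_pdivrMr// -(ler_pM2r (exprn_gt0 2 e0)).
apply: (le_trans (pow_rem t n (ltW e0) he)).
have -> : cabs h / e ^+ 2 * r ^+ n * cabs h * e ^+ 2 = cabs h ^+ 2 * r ^+ n.
  by field; rewrite gt_eqF.
apply: ler_wpM2l; first exact: sqr_ge0.
have : (cabs t + e) ^+ n <= r ^+ n.
  have t0 := cabs_ge0 t; apply: lerXn2r => //; rewrite nnegrE; first by rewrite addr_ge0// ltW.
  by rewrite (le_trans _ ter)// addr_ge0// ltW.
have : 0 <= cabs t ^+ n by rewrite exprn_ge0// cabs_ge0.
have : 0 <= n%:R * cabs t ^+ n.-1 * e by nneg.
lra.
Qed.

Lemma pow_der (t : R[i]) (e r : R) n : 0 < e -> cabs t + e <= r ->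
  cabs (n%:R * t ^+ n.-1) <= e^-1 * r ^+ n.
Proof.
move=> e0 ter; have t0 := cabs_ge0 t; rewrite cabsM cabsn cabsX.
rewrite [e^-1 * _]mulrC ler_pdivlMr//.
suff H : cabs t ^+ n + n%:R * cabs t ^+ n.-1 * e <= (cabs t + e) ^+ n.
  have : (cabs t + e) ^+ n <= r ^+ n.
    apply: lerXn2r => //; rewrite nnegrE; first by rewrite addr_ge0// ltW.
    by rewrite (le_trans _ ter)// addr_ge0// ltW.
  by apply: le_trans; apply: le_trans H; rewrite lerDr exprn_ge0.
have := @pow_rem t (e%:C) e n (ltW e0); rewrite cabsR gtr0_norm// => /(_ (lexx _)) H.
have : 0 <= e ^+ 2 * ((cabs t + e) ^+ n - cabs t ^+ n - n%:R * cabs t ^+ n.-1 * e).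
  apply: le_trans H; by rewrite mulr_ge0 ?cabs_ge0 ?sqr_ge0.
rewrite pmulr_rge0 ?exprn_gt0//; lra.
Qed.

End PowerDerivative.

Section Ode.
Variable R : realType.
Variables (a0 : int -> R[i]).
Local Notation c := (ucoef a0).

Definition flow (t : R[i]) k : R[i] := csum (fun n => t ^+ n * c n k).
Definition dflow (t : R[i]) k : R[i] := csum (fun n => (n%:R * t ^+ n.-1) * c n k).

Variables (r U : R).
Hypothesis (r0 : 0 <= r).

Lemma flow_Nw d t : 0 <= d -> (mass c d r <= U%:E)%E -> cabs t <= r ->
  (Nw d (flow t) <= U%:E)%E.
Proof.
move=> d0 H tr; rewrite -[U]mul1r; apply: (comb_Nw r0 H (f := fun n => t ^+ n)) => //.
move=> n; rewrite mul1r cabsX; apply: lerXn2r => //; rewrite nnegrE ?cabs_ge0//.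
Qed.

Lemma dflow_Nw d t (e : R) : 0 <= d -> (mass c d r <= U%:E)%E -> 0 < e -> cabs t + e <= r ->
  (Nw d (dflow t) <= (e^-1 * U)%:E)%E.
Proof.
move=> d0 H e0 tr.
apply: (comb_Nw r0 H (f := fun n => n%:R * t ^+ n.-1)).
  by rewrite invr_ge0 ltW.
by move=> n; exact: pow_der.
Qed.

Lemma flow_diff d t (e : R) h : 0 <= d -> (mass c d r <= U%:E)%E -> 0 < e ->
  cabs t + e <= r -> cabs h <= e -> h != 0 ->
  (Nw d (fun k => (flow (t + h) k - flow t k) / h - dflow t k)%R <= (cabs h / e ^+ 2 * U)%:E)%E.
Proof.
move=> d0 H e0 tr he h0.
have tr1 : cabs t <= r by apply: le_trans tr; rewrite lerDl ltW.
have tr2 : cabs (t + h) <= r.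
  by rewrite (le_trans (cabsD _ _))// (le_trans _ tr)// lerD2l.
have P (s : R[i]) n : cabs s <= r -> cabs (s ^+ n) <= 1 * r ^+ n.
  by move=> sr; rewrite mul1r cabsX; apply: lerXn2r => //; rewrite nnegrE ?cabs_ge0.
rewrite (_ : (fun k => _) = fun k => csum (fun n => (((t + h) ^+ n - t ^+ n) / h - n%:R * t ^+ n.-1) * c n k)).
  apply: (comb_Nw r0 H (f := fun n => ((t + h) ^+ n - t ^+ n) / h - n%:R * t ^+ n.-1)).
    by rewrite divr_ge0 ?cabs_ge0 ?sqr_ge0.
  by move=> n; exact: pow_quot.
apply/funext => k; rewrite /flow /dflow.
have S1 := comb_summ d0 r0 H k ler01 (fun n => P _ n tr2).
have S2 := comb_summ d0 r0 H k ler01 (fun n => P _ n tr1).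
have S3 : summ (fun n => (n%:R * t ^+ n.-1) * c n k).
  apply: (comb_summ d0 r0 H (B := e^-1)); first by rewrite invr_ge0 ltW.
  by move=> n; exact: pow_der.
rewrite -csumB// mulrC -csumZ; last exact: summD S1 (summN S2).
rewrite -csumB//; last exact/summZ/(summD S1 (summN S2)).
by apply: eq_csum => n; rewrite mulrBl; congr (_ - _); rewrite -mulrBl mulrA [h^-1 * _]mulrC.
Qed.

(** The n-th coefficient of the Cauchy product is n+1 times the coefficient n+1
    of the series: this is the recursion [ucoefS]. The family indexed by the
    frequency m and the two exponents is absolutely summable, which justifies
    the exchanges. *)
Lemma flow_ode t (e : R) k : (mass c 0 r <= U%:E)%E -> 0 < e -> cabs t + e <= r ->
  dflow t k = Bil (flow t) (flow t) k.
Proof.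
move=> H e0 tr.
have tr1 : cabs t <= r by apply: le_trans tr; rewrite lerDl ltW.
have P n : cabs (t ^+ n) <= 1 * r ^+ n.
  by rewrite mul1r cabsX; apply: lerXn2r => //; rewrite nnegrE ?cabs_ge0.
have S m := comb_summ (lexx 0) r0 H m ler01 P.
(* [F m n] bounds the factor of frequency m and exponent n; the triple sum is
   dominated by the convolution of the sequence [A] with itself. *)
pose F m (n : nat) := r ^+ n * (wt 0 m * cabs (c n m)).
have F0 m n : 0 <= F m n by apply: mulr_ge0; [exact: exprn_ge0|exact: wt_term_ge0].
have FM : (\esum_(m in [set: int]) esumR (F m) <= U%:E)%E.
  by apply: le_trans H; rewrite /mass -esumR_swap// => p; exact: F0.
have Ffin m : (esumR (F m) < +oo)%E.
  apply: le_lt_trans (ltry U); apply: le_trans FM.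
  exact: le_esum_term.
pose A m := fine (esumR (F m)).
have A0 m : 0 <= A m by rewrite fine_ge0// esumR_ge0.
have AE m : esumR (F m) = (A m)%:E by exact: esumR_fin.
have AM : (esumR A < +oo)%E.
  apply: le_lt_trans (ltry U); apply: le_trans FM.
  by apply: le_esum => m _; rewrite AE.
pose G (p : int * (nat * nat)) : R[i] :=
  beta R k p.1 * ((t ^+ p.2.1 * c p.2.1 p.1) * (t ^+ p.2.2 * c p.2.2 (k - p.1))).
have sG : summ G.
  apply: (@le_esumR_fin _ _ _ (fun p => 4 * (F p.1 p.2.1 * F (k - p.1) p.2.2))).
    move=> [m [i j]] /=; rewrite /G /F /= cabsM (cabsM (t ^+ i * _)) (cabsM (t ^+ i)) (cabsM (t ^+ j)).
    set x := cabs (t ^+ i); set y := cabs (t ^+ j).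
    have xr : x <= r ^+ i by have := P i; rewrite mul1r.
    have yr : y <= r ^+ j by have := P j; rewrite mul1r.
    have ci := cabs_ge0 (c i m); have cj := cabs_ge0 (c j (k - m)).
    have x0 : 0 <= x := cabs_ge0 _. have y0 : 0 <= y := cabs_ge0 _.
    have o1 := ltW (om_gt0 R m); have o2 := ltW (om_gt0 R (k - m)).
    apply: (@le_trans _ _ (4 * (om R m * om R (k - m)) * (r ^+ i * cabs (c i m) * (r ^+ j * cabs (c j (k - m)))))).
      apply: ler_pM => //; [exact: cabs_ge0|by nneg|exact: beta_le|].
      apply: ler_pM => //; [by nneg|by nneg| |]; exact: ler_wpM2r.
    rewrite /wt !mulr0 !mul0r expR0 !mulr1; apply: eq_le_imp; ring.
  rewrite esumRZ//; last by move=> p; exact: mulr_ge0.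
  rewrite [X in (_ * X)%E](esumR_fin)//; first by rewrite -EFinM ltry.
    by move=> p; exact: mulr_ge0.
  rewrite esumR_pair; last by move=> p; exact: mulr_ge0.
  under eq_esum => m _ do rewrite (esumRM (F0 m) (F0 (k - m)) (Ffin (k - m))) !AE -EFinM.
  have := esumR_conv A0 A0 AM; rewrite (esumR_fin A0 AM) -EFinM => E.
  apply: le_lt_trans (ltry (fine (esumR A) * fine (esumR A))); rewrite -E.
  exact: le_esum_term.
transitivity (csum (fun q : nat * nat => csum (fun m => G (m, q)))); last first.
  rewrite -csum_swap; last by apply: le_lt_trans sG; apply: le_esumR => -[].
  apply: eq_csum => m; rewrite -csumM; [|exact: S|exact: S].
  by rewrite -csumZ//; exact: (summM (S m) (S (k - m))).
have GB q : csum (fun m => G (m, q)) = t ^+ (q.1 + q.2) * Bil (c q.1) (c q.2) k.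
  have [t0|t0] := eqVneq (t ^+ (q.1 + q.2)) 0.
    rewrite t0 mul0r -[RHS](@csum0 R int); apply: eq_csum => m; rewrite /G /=.
    have -> : t ^+ q.1 * c q.1 m * (t ^+ q.2 * c q.2 (k - m)) =
      t ^+ (q.1 + q.2) * (c q.1 m * c q.2 (k - m)) by rewrite exprD; ring.
    by rewrite t0 mul0r mulr0.
  rewrite /Bil -csumZ.
    by apply: eq_csum => m; rewrite /G /= exprD; ring.
  have : summ (fun m => G (m, q)).
    apply: (summ_slice (f := fun p : (nat * nat) * int => G (p.2, p.1))).
    by move: sG; rewrite /summ (ell1_reindex G (swap_bij _ _)).
  move=> /(summZ (t ^+ (q.1 + q.2))^-1); congr summ; apply/funext => m.
  rewrite /G /= -[RHS]mul1r -(mulVf t0) exprD; ring.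
under eq_csum => q do rewrite GB.
rewrite csum_cauchy; last first.
  move: (sG); rewrite /summ (ell1_reindex G (swap_bij _ _)) => sG'.
  have := summ_csum (f := fun p : (nat * nat) * int => G (p.2, p.1)) sG'.
  by congr summ; apply/funext => q /=; rewrite GB.
rewrite /dflow (csum_inj (g := succn)); last 2 first.
- by move=> x y [].
- by case=> [|n]; [rewrite mul0r mul0r eqxx|exists n].
apply: eq_csum => n /=.
rewrite (eq_big_nat _ _ (F2 := fun i => t ^+ n * Bil (c i) (c (n - i)%N) k)); last first.
  by move=> i /andP[_ ni] /=; rewrite subnKC.
rewrite -big_distrr/= ucoefS mulrA [_ * t ^+ n]mulrC -!mulrA; congr (_ * _).
by rewrite mulrA mulfV ?mul1r ?pnatr_eq0.
Qed.

End Ode.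

Section MassBound.
Variable R : realType.
Variables (D M : R) (a0 : int -> R[i]).
Hypotheses (D0 : 0 < D) (M0 : 0 < M) (a0M : (Nw D a0 <= M%:E)%E).

(** At this radius the geometric factors cancel and leave the sum of the
    1/(n+1)^2, which is at most 2. *)
Lemma ucoef_mass d : 0 <= d -> d < D ->
  (mass (ucoef a0) d ((D - d) / growth D M) <= (2 * M)%:E)%E.
Proof.
move=> d0 dD; set r := _ / _.
have K00 : 0 < growth D M by exact: growth_gt0.
have Dd : 0 < D - d by rewrite subr_gt0.
have r0 : 0 <= r by rewrite divr_ge0 ?ltW.
rewrite /mass esumR_pair; last first.
  by move=> p; apply: mulr_ge0; [exact: exprn_ge0|exact: wt_term_ge0].
apply: (@le_trans _ _ (\esum_(n in [set: nat]) (M * (n.+1%:R ^+ 2)^-1)%:E)%E).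
  apply: le_esum => n _ /=.
  rewrite esumRZ ?exprn_ge0//; last by move=> k; exact: wt_term_ge0.
  have H := ucoef_bound D0 M0 a0M n d0 dD.
  apply: (@le_trans _ _ ((r ^+ n)%:E * (M * (growth D M / (D - d)) ^+ n / n.+1%:R ^+ 2)%:E)%E).
    by apply: lee_wpmul2l => //; rewrite lee_fin exprn_ge0.
  rewrite -EFinM lee_fin; apply: eq_le_imp.
  rewrite mulrA mulrCA -exprMn (_ : r * (growth D M / (D - d)) = 1) ?expr1n ?mulr1//.
  by rewrite /r mulrACA [_^-1 * _^-1]mulrC mulrACA !mulfV ?mulr1 ?gt_eqF.
have p0 n : (0 <= (M * (n.+1%:R ^+ 2)^-1)%:E)%E.
  by rewrite lee_fin mulr_ge0 ?invr_ge0 ?exprn_ge0// ltW.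
rewrite -nneseries_esumT//.
apply: lime_le; first by apply: is_cvg_nneseries.
apply: nearW => -[|n]; first by rewrite big_geq// lee_fin mulr_ge0// ltW.
rewrite sumEFin lee_fin -big_distrr/= mulrC ler_wpM2r ?(ltW M0)//.
by rewrite (le_trans (sum_invsq R n))// gerBl invr_ge0.
Qed.

End MassBound.

Section ComplexDerivative.
Variable R : realType.

(** Complex differentiability in epsilon-delta form with real moduli, the form
    produced and consumed by the estimates. *)
Definition cdiff (f : R[i] -> R[i]) (t l : R[i]) := forall e : R, 0 < e ->
  exists2 eta : R, 0 < eta & forall h, h != 0 -> cabs h < eta ->
    cabs ((f (t + h) - f t) / h - l) <= e.

Lemma cdiffD f g t l m : cdiff f t l -> cdiff g t m ->
  cdiff (fun z => f z + g z) t (l + m).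
Proof.
move=> hf hg e e0.
have e2 : 0 < e / 2 by rewrite divr_gt0.
have [x x0 Hx] := hf _ e2; have [y y0 Hy] := hg _ e2.
exists (Num.min x y); first by rewrite lt_min x0.
move=> h h0; rewrite lt_min => /andP[hx hy].
have -> : (f (t + h) + g (t + h) - (f t + g t)) / h - (l + m) =
  ((f (t + h) - f t) / h - l) + ((g (t + h) - g t) / h - m) by ring.
rewrite (le_trans (cabsD _ _))// [leRHS]splitr; apply: lerD; [exact: Hx|exact: Hy].
Qed.

Lemma cdiff_cst (a t : R[i]) : cdiff (fun=> a) t 0.
Proof.
move=> e e0; exists 1 => // h _ _.
by rewrite subrr mul0r subrr cabs0 ltW.
Qed.

Lemma cdiffZ a f t l : cdiff f t l -> cdiff (fun z => a * f z) t (a * l).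
Proof.
move=> hf e e0.
have ca := cabs_ge0 a.
have c0 : 0 < cabs a + 1 by lra.
have [|x x0 Hx] := hf (e / (cabs a + 1)); first by rewrite divr_gt0.
exists x => // h h0 hx.
have -> : (a * f (t + h) - a * f t) / h - a * l = a * ((f (t + h) - f t) / h - l) by ring.
rewrite cabsM (le_trans (ler_wpM2l ca (Hx h h0 hx)))//.
rewrite mulrA ler_pdivrMr// mulrC ler_wpM2l ?(ltW e0)//; lra.
Qed.

Lemma cdiffB f g t l m : cdiff f t l -> cdiff g t m ->
  cdiff (fun z => f z - g z) t (l - m).
Proof.
move=> hf hg.
have := cdiffD hf (cdiffZ (-1) hg); rewrite mulN1r.
by congr cdiff; apply/funext => z; rewrite mulN1r.
Qed.

Lemma cdiff_sum (I : eqType) (s : seq I) (F : I -> R[i] -> R[i]) t (L : I -> R[i]) :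
  (forall i, i \in s -> cdiff (F i) t (L i)) ->
  cdiff (fun z => \sum_(i <- s) F i z) t (\sum_(i <- s) L i).
Proof.
elim: s => [|i s IH] H.
  rewrite big_nil (_ : (fun z => _) = fun=> 0); first exact: cdiff_cst.
  by apply/funext => z; rewrite big_nil.
rewrite big_cons (_ : (fun z => _) = fun z => F i z + \sum_(j <- s) F j z).
  apply: cdiffD; first by apply: H; rewrite mem_head.
  by apply: IH => j js; apply: H; rewrite in_cons js orbT.
by apply/funext => z; rewrite big_cons.
Qed.

(** The first order expansion, with the increment h multiplied out. *)
Lemma is_deriveP (g : R -> R) (x l : R) :
  (forall e, 0 < e -> exists2 eta, 0 < eta & forall h, h != 0 -> `|h| < eta ->
    `|g (x + h) - g x - h * l| <= e * `|h|) -> is_derive x 1 g l.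
Proof.
move=> H.
have C : (fun h : R => h^-1 *: (g (h *: (1 : R) + x) - g x)) @ 0^' --> l.
  apply/cvgrPdist_le => e e0; have [eta eta0 He] := H e e0.
  near=> h.
  have h0 : h != 0 by near: h; exact: nbhs_dnbhs_neq.
  have hh : `|h| < eta by near: h; exact: dnbhs0_lt.
  have := He h h0 hh; rewrite -ler_pdivrMr ?normr_gt0//; apply: le_trans.
  rewrite -normrV ?unitfE// -normrM distrC [h *: 1]mulr1 [h + x]addrC.
  rewrite (_ : h^-1 *: _ - l = (g (x + h) - g x - h * l) * h^-1)//.
  by rewrite [RHS]mulrBl mulrAC mulfV// mul1r mulrC.
split; first by apply/cvg_ex; exists l.
exact: cvg_lim C.
Unshelve. all: by end_near. Qed.

(** Restricted to a ray and multiplied by a constant, a complex differentiable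
    function has a differentiable real part, to which the mean value theorem
    applies. *)
Lemma cdiff_line f (t1 l th : R[i]) (x : R) : cdiff f (x%:C * t1) l ->
  is_derive x 1 (fun s : R => Re (th * f (s%:C * t1))) (Re (th * (t1 * l))).
Proof.
move=> H; apply: is_deriveP => e e0.
have ct := cabs_ge0 th; have c1 := cabs_ge0 t1.
pose c := cabs th * cabs t1 + 1; have c0 : 0 < c by rewrite ltr_wpDl// mulr_ge0.
have [|eta eta0 He] := H (e / c); first by rewrite divr_gt0.
exists (eta / (cabs t1 + 1)); first by rewrite divr_gt0//; lra.
move=> h h0; rewrite ltr_pdivlMr; last lra.
move=> hh.
have [t10|t10] := eqVneq t1 0.
  rewrite t10 (_ : Re (th * (0 * l)) = 0); last by rewrite mul0r mulr0.
  rewrite !mulr0 subr0 subrr normr0.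
  by apply: mulr_ge0 => //; exact: ltW.
have ht0 : h%:C * t1 != 0 by rewrite mulf_neq0// (inj_eq (@complexI R)).
have hlt : cabs (h%:C * t1) < eta.
  rewrite cabsM cabsR (le_lt_trans _ hh)// ler_wpM2l//; lra.
have := He _ ht0 hlt.
have xE : (x + h)%:C * t1 = x%:C * t1 + h%:C * t1 by rewrite rmorphD mulrDl.
rewrite -xE; set u := f _; set v := f _ => Hq.
have -> : Re (th * u) - Re (th * v) - h * Re (th * (t1 * l)) =
   Re (th * ((h%:C * t1) * ((u - v) / (h%:C * t1) - l))).
  have E : th * ((h%:C * t1) * ((u - v) / (h%:C * t1) - l)) =
      th * u - th * v - h%:C * (th * (t1 * l)).
    by rewrite mulrBr [X in X - _]mulrC -mulrA mulVf// mulr1; ring.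
  by rewrite E !cReD !cReN (cReM h%:C) /= mul0r subr0.
apply: (le_trans (cabs_Re _)); rewrite !cabsM cabsR.
apply: (@le_trans _ _ (cabs th * (`|h| * cabs t1 * (e / c)))).
  by apply: ler_wpM2l => //; apply: ler_wpM2l => //; apply: mulr_ge0.
have -> : cabs th * (`|h| * cabs t1 * (e / c)) = (cabs th * cabs t1) * (e * `|h|) / c by ring.
rewrite ler_pdivrMr// mulrC; apply: ler_wpM2l; first by rewrite mulr_ge0// ltW.
by rewrite /c lerDl.
Qed.

(** The difference of g and the primitive of Q (x - a)^n is nonincreasing. *)
Lemma mvt_pow (g g' : R -> R) (a b Q : R) n : a <= b -> g a = 0 ->
  (forall x, a <= x <= b -> is_derive x 1 g (g' x)) ->
  (forall x, a <= x <= b -> g' x <= Q * (x - a) ^+ n) ->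
  g b <= Q * (b - a) ^+ n.+1 / n.+1%:R.
Proof.
move=> ab ga dg g'Q.
move: ab; rewrite le_eqVlt => /orP[/eqP <-|ab].
  by rewrite ga subrr expr0n mulr0 mul0r.
pose c := Q / n.+1%:R.
pose p (x : R) := g x - c * (x - a) ^+ n.+1.
have dp x : a <= x <= b -> is_derive x 1 p (g' x - Q * (x - a) ^+ n).
  move=> xab; have d1 := dg x xab.
  have d2 : is_derive x (1 : R) ((id - cst a) ^+ n.+1 : R -> R) ((n.+1%:R * (x - a) ^+ n) *: (1 - 0 : R)).
    exact: is_deriveX.
  have := is_deriveB d1 (is_deriveZ c d2).
  rewrite subr0 [_ *: 1]mulr1 (_ : c *: _ = Q * (x - a) ^+ n); last first.
    by rewrite /c -[_ *: _]/(_ * _) mulrA divfK ?pnatr_eq0.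
  by congr is_derive; apply/funext => y; rewrite /p exprfctE.
have [||z zab] := @MVT R p (fun x => g' x - Q * (x - a) ^+ n) a b ab.
- by move=> x; rewrite in_itv/= => /andP[x1 x2]; apply: dp; rewrite !ltW.
- apply: derivable_within_continuous => x; rewrite in_itv/= => xab.
  by have := dp x xab; case.
have zin : a <= z <= b by move: zab; rewrite in_itv/= => /andP[x1 x2]; rewrite !ltW.
rewrite /p ga subrr expr0n mulr0 subr0 => E.
have : (g' z - Q * (z - a) ^+ n) * (b - a) <= 0.
  by rewrite mulr_le0_ge0 ?subr_le0 ?g'Q// subr_ge0 ltW.
by rewrite -E subr0 subr_le0 /c mulrAC.
Qed.

End ComplexDerivative.

Section Uniqueness.
Variable R : realType.
Variables (D B : R) (t1 : R[i]) (c c' : R[i] -> int -> R[i]).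
Hypotheses (D0 : 0 < D) (B0 : 0 < B).
Hypothesis Hc : forall x : R, 0 <= x <= 1 -> forall k,
  cdiff (fun t => c t k) (x%:C * t1) (Bil (c (x%:C * t1)) (c (x%:C * t1)) k).
Hypothesis Hc' : forall x : R, 0 <= x <= 1 -> forall k,
  cdiff (fun t => c' t k) (x%:C * t1) (Bil (c' (x%:C * t1)) (c' (x%:C * t1)) k).
Hypothesis HB : forall x : R, 0 <= x <= 1 -> (Nw D (c (x%:C * t1)%R) <= B%:E)%E.
Hypothesis HB' : forall x : R, 0 <= x <= 1 -> (Nw D (c' (x%:C * t1)%R) <= B%:E)%E.

Let w (x : R) k := c (x%:C * t1) k - c' (x%:C * t1) k.
Let K := 4 * expR 1 * B * bil_const D * cabs t1.

Let K_ge0 : 0 <= K.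
Proof. by have := ltW (bil_const_gt0 D0); rewrite /K; nneg. Qed.

(** The difference w of the two solutions satisfies w' = Bil w c + Bil c' w.
    Induction on n: the radius is enlarged by (D - d)/(n+2) as in
    [ucoef_bound], and integration from x0 produces the factor (x - x0)/(n+1).
    *)
Lemma uniq_bound x0 : 0 <= x0 -> (forall k, w x0 k = 0) ->
  forall n d x, 0 <= d -> d < D -> x0 <= x -> x <= 1 ->
  (Nw d (w x) <= (2 * B * (K / (D - d) * (x - x0)) ^+ n)%:E)%E.
Proof.
move=> x00 wx0; elim => [|n IH] d x d0 dD xx0 x1.
  have x01 : 0 <= x <= 1 by rewrite x1 (le_trans x00).
  rewrite expr0 mulr1; apply: (le_trans (NwB _ _ _)).
  rewrite (_ : 2 * B = B + B); last by ring.
  rewrite EFinD; apply: leeD.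
    by apply: le_trans (HB x01); apply: le_Nw; exact: ltW.
  by apply: le_trans (HB' x01); apply: le_Nw; exact: ltW.
set e := D - d; have e0 : 0 < e by rewrite subr_gt0.
pose r := e / n.+2%:R; have r0 : 0 < r by rewrite divr_gt0.
have n1 : 0 < n.+1%:R :> R by []. have n2 : 0 < n.+2%:R :> R by [].
have n2E : n.+2%:R = n.+1%:R + 1 :> R by rewrite -natr1.
have rD : r <= D.
  rewrite /r ler_pdivrMr// (@le_trans _ _ D)//; first by rewrite /e gerBl.
  by rewrite ler_peMr ?(ltW D0)// n2E lerDr ltW.
have er : D - (d + r) = e * (n.+1%:R / n.+2%:R).
  by rewrite opprD addrA -/e /r n2E; field; rewrite gt_eqF//; lra.
have drD : d + r < D by rewrite -subr_gt0 er mulr_gt0// divr_gt0.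
have dr0 : 0 <= d + r by rewrite addr_ge0// ltW.
have C00 := ltW (bil_const_gt0 D0); have B00 := ltW B0.
have K00 := K_ge0.
have ct1 := cabs_ge0 t1.
have IHs s : x0 <= s -> s <= 1 ->
    (Nw (d + r) (w s) <= (2 * B * (expR 1 * (K / e) ^+ n * (s - x0) ^+ n))%:E)%E.
  move=> s0 s1; apply: (le_trans (IH _ _ dr0 drD s0 s1)); rewrite lee_fin.
  apply: ler_wpM2l; first by nneg.
  have -> : K / (D - (d + r)) * (s - x0) = (n.+2%:R / n.+1%:R) * (K / e * (s - x0)).
    by rewrite er; field; rewrite !gt_eqF//; lra.
  rewrite exprMn (_ : expR 1 * _ * _ = expR 1 * (K / e * (s - x0)) ^+ n).
    2: by rewrite -mulrA -exprMn.
  apply: ler_wpM2r; last exact: ratio_le_e.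
  apply: exprn_ge0; apply: mulr_ge0; last by rewrite subr_ge0.
  by apply: divr_ge0 => //; exact: ltW.
apply: ge_esumR => [k|S uS]; first exact: wt_term_ge0.
(* Unit multipliers realising the norm of w at the endpoint x; the norm is
   tested on the finite set S of frequencies, so that it becomes the real part
   of a differentiable function of s. *)
pose th k := sval (cid2 (cabs_rot (w x k))).
have th1 k : cabs (th k) = 1 by rewrite /th; case: cid2.
have thw k : th k * w x k = (cabs (w x k))%:C by rewrite /th; case: cid2.
pose F t := \sum_(k <- S) ((wt d k)%:C * th k) * (c t k - c' t k).
pose F' (s : R) := \sum_(k <- S) ((wt d k)%:C * th k) *
  (Bil (c (s%:C * t1)) (c (s%:C * t1)) k - Bil (c' (s%:C * t1)) (c' (s%:C * t1)) k).
pose g (s : R) := Re (1 * F (s%:C * t1)).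
pose Q := cabs t1 * (bil_const D / r * (2 * B * (2 * B * (expR 1 * (K / e) ^+ n)))).
have Q0 : 0 <= Q.
  by have := ltW r0; have := ltW e0; rewrite /Q => *; nneg.
have -> : \sum_(k <- S) wt d k * cabs (w x k) = g x.
  rewrite /g mul1r /F -[LHS]/(Re (_%:C)) rmorph_sum; congr Re.
  apply: eq_bigr => k _; rewrite -mulrA; have := thw k; rewrite /w => ->.
  by rewrite rmorphM.
have in01 s : x0 <= s <= x -> 0 <= s <= 1.
  by move=> /andP[s0 sx]; rewrite (le_trans x00 s0) (le_trans sx x1).
have := @mvt_pow R g (fun s => Re (1 * (t1 * F' s))) x0 x Q n xx0.
move=> H; apply: (@le_trans _ _ (Q * (x - x0) ^+ n.+1 / n.+1%:R)%:E).
  rewrite lee_fin; apply: H.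
  - rewrite /g /F big1 ?mulr0// => k _.
    by have := wx0 k; rewrite /w => ->; rewrite mulr0.
  - move=> s /in01 s01; apply: cdiff_line; apply: cdiff_sum => k _.
    apply: cdiffZ; apply: cdiffB; [exact: Hc|exact: Hc'].
  - move=> s sin; have s01 := in01 _ sin; case/andP: sin => s0 sx.
    have s1 : s <= 1 by case/andP: s01.
    apply: (le_trans (ler_norm _)); apply: (le_trans (cabs_Re _)).
    rewrite mul1r cabsM /Q -mulrA; apply: ler_wpM2l => //.
    have fin0 a : (Nw D a <= B%:E)%E -> (Nw 0 a < +oo)%E.
      by move=> h; apply: le_lt_trans (ltry B); apply: le_trans h; exact: le_Nw (ltW D0).
    have findr a : (Nw D a <= B%:E)%E -> (Nw (d + r) a <= B%:E)%E.
      by apply: le_trans; exact: le_Nw (ltW drD).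
    have cB := HB s01; have c'B := HB' s01.
    have wfin : (Nw (d + r) (w s) < +oo)%E by apply: le_lt_trans (IHs s s0 s1) (ltry _).
    have wfin0 : (Nw 0 (w s) < +oo)%E by apply: le_lt_trans wfin; exact: le_Nw.
    have E k : Bil (c (s%:C * t1)) (c (s%:C * t1)) k - Bil (c' (s%:C * t1)) (c' (s%:C * t1)) k
      = Bil (w s) (c (s%:C * t1)) k + Bil (c' (s%:C * t1)) (w s) k.
      rewrite /w BilBl ?BilBr//; try exact: fin0; ring.
    apply: (@le_trans _ _ (\sum_(k <- S) (wt d k * cabs (Bil (w s) (c (s%:C * t1)) k) +
       wt d k * cabs (Bil (c' (s%:C * t1)) (w s) k)))).
      apply: (le_trans (cabs_sum _ _)); apply: ler_sum => k _.
      rewrite E !cabsM th1 mulr1 cabsR ger0_norm ?wt_ge0// -mulrDr.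
      by apply: ler_wpM2l; [exact: wt_ge0|exact: cabsD].
    have cr0 : 0 <= bil_const D / r by apply: divr_ge0 => //; exact: ltW.
    have X : (Nw d (Bil (w s) (c (s%:C * t1)%R)) <=
        (bil_const D / r * (2 * B * (expR 1 * (K / e) ^+ n * (s - x0) ^+ n) * B))%:E)%E.
      have cf := le_lt_trans (findr _ cB) (ltry B).
      apply: (le_trans (Bil_bound _ d0 r0 rD cf)).
      rewrite -/(bil_const D) [leRHS]EFinM; apply: lee_wpmul2l; first by rewrite lee_fin.
      by rewrite [leRHS]EFinM; apply: lee_pmul; [exact: Nw_ge0|exact: Nw_ge0|exact: IHs|exact: findr].
    have Y : (Nw d (Bil (c' (s%:C * t1)%R) (w s)) <=
        (bil_const D / r * (B * (2 * B * (expR 1 * (K / e) ^+ n * (s - x0) ^+ n))))%:E)%E.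
      apply: (le_trans (Bil_bound _ d0 r0 rD wfin)).
      rewrite -/(bil_const D) [leRHS]EFinM; apply: lee_wpmul2l; first by rewrite lee_fin.
      by rewrite [leRHS]EFinM; apply: lee_pmul; [exact: Nw_ge0|exact: Nw_ge0|exact: findr|exact: IHs].
    have := leeD X Y; rewrite /Nw -esumRD; try by move=> k; exact: wt_term_ge0.
    move=> XY; rewrite -lee_fin.
    have Z0 k : 0 <= wt d k * cabs (Bil (w s) (c (s%:C * t1)) k) +
       wt d k * cabs (Bil (c' (s%:C * t1)) (w s) k).
      by apply: addr_ge0; exact: wt_term_ge0.
    apply: (le_trans (esumR_seq uS Z0)); apply: (le_trans XY).
    by rewrite -EFinD lee_fin; apply: eq_le_imp; ring.
rewrite lee_fin -subr_ge0.
have -> : 2 * B * (K / e * (x - x0)) ^+ n.+1 - Q * (x - x0) ^+ n.+1 / n.+1%:R =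
  cabs t1 * bil_const D / e * (2 * B * (2 * B * (expR 1 * (K / e) ^+ n))) * (x - x0) ^+ n.+1 * (n%:R / n.+1%:R).
  rewrite exprMn (exprSr (K / e) n) /Q /r {2}/K n2E -(natr1 n).
  move: ((K / e) ^+ n) (expR 1) (bil_const D) ((x - x0) ^+ n.+1) => y E0 c0 z.
  have q0 : 0 <= n%:R :> R by []. move: q0; move: (n%:R : R) => q q0.
  by field; rewrite !gt_eqF//; lra.
have xx : 0 <= x - x0 by rewrite subr_ge0.
by have := ltW e0; nneg.
Qed.

(** On a subsegment of length h the bound of [uniq_bound] at radius 0 is at
    most a constant times 2^-n, so w stays 0. As h does not depend on the
    starting point, finitely many steps reach 1. *)
Lemma uniq_line : (forall k, w 0 k = 0) -> forall x, 0 <= x <= 1 -> forall k, w x k = 0.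
Proof.
move=> w0.
have K00 := K_ge0.
pose h := D / (2 * (K + 1)).
have h0 : 0 < h by rewrite divr_gt0// mulr_gt0//; lra.
have local x0 : 0 <= x0 -> (forall k, w x0 k = 0) ->
    forall x, x0 <= x -> x <= 1 -> x - x0 <= h -> forall k, w x k = 0.
  move=> x00 wx0 x xx0 x1 xh k.
  have H n : cabs (w x k) <= 2 * B * (2^-1) ^+ n.
    have := uniq_bound x00 wx0 n (lexx 0) D0 xx0 x1.
    rewrite subr0 => Hn; rewrite -lee_fin.
    apply: (@le_trans _ _ (Nw 0 (w x))).
      apply: le_trans (Nw_term 0 (w x) k); rewrite lee_fin ler_peMl ?cabs_ge0//.
      exact: wt_ge1.
    apply: (le_trans Hn); rewrite lee_fin; apply: ler_wpM2l; first by have := ltW B0; nneg.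
    have q0 : 0 <= x - x0 by rewrite subr_ge0.
    apply: lerXn2r; rewrite ?nnegrE ?invr_ge0//.
      by have := ltW D0; nneg.
    rewrite mulrAC ler_pdivrMr//.
    have : K * (x - x0) <= K * h by apply: ler_wpM2l.
    move=> /le_trans; apply; rewrite /h mulrCA [leRHS]mulrC; apply: ler_wpM2l; first exact: ltW.
    rewrite invfM mulrCA -[leRHS]mulr1; apply: ler_wpM2l; first by rewrite invr_ge0.
    by rewrite ler_pdivrMr; lra.
  apply: cabs_eq0; apply/eqP; rewrite eq_le cabs_ge0 andbT.
  have cv : (fun n => 2 * B * (2^-1) ^+ n : R) @ \oo --> (2 * B * 0 : R).
    by apply: cvgMr; apply: cvg_expr; rewrite ger0_norm ?invr_ge0// invf_lt1// ltr1n.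
  rewrite mulr0 in cv.
  by apply: (cvgr_to_ge cv); apply: nearW => n; exact: H.
have step n : forall x, 0 <= x <= 1 -> x <= n%:R * h -> forall k, w x k = 0.
  elim: n => [|n IH] x /andP[x0 x1].
    rewrite mul0r => x0'; have -> : x = 0 by apply/eqP; rewrite eq_le x0 x0'.
    exact: w0.
  move=> xn.
  have [xs|xs] := leP x (n%:R * h); first by apply: IH; rewrite ?x0.
  have nh0 : 0 <= n%:R * h by rewrite mulr_ge0// ltW.
  apply: (local (n%:R * h)) => //.
  - by apply: IH => //; rewrite nh0 (le_trans (ltW xs)).
  - exact: ltW.
  - by rewrite lerBlDr -[h in h + _]mul1r -mulrDl nat1r.
move=> x x01; apply: (step (Num.bound (1 / h))) => //.
case/andP: x01 => _ x1; rewrite -ler_pdivrMr//.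
apply: (@le_trans _ _ (1 / h)); first by rewrite ler_wpM2r// invr_ge0 ltW.
have : 0 <= 1 / h by rewrite divr_ge0// ltW.
by move=> /archi_boundP/ltW.
Qed.

End Uniqueness.

(** * Exponentials and Fourier synthesis *)

Section RealBounds.
Variable R : realType.

Lemma sin_le (x : R) : 0 <= x -> sin x <= x.
Proof.
move=> x0; have := @mvt_pow R sin cos 0 x 1 0 x0 (sin0 R).
rewrite subr0 expr1 mul1r divr1; apply.
by move=> y _; rewrite expr0 mulr1 cos_le1.
Qed.

Lemma one_sub_cos_le (x : R) : 0 <= x -> 1 - cos x <= x ^+ 2 / 2.
Proof.
move=> x0; have := @mvt_pow R (fun y => 1 - cos y) sin 0 x 1 1 x0.
rewrite subr0 mul1r; apply; first by rewrite cos0 subrr.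
  move=> y _.
  have := is_deriveB (is_derive_cst (1 : R) y (1 : R)) (is_derive_cos y).
  by rewrite sub0r opprK.
by move=> y /andP[y0 _]; rewrite subr0 mul1r; exact: sin_le.
Qed.

Lemma sub_sin_le (x : R) : 0 <= x -> x - sin x <= x ^+ 2 / 2.
Proof.
move=> x0; have := @mvt_pow R (fun y => y - sin y) (fun y => 1 - cos y) 0 x 1 1 x0.
rewrite subr0 mul1r; apply; first by rewrite sin0 subrr.
move=> y /andP[y0 _]; rewrite subr0 mul1r expr1.
have := @mvt_pow R (fun y => 1 - cos y) sin 0 y 1 0 y0.
rewrite subr0 mul1r divr1 expr1; apply; first by rewrite cos0 subrr.
  move=> z _.
  have := is_deriveB (is_derive_cst (1 : R) z (1 : R)) (is_derive_cos z).
  by rewrite sub0r opprK.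
by move=> z _; rewrite expr0 mulr1 sin_le1.
Qed.

Lemma norm_sin_le (x : R) : `|sin x| <= `|x|.
Proof.
wlog x0 : x / 0 <= x => [H|].
  by case: (leP 0 x) => [/H//|x0]; rewrite -normrN -sinN -(normrN x) H// oppr_ge0 ltW.
rewrite (ger0_norm x0) ler_norml sin_le// andbT.
have := @mvt_pow R (fun y => - sin y) (fun y => - cos y) 0 x 1 0 x0.
rewrite subr0 mul1r divr1 expr1 lerNl; apply; first by rewrite sin0 oppr0.
by move=> y _; rewrite expr0 mulr1 lerNl cos_geN1.
Qed.

Lemma norm_cos_sub1 (x : R) : `|cos x - 1| <= x ^+ 2 / 2.
Proof.
rewrite distrC ger0_norm ?subr_ge0 ?cos_le1//.
case: (leP 0 x) => [/one_sub_cos_le//|x0].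
by rewrite -cosN -sqrrN; apply: one_sub_cos_le; rewrite oppr_ge0 ltW.
Qed.

Lemma norm_sin_sub (x : R) : `|sin x - x| <= x ^+ 2 / 2.
Proof.
wlog x0 : x / 0 <= x => [H|].
  case: (leP 0 x) => [/H//|x0].
  have -> : sin x - x = - (sin (- x) - - x) by rewrite sinN; ring.
  by rewrite normrN -sqrrN H// oppr_ge0 ltW.
by rewrite distrC ger0_norm ?subr_ge0 ?sin_le// sub_sin_le.
Qed.

Lemma expR_sub1_le (x : R) : expR x - 1 <= x * expR x.
Proof.
have := expR_ge1Dx (- x); move=> /(ler_wpM2l (expR_ge0 x)).
by rewrite -expRD subrr expR0; lra.
Qed.

Lemma norm_expR_sub1 (x : R) : `|expR x - 1| <= `|x| * expR `|x|.
Proof.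
have H := expR_sub1_le x; have G := expR_ge1Dx x.
case: (leP 0 x) => x0.
  by rewrite ger0_norm ?(ger0_norm x0)//; lra.
have e1 : expR x <= 1 by rewrite -expR0 ler_expR ltW.
rewrite ler0_norm ?subr_le0// (ltr0_norm x0) opprB.
have : 1 <= expR (- x) by rewrite -expR0 ler_expR oppr_ge0 ltW.
move=> /(ler_wpM2l (_ : 0 <= - x)); rewrite oppr_ge0 (ltW x0) => /(_ isT); lra.
Qed.

Lemma norm_expR_sub1x (x : R) : `|expR x - 1 - x| <= x ^+ 2 * expR `|x|.
Proof.
have H := expR_sub1_le x; have G := expR_ge1Dx x.
rewrite ger0_norm; last by lra.
have : expR x - 1 - x <= `|x| * `|expR x - 1|.
  by rewrite -normrM; apply: le_trans (ler_norm _); lra.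
move=> /le_trans; apply; rewrite -[x ^+ 2]real_normK ?num_real// expr2 -mulrA.
by apply: ler_wpM2l => //; exact: norm_expR_sub1.
Qed.

End RealBounds.

Section ComplexExp.
Variable R : realType.

Lemma cabs_sqr (z : R[i]) : cabs z ^+ 2 = Re z ^+ 2 + Im z ^+ 2.
Proof. by case: z => a b; rewrite /cabs /= sqr_sqrtr// addr_ge0// sqr_ge0. Qed.

Lemma cabs_expi (x : R) : cabs (expi x) = 1.
Proof. by rewrite /cabs /expi /= cos2Dsin2 sqrtr1. Qed.

Lemma expiD (x y : R) : expi (x + y) = expi x * expi y.
Proof.
rewrite /expi cosD sinD; apply/eqP; rewrite eq_complex /= eqxx /=.
by apply/eqP; rewrite addrC [sin x * _]mulrC; ring.
Qed.

Lemma expi0 : expi (0 : R) = 1.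
Proof. by rewrite /expi cos0 sin0. Qed.

Definition cexp (w : R[i]) : R[i] := (expR (Re w))%:C * expi (Im w).

Lemma cabs_cexp w : cabs (cexp w) = expR (Re w).
Proof. by rewrite /cexp cabsM cabs_expi mulr1 cabsR ger0_norm// expR_ge0. Qed.

Lemma cexpD w z : cexp (w + z) = cexp w * cexp z.
Proof. by rewrite /cexp cReD cImD expRD expiD rmorphM /=; ring. Qed.

(** Only the quadratic dependence on |w|, with an exponential factor that a
    weight can absorb, matters below; the constant 3 is not optimal. *)
Lemma cexp_bound w : cabs (cexp w - 1 - w) <= 3 * cabs w ^+ 2 * expR (cabs w).
Proof.
set x := Re w; set y := Im w; set E := expR (cabs w).
have xw : `|x| <= cabs w := cabs_Re w.
have yw : `|y| <= cabs w := cabs_Im w.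
have w0 := cabs_ge0 w.
have ex : expR `|x| <= E by rewrite ler_expR.
have E1 : 1 <= E by rewrite -expR0 ler_expR.
have wE : w = x +i* y by rewrite /x /y; case: (w).
have e0 : 0 <= expR x by exact: expR_ge0.
have exE : expR x <= E by rewrite ler_expR (le_trans (ler_norm x)).
have x2 : x ^+ 2 + y ^+ 2 = cabs w ^+ 2 by rewrite cabs_sqr.
have sx := sqr_ge0 x; have sy := sqr_ge0 y.
apply: (le_trans (cabs_ReIm _)).
have -> : Re (cexp w - 1 - w) = expR x * (cos y - 1) + (expR x - 1 - x).
  by rewrite !cReD !cReN /cexp cReM /= -/x -/y; ring.
have -> : Im (cexp w - 1 - w) = (expR x - 1) * sin y + (sin y - y).
  by rewrite !cImD !cImN /cexp cImM /= -/x -/y; ring.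
have H1 : `|expR x * (cos y - 1) + (expR x - 1 - x)| <= E * cabs w ^+ 2.
  apply: (le_trans (ler_normD _ _)); rewrite normrM (ger0_norm e0).
  have A1 : expR x * `|cos y - 1| <= E * y ^+ 2.
    apply: ler_pM => //; apply: (le_trans (norm_cos_sub1 y)); lra.
  have A2 : `|expR x - 1 - x| <= x ^+ 2 * E.
    by apply: (le_trans (norm_expR_sub1x x)); apply: ler_wpM2l.
  by rewrite -x2; lra.
have H2 : `|(expR x - 1) * sin y + (sin y - y)| <= 2 * (E * cabs w ^+ 2).
  apply: (le_trans (ler_normD _ _)); rewrite normrM.
  have A1 : `|expR x - 1| * `|sin y| <= (cabs w * E) * cabs w.
    apply: ler_pM => //; last exact: le_trans (norm_sin_le y) yw.
    apply: (le_trans (norm_expR_sub1 x)); exact: ler_pM.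
  have A2 : `|sin y - y| <= E * cabs w ^+ 2.
    apply: (le_trans (norm_sin_sub y)).
    have : 1 * cabs w ^+ 2 <= E * cabs w ^+ 2 by apply: ler_wpM2r => //; exact: sqr_ge0.
    by rewrite -x2; lra.
  move: A1 A2; rewrite expr2; lra.
lra.
Qed.

End ComplexExp.

Section Synthesis.
Variable R : realType.
Implicit Types (a b : int -> R[i]) (k : int) (d : R).

Local Notation ab k := (`|(k : int)%:~R : R|).

(** The derivative in x multiplies the k-th coefficient by [freq k]. *)
Definition freq k : R[i] := (2 * pi * k%:~R)%:C * 'i.

(** The Fourier series at complex arguments. *)
Definition synthz a (z : R[i]) : R[i] := csum (fun k => a k * cexp (freq k * z)).

Definition ek k (x : R) : R[i] := expi (2 * k%:~R * pi * x).

Definition synth a (x : R) : R[i] := csum (fun k => a k * ek k x).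

Lemma cabs_freq k : cabs (freq k) = 2 * pi * ab k.
Proof. by rewrite /freq cabsM cabs_i mulr1 cabsR normrM ger0_norm ?twopi_ge0. Qed.

Lemma ekE k x : ek k x = cexp (freq k * x%:C).
Proof.
rewrite /ek /cexp cReM cImM /freq /= !(mul0r, mulr0, mulr1, oppr0, subr0, add0r, addr0).
by rewrite expR0 mul1r; congr expi; ring.
Qed.

Lemma synthE a x : synth a x = synthz a x%:C.
Proof. by apply: eq_csum => k; rewrite ekE. Qed.

Lemma cabs_ek k x : cabs (ek k x) = 1. Proof. exact: cabs_expi. Qed.

Lemma cexp_freq_le k z : cabs (cexp (freq k * z)) <= expR (2 * pi * `|Im z| * ab k).
Proof.
rewrite cabs_cexp ler_expR cReM /freq /= !(mul0r, mulr0, mulr1, oppr0, subr0, add0r, addr0).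
apply: (le_trans (ler_norm _)); rewrite normrN !normrM.
by rewrite (ger0_norm (pi_ge0 R)) normr_nat; apply: eq_le_imp; ring.
Qed.

Lemma synth_summ a x : summ a -> summ (fun k => a k * ek k x).
Proof. by apply: le_summ => k; rewrite cabsM cabs_ek mulr1. Qed.

Lemma synthz_summ a d z : `|Im z| <= d -> (Nw d a < +oo)%E ->
  summ (fun k => a k * cexp (freq k * z)).
Proof.
move=> zd; apply: le_lt_trans; apply: le_esumR => k; rewrite cabsM mulrC.
apply: ler_wpM2r; first exact: cabs_ge0.
apply: (le_trans (cexp_freq_le k z)); rewrite -[leLHS]mul1r.
apply: ler_pM; rewrite ?expR_ge0 ?om_ge1//.
rewrite ler_expR; apply: ler_wpM2r => //; apply: ler_wpM2l => //; exact: twopi_ge0.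
Qed.

Lemma freq_om k : cabs (freq k) <= 8 * om R k.
Proof.
rewrite cabs_freq /om; have := @pi_le4 R; have := normr_ge0 (k%:~R : R).
move: (ab k) => x x0 p4.
have : 2 * pi * x <= 8 * x by apply: ler_wpM2r => //; lra.
lra.
Qed.

(** The second order Taylor remainder of a mode involves the square of its
    frequency, which the exponential weight absorbs. *)
Lemma freq_sqr_le e k : 0 < e ->
  cabs (freq k) ^+ 2 <= 4 / e ^+ 2 * expR (2 * pi * e * ab k).
Proof.
move=> e0; rewrite cabs_freq; set x := 2 * pi * ab k.
have x0 : 0 <= x by rewrite /x; apply: mulr_ge0; [exact: twopi_ge0|].
have -> : 2 * pi * e * ab k = e * x / 2 + e * x / 2 by rewrite /x; field.
rewrite expRD -expr2; set y := expR _.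
have : e * x / 2 <= y by apply: le_trans (expR_ge1Dx _); rewrite lerDr.
move=> H; rewrite mulrAC ler_pdivlMr ?exprn_gt0// -exprMn.
have : (e * x / 2) ^+ 2 <= y ^+ 2.
  by apply: lerXn2r => //; rewrite nnegrE ?expR_ge0//; have := ltW e0; nneg.
rewrite expr_div_n ler_pdivrMr ?exprn_gt0// => K.
by rewrite mulrC [4 * _]mulrC (le_trans K)// -natrX.
Qed.

(** The margin d - |Im z| is split in two halves eta. For |h| < eta the
    remainder of the mode k is at most |h|^2 |freq k|^2 exp(2 pi (|Im z| + eta)
    |k|) up to a constant; the second half absorbs the square of the frequency,
    and the sum over k is bounded by the norm of the coefficients. *)
Lemma synthz_cdiff a d z : `|Im z| < d -> (Nw d a < +oo)%E ->
  cdiff (synthz a) z (synthz (fun k => freq k * a k) z).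
Proof.
move=> zd ao e e0.
pose eta := (d - `|Im z|) / 2.
have eta0 : 0 < eta by rewrite divr_gt0// subr_gt0.
have dE : d = `|Im z| + eta + eta by rewrite /eta; field.
pose N := fine (Nw d a); have NE : Nw d a = N%:E := Nw_fin ao.
have N0 : 0 <= N by rewrite fine_ge0// Nw_ge0.
have e20 : 0 < eta ^+ 2 by exact: exprn_gt0.
(* 12 is the 3 of [cexp_bound] times the 4 of [freq_sqr_le]. *)
pose C := 12 / eta ^+ 2 * N + 1.
have C0 : 0 < C by rewrite ltr_wpDl//; have := ltW e20; nneg.
(* the second order remainder of one mode, dominated by the weight *)
have key k h : cabs h < eta ->
    cabs (a k * (cexp (freq k * (z + h)) - cexp (freq k * z) - freq k * h * cexp (freq k * z)))
    <= cabs h ^+ 2 * (12 / eta ^+ 2) * (wt d k * cabs (a k)).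
  move=> hh.
  have -> : a k * (cexp (freq k * (z + h)) - cexp (freq k * z) - freq k * h * cexp (freq k * z))
     = a k * (cexp (freq k * z) * (cexp (freq k * h) - 1 - freq k * h)).
    by rewrite (mulrDr (freq k)) cexpD; ring.
  rewrite (cabsM (a k)) (cabsM (cexp _)) [leLHS]mulrC mulrA.
  apply: ler_wpM2r; first exact: cabs_ge0.
  have B1 := cexp_freq_le k z.
  have B2 := cexp_bound (freq k * h).
  have B3 : expR (cabs (freq k * h)) <= expR (2 * pi * eta * ab k).
    rewrite ler_expR cabsM cabs_freq mulrAC; apply: ler_wpM2r => //.
    by apply: ler_wpM2l; [exact: twopi_ge0|exact: ltW].
  have B4 := freq_sqr_le k eta0.
  have W : expR (2 * pi * `|Im z| * ab k) * expR (2 * pi * eta * ab k) * expR (2 * pi * eta * ab k) <= wt d k.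
    rewrite /wt -!expRD dE -[leLHS]mul1r.
    apply: ler_pM; rewrite ?expR_ge0// ?om_ge1//.
    by rewrite ler_expR; apply: eq_le_imp; ring.
  apply: (@le_trans _ _ (expR (2 * pi * `|Im z| * ab k) *
     (3 * ((4 / eta ^+ 2 * expR (2 * pi * eta * ab k)) * cabs h ^+ 2) * expR (2 * pi * eta * ab k)))).
    apply: ler_pM => //; [exact: cabs_ge0|exact: cabs_ge0|].
    apply: (le_trans B2); rewrite cabsM exprMn; have hc := cabs_ge0 h.
    have fc := cabs_ge0 (freq k).
    apply: ler_pM; [nneg|exact: expR_ge0| |by rewrite -cabsM].
    apply: ler_wpM2l => //; apply: ler_wpM2r => //; exact: exprn_ge0.
  apply: (@le_trans _ _ (cabs h ^+ 2 * (12 / eta ^+ 2) *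
    (expR (2 * pi * `|Im z| * ab k) * expR (2 * pi * eta * ab k) * expR (2 * pi * eta * ab k)))).
    by apply: eq_le_imp; ring.
  apply: ler_wpM2l => //; have := cabs_ge0 h; have := ltW e20; nneg.
exists (Num.min eta (e / C)); first by rewrite lt_min eta0 divr_gt0.
move=> h h0; rewrite lt_min => /andP[hh hC].
have ch : 0 < cabs h.
  by rewrite lt_def cabs_ge0 andbT; apply: contra h0 => /eqP/cabs_eq0 ->.
have s1 : summ (fun k => a k * cexp (freq k * (z + h))).
  apply: (synthz_summ (d := d)) => //; rewrite cImD (le_trans (ler_normD _ _))//.
  by have := cabs_Im h; lra.
have s2 : summ (fun k => a k * cexp (freq k * z)).
  by apply: (synthz_summ (d := d)) => //; exact: ltW.
have s4 : summ (fun k => a k * (cexp (freq k * (z + h)) - cexp (freq k * z) - freq k * h * cexp (freq k * z))).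
  apply: (@le_esumR_fin _ _ _ (fun k => cabs h ^+ 2 * (12 / eta ^+ 2) * (wt d k * cabs (a k)))).
    by move=> k; exact: key.
  rewrite esumRZ.
  - by rewrite -/(Nw d a) NE -EFinM ltry.
  - by have := ltW ch; have := ltW e20; nneg.
  - by move=> k; exact: wt_term_ge0.
have s3 : summ (fun k => freq k * a k * cexp (freq k * z)).
  have := summZ h^-1 (summD (summD s1 (summN s2)) (summN s4)).
  congr summ; apply/funext => k.
  rewrite -[RHS]mul1r -(mulVf h0); ring.
have -> : (synthz a (z + h) - synthz a z) / h - synthz (fun k => freq k * a k) z =
   h^-1 * csum (fun k => a k * (cexp (freq k * (z + h)) - cexp (freq k * z) - freq k * h * cexp (freq k * z))).
  rewrite -[X in _ - X]mul1r -(mulVf h0) -mulrA mulrC -mulrBr; congr (_ * _).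
  rewrite /synthz -csumZ// -csumB// -csumB//; last by exact: summZ.
    by apply: eq_csum => k; ring.
  exact: summD s1 (summN s2).
rewrite cabsM cabsV mulrC ler_pdivrMr//.
apply: (@le_trans _ _ (cabs h ^+ 2 * (12 / eta ^+ 2) * N)).
  apply: csum_le; rewrite EFinM -NE /Nw -esumRZ.
  - by apply: le_esumR => k; exact: key.
  - by have := ltW ch; have := ltW e20; nneg.
  - by move=> k; exact: wt_term_ge0.
rewrite -mulrA expr2 -mulrA [e * _]mulrC; apply: ler_wpM2l; first exact: ltW.
apply: (@le_trans _ _ (e / C * (12 / eta ^+ 2 * N))).
  by apply: ler_wpM2r; [have := ltW e20; nneg|exact: ltW].
rewrite mulrAC ler_pdivrMr//; apply: ler_wpM2l; first exact: ltW.
by rewrite /C lerDl.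
Qed.

Lemma synth_dx a d : 0 < d -> (Nw d a < +oo)%E ->
  is_dx (synth a) (synth (fun k => freq k * a k)).
Proof.
move=> d0 ao x.
have z0 : `|Im (x%:C)| < d by rewrite /= normr0.
have H := synthz_cdiff z0 ao.
have H' : cdiff (synthz a) (x%:C * 1) (synthz (fun k => freq k * a k) x%:C) by rewrite mulr1.
rewrite synthE; split.
  have := cdiff_line 1 H'; rewrite !mul1r; congr is_derive.
  by apply/funext => s; rewrite mulr1 mul1r synthE.
have ImE (z : R[i]) : Re (- 'i * z) = Im z by case: z => u v /=; ring.
have := cdiff_line (- 'i) H'; rewrite mul1r ImE; congr is_derive.
by apply/funext => s; rewrite mulr1 ImE synthE.
Qed.

End Synthesis.

(** * Integration over the circle *)

Section CircleIntegral.
Variable R : realType.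
Local Notation mu := (@lebesgue_measure R).
Local Notation I01 := (`[0%R, 1%R]%classic : set R).
Implicit Types f g : R -> R[i].

Definition cintegrable f :=
  mu.-integrable I01 (EFin \o (fun x => Re (f x))) /\
  mu.-integrable I01 (EFin \o (fun x => Im (f x))).

Definition ccont f := continuous (fun x => Re (f x)) /\ continuous (fun x => Im (f x)).

Lemma mI01 : @measurable _ (measurableTypeR R) `[0%R, 1%R]%classic.
Proof. exact: measurable_itv. Qed.

Lemma integrable01_cont (f : R -> R) : continuous f -> mu.-integrable I01 (EFin \o f).
Proof.
move=> fc; apply: continuous_compact_integrable; first exact: segment_compact.
exact: continuous_subspaceT.
Qed.

Lemma ccont_cintegrable f : ccont f -> cintegrable f.
Proof. by move=> [h1 h2]; split; exact: integrable01_cont. Qed.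

Lemma integrable01D (f g : R -> R) : mu.-integrable I01 (EFin \o f) ->
  mu.-integrable I01 (EFin \o g) -> mu.-integrable I01 (EFin \o (fun x => f x + g x)).
Proof. move=> hf hg; exact: (integrableD mI01 hf hg). Qed.

Lemma integrable01Z c (f : R -> R) : mu.-integrable I01 (EFin \o f) ->
  mu.-integrable I01 (EFin \o (fun x => c * f x)).
Proof. by move=> hf; exact: (integrableZl mI01 c hf). Qed.

Lemma cintegrableD f g : cintegrable f -> cintegrable g ->
  cintegrable (fun x => f x + g x).
Proof.
move=> [f1 f2] [g1 g2]; split.
  rewrite (_ : (fun x => Re (f x + g x)) = fun x => Re (f x) + Re (g x)).
    exact: integrable01D.
  by apply/funext => x; rewrite cReD.
rewrite (_ : (fun x => Im (f x + g x)) = fun x => Im (f x) + Im (g x)).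
  exact: integrable01D.
by apply/funext => x; rewrite cImD.
Qed.

Lemma cintegrableZ c f : cintegrable f -> cintegrable (fun x => c * f x).
Proof.
move=> [f1 f2]; split.
  rewrite (_ : (fun x => Re (c * f x)) = fun x => Re c * Re (f x) + - Im c * Im (f x)).
    by apply: integrable01D; exact: integrable01Z.
  by apply/funext => x; rewrite cReM mulNr.
rewrite (_ : (fun x => Im (c * f x)) = fun x => Re c * Im (f x) + Im c * Re (f x)).
  by apply: integrable01D; exact: integrable01Z.
by apply/funext => x; rewrite cImM.
Qed.

Lemma cintD f g : cintegrable f -> cintegrable g ->
  cint (fun x => f x + g x) = cint f + cint g.
Proof.
move=> [f1 f2] [g1 g2]; rewrite /cint.
under eq_Rintegral do rewrite cReD.
under [X in _ +i* X]eq_Rintegral do rewrite cImD.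
by rewrite (RintegralD mI01 f1 g1) (RintegralD mI01 f2 g2).
Qed.

Lemma cintZ c f : cintegrable f -> cint (fun x => c * f x) = c * cint f.
Proof.
move=> [f1 f2]; rewrite /cint.
under eq_Rintegral do rewrite cReM -mulNr.
under [X in _ +i* X]eq_Rintegral do rewrite cImM.
rewrite (RintegralD mI01 (integrable01Z _ f1) (integrable01Z _ f2)).
rewrite (RintegralD mI01 (integrable01Z _ f2) (integrable01Z _ f1)).
rewrite !(RintegralZl _ mI01 f1) !(RintegralZl _ mI01 f2).
by case: c => a b; rewrite mulNr.
Qed.

Lemma cintB f g : cintegrable f -> cintegrable g ->
  cint (fun x => f x - g x) = cint f - cint g.
Proof.
move=> hf hg; rewrite -[- cint g]mulN1r -cintZ// -cintD//; last exact: cintegrableZ.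
by congr cint; apply/funext => x; rewrite mulN1r.
Qed.

Lemma Rintegral01_bound (f : R -> R) M : mu.-integrable I01 (EFin \o f) ->
  (forall x, 0 <= x <= 1 -> `|f x| <= M) -> `|\int[mu]_(x in I01) f x| <= M.
Proof.
move=> fi fM; apply: (le_trans (le_normr_Rintegral mI01 fi)).
have mM : mu.-integrable I01 (EFin \o (fun=> M)).
  by apply: integrable01_cont; exact: cst_continuous.
apply: (@le_trans _ _ (\int[mu]_(x in I01) M)).
  apply: le_Rintegral => //; first exact: (integrable_norm fi).
by rewrite Rintegral_cst ?mI01//= lebesgue_measure_itv/= lte_fin ltr01 oppr0 adde0 mulr1.
Qed.

(** Real and imaginary parts are bounded separately, whence the factor 2. *)
Lemma cint_bound f M : cintegrable f ->
  (forall x, 0 <= x <= 1 -> cabs (f x) <= M) -> cabs (cint f) <= 2 * M.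
Proof.
move=> [f1 f2] fM; apply: (le_trans (cabs_ReIm _)).
rewrite mulrDl mul1r; apply: lerD; apply: Rintegral01_bound => // x x01.
  exact: le_trans (cabs_Re _) (fM x x01).
exact: le_trans (cabs_Im _) (fM x x01).
Qed.

Lemma derive_cont (f : R -> R) (x l : R) : is_derive x 1 f l -> {for x, continuous f}.
Proof. by case=> h _; apply: differentiable_continuous; exact/derivable1_diffP. Qed.

Lemma FTC01 (F f : R -> R) : (forall x : R, is_derive x 1 F (f x)) -> continuous f ->
  \int[mu]_(x in I01) f x = F 1 - F 0.
Proof.
move=> dF fc; rewrite /Rintegral (@continuous_FTC2 _ f F 0 1)//.
- exact: continuous_subspaceT.
- split.
  + by move=> x _; case: (dF x).
  + by apply: cvg_at_right_filter; exact: (derive_cont (dF 0)).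
  + by apply: cvg_at_left_filter; exact: (derive_cont (dF 1)).
- by move=> x _; rewrite derive1E; case: (dF x).
Qed.

Lemma cint_dx F f : is_dx F f -> ccont f -> cint f = F 1 - F 0.
Proof.
move=> dF [f1 f2]; rewrite /cint.
rewrite (FTC01 (fun x => (dF x).1) f1) (FTC01 (fun x => (dF x).2) f2).
by case: (F 1) (F 0) => [a b] [c d].
Qed.

Lemma is_dx_ccont F f : is_dx F f -> ccont F.
Proof.
by move=> dF; split=> x; [have := derive_cont (dF x).1|have := derive_cont (dF x).2].
Qed.

Lemma ccontD f g : ccont f -> ccont g -> ccont (fun x => f x + g x).
Proof.
move=> [f1 f2] [g1 g2]; split=> x.
  by under eq_fun do rewrite cReD; exact: cvgD (f1 x) (g1 x).
by under eq_fun do rewrite cImD; exact: cvgD (f2 x) (g2 x).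
Qed.

Lemma ccontM f g : ccont f -> ccont g -> ccont (fun x => f x * g x).
Proof.
move=> [f1 f2] [g1 g2]; split=> x.
  under eq_fun do rewrite cReM.
  exact: cvgB (cvgM (f1 x) (g1 x)) (cvgM (f2 x) (g2 x)).
under eq_fun do rewrite cImM.
exact: cvgD (cvgM (f1 x) (g2 x)) (cvgM (f2 x) (g1 x)).
Qed.

Lemma ccont_cst (c : R[i]) : ccont (fun=> c).
Proof. by split; exact: cst_continuous. Qed.

Lemma ccontZ c f : ccont f -> ccont (fun x => c * f x).
Proof. by move=> fc; apply: ccontM => //; exact: ccont_cst. Qed.

Lemma ccont_sum (I : Type) (s : seq I) (F : I -> R -> R[i]) :
  (forall i, ccont (F i)) -> ccont (fun x => \sum_(i <- s) F i x).
Proof.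
move=> H; elim: s => [|i s IH].
  by under eq_fun do rewrite big_nil; exact: ccont_cst.
by under eq_fun do rewrite big_cons; exact: ccontD.
Qed.

Lemma cint_sum (I : Type) (s : seq I) (F : I -> R -> R[i]) :
  (forall i, ccont (F i)) ->
  cint (fun x => \sum_(i <- s) F i x) = \sum_(i <- s) cint (F i).
Proof.
move=> H; elim: s => [|i s IH].
  rewrite big_nil; under eq_fun do rewrite big_nil.
  rewrite -[RHS](mul0r (cint (fun=> 0))) -cintZ; last exact/ccont_cintegrable/ccont_cst.
  by congr cint; apply/funext => x; rewrite mulr0.
rewrite big_cons -IH -cintD; last 2 first.
- exact: ccont_cintegrable.
- by apply: ccont_cintegrable; exact: ccont_sum.
by congr cint; apply/funext => x; rewrite big_cons.
Qed.

Local Notation ab k := (`|(k : int)%:~R : R|).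

Lemma ekD k m x : @ek R (k + m) x = @ek R k x * @ek R m x.
Proof. by rewrite /ek -expiD; congr expi; rewrite intrD; ring. Qed.

Lemma ek0 x : @ek R 0 x = 1.
Proof. by rewrite /ek mulr0 !mul0r expi0. Qed.

(** A single coefficient: properties of one character are instances of
    properties of [synth]. *)
Definition mode (k j : int) : R[i] := if j == k then 1 else 0.

Lemma mode_fin d k : (Nw d (mode k) < +oo)%E.
Proof.
rewrite /Nw (_ : (fun j => _) = fun j => cabs (if j == k then (wt d k)%:C else 0)).
  exact: (summ_pred1 k (wt d k)%:C).1.
apply/funext => j; rewrite /mode; case: eqP => [->|_].
  by rewrite cabs1 mulr1 cabsR ger0_norm// wt_ge0.
by rewrite !cabs0 mulr0.
Qed.

Lemma synth_mode k : synth (mode k) = @ek R k.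
Proof.
apply/funext => x; rewrite -[RHS](summ_pred1 k (@ek R k x)).2.
by apply: eq_csum => j; rewrite /mode; case: eqP => [->|_]; rewrite ?mul1r ?mul0r.
Qed.

Lemma ek_dx k : is_dx (@ek R k) (fun x => freq R k * @ek R k x).
Proof.
have := synth_dx ltr01 (mode_fin 1 k); rewrite synth_mode.
congr is_dx; apply/funext => x; rewrite -[RHS](summ_pred1 k (freq R k * @ek R k x)).2.
apply: eq_csum => j; rewrite /mode; case: eqP => [->|_]; first by rewrite mulr1.
by rewrite mulr0 mul0r.
Qed.

Lemma ek_ccont k : ccont (@ek R k).
Proof. exact: is_dx_ccont (ek_dx k). Qed.

Lemma sin2pik (k : int) : sin (2 * k%:~R * pi : R) = 0 /\ cos (2 * k%:~R * pi : R) = 1.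
Proof.
have nat_case (n : nat) : sin (n%:R * (2 * pi) : R) = 0 /\ cos (n%:R * (2 * pi) : R) = 1.
  elim: n => [|n [IH1 IH2]]; first by rewrite mul0r sin0 cos0.
  have -> : n.+1%:R * (2 * pi) = n%:R * (2 * pi) + pi *+ 2 :> R.
    by rewrite -natr1 mulr2n; ring.
  by rewrite sinD2pi cosD2pi.
have E n : 2 * n%:~R * pi = n%:~R * (2 * pi) :> R by ring.
case: k => n; first by rewrite E; exact: nat_case.
rewrite E NegzE mulrNz mulNr sinN cosN; have [-> ->] := nat_case n.+1.
by rewrite oppr0.
Qed.

Lemma ek1 k : @ek R k 1 = 1.
Proof. by rewrite /ek mulr1 /expi; have [-> ->] := sin2pik k. Qed.

Lemma ek00 k : @ek R k 0 = 1.
Proof. by rewrite /ek mulr0 expi0. Qed.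

Lemma ek_periodic k : periodic1 (@ek R k).
Proof.
by move=> x; rewrite /ek mulrDr expiD; have := ek1 k; rewrite /ek => ->; rewrite mulr1.
Qed.

Lemma freq_neq0 k : k != 0 -> freq R k != 0.
Proof.
move=> k0; rewrite /freq mulf_neq0//; last by rewrite eq_complex /= oner_eq0 andbF.
by rewrite (inj_eq (@complexI R)) !mulf_neq0// ?intr_eq0// gt_eqF// pi_gt0.
Qed.

Lemma cint_ek k : cint (@ek R k) = if k == 0 then 1 else 0.
Proof.
case: eqP => [->|/eqP k0].
  rewrite (_ : @ek R 0 = fun=> 1); last by apply/funext => x; exact: ek0.
  rewrite /cint /= !Rintegral_cst ?mI01//= lebesgue_measure_itv/= lte_fin ltr01.
  by rewrite oppr0 adde0/= mul0r mulr1.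
have := cint_dx (ek_dx k) (ccontZ (freq R k) (ek_ccont k)).
rewrite ek1 ek00 subrr cintZ; last exact/ccont_cintegrable/ek_ccont.
by move=> /eqP; rewrite mulf_eq0 (negPf (freq_neq0 k0)) /= => /eqP.
Qed.

Lemma fhatE f k : fhat f k = cint (fun x => f x * @ek R (- k) x).
Proof.
congr cint; apply/funext => x; congr (_ * _); rewrite /ek; congr expi.
by rewrite mulrNz; ring.
Qed.

Lemma fhat_trig (a : int -> R[i]) s m : uniq s ->
  fhat (fun x => \sum_(k <- s) a k * @ek R k x) m = if m \in s then a m else 0.
Proof.
move=> us; rewrite fhatE.
rewrite (_ : (fun x => _) = fun x => \sum_(k <- s) a k * @ek R (k - m) x); last first.
  by apply/funext => x; rewrite big_distrl/=; apply: eq_bigr => k _; rewrite ekD mulrA.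
rewrite cint_sum; last by move=> k; exact/ccontZ/ek_ccont.
under eq_bigr => k _ do rewrite (cintZ _ (ccont_cintegrable (ek_ccont (k - m)))) cint_ek subr_eq0.
case: ifPn => ms.
  rewrite (bigD1_seq m)//= eqxx mulr1 big1 ?addr0// => k /negPf ->.
  by rewrite mulr0.
rewrite big_seq big1// => k ks; case: eqP => [E|_]; last by rewrite mulr0.
by rewrite E in ks; rewrite ks in ms.
Qed.

Lemma synth_ccont (a : int -> R[i]) d : 0 < d -> (Nw d a < +oo)%E -> ccont (synth a).
Proof. by move=> d0 ao; exact: is_dx_ccont (synth_dx d0 ao). Qed.

Lemma synth_periodic (a : int -> R[i]) : periodic1 (synth a).
Proof. by move=> x; apply: eq_csum => k; rewrite ek_periodic. Qed.

(** Truncate the series to a finite set of frequencies containing m: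
    orthogonality computes the coefficient of the truncation, and the rest is
    uniformly small. *)
Lemma fhat_synth (a : int -> R[i]) d m : 0 < d -> (Nw d a < +oo)%E -> fhat (synth a) m = a m.
Proof.
move=> d0 ao; have sa : summ a := Nw_summ (ltW d0) ao.
apply/eqP; rewrite -subr_eq0; apply/eqP; apply: cabs_eq0; apply/eqP.
rewrite eq_le cabs_ge0 andbT; apply/ler_addgt0Pl => e e0; rewrite addr0.
have e2 : 0 < e / 2 by rewrite divr_gt0.
have [s us Hs] := csum_approx sa e2.
(* m itself has to be among the frequencies kept *)
pose s' := undup (m :: s).
have us' : uniq s' by exact: undup_uniq.
have [|T _] := Hs s' us'; first by move=> k ks; rewrite mem_undup in_cons ks orbT.
have ms' : m \in s' by rewrite mem_undup mem_head.
have c1 := synth_ccont d0 ao.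
have c2 : ccont (fun x => \sum_(k <- s') a k * @ek R k x).
  by apply: ccont_sum => k; exact/ccontZ/ek_ccont.
have -> : fhat (synth a) m - a m =
    cint (fun x => (synth a x - \sum_(k <- s') a k * @ek R k x) * @ek R (- m) x).
  rewrite (_ : a m = fhat (fun x => \sum_(k <- s') a k * @ek R k x) m); last first.
    by rewrite fhat_trig// ms'.
  rewrite !fhatE -cintB; last 2 first.
  - by apply: ccont_cintegrable; exact/ccontM/ek_ccont.
  - by apply: ccont_cintegrable; exact/ccontM/ek_ccont.
  by congr cint; apply/funext => x; rewrite mulrBl.
have H x : cabs ((synth a x - \sum_(k <- s') a k * @ek R k x) * @ek R (- m) x) <= e / 2.
  rewrite cabsM cabs_ek mulr1.
  have [S1 S2] := csum_seq (fun k => a k * @ek R k x) us'.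
  rewrite -S2 /synth -csumB//; last exact: synth_summ.
  apply: csum_le; apply: le_trans T; apply: le_esumR => k.
  case: ifP; first by rewrite subrr.
  by rewrite subr0 cabsM cabs_ek mulr1.
have -> : e = 2 * (e / 2) by field.
apply: cint_bound => //; apply: ccont_cintegrable; apply: ccontM; last exact: ek_ccont.
have := ccontD c1 (ccontZ (-1) c2).
by congr ccont; apply/funext => x; rewrite mulN1r.
Qed.

Definition convol (a b : int -> R[i]) k := csum (fun m => a m * b (k - m)).

Lemma conv_summ (a b : int -> R[i]) (k : int) : summ a -> summ b -> summ (fun m => a m * b (k - m)).
Proof.
move=> sa sb; have := summM sa sb.
rewrite /summ (ell1_reindex _ conv_bij) => /(summ_slice (f := fun p : int * int => a p.2 * b (p.1 - p.2)) k).
by [].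
Qed.

Lemma synthM a b x : summ a -> summ b -> synth a x * synth b x = synth (convol a b) x.
Proof.
move=> sa sb; rewrite /synth -csumM; [|exact: synth_summ|exact: synth_summ].
have := summM (synth_summ x sa) (synth_summ x sb).
rewrite (csum_reindex _ conv_bij) /summ (ell1_reindex _ conv_bij) => sM.
rewrite csum_pair//=; apply: eq_csum => k.
rewrite /convol [RHS]mulrC -csumZ; last exact: conv_summ.
apply: eq_csum => m; have -> : ek k x = ek m x * ek (k - m) x by rewrite -ekD addrC subrK.
ring.
Qed.

Lemma wt_subM (d : R) (k m : int) : 0 <= d -> wt d k <= wt d m * wt d (k - m).
Proof.
move=> d0; rewrite /wt mulrACA -expRD -mulrDr.
have H : ab k <= ab m + ab (k - m) by rewrite -{1}(subrK m k) addrC abD.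
apply: ler_pM; rewrite ?expR_ge0 ?(ltW (om_gt0 _ _))//.
  rewrite /om; have := mulr_ge0 (ab_ge0 R m) (ab_ge0 R (k - m)); lra.
rewrite ler_expR; apply: ler_wpM2l => //; apply: mulr_ge0 => //; exact: twopi_ge0.
Qed.

(** The weight is submultiplicative along k = m + (k - m), so the norm is an
    algebra norm. *)
Lemma Nw_conv d a b : 0 <= d -> (Nw d b < +oo)%E ->
  (Nw d (convol a b) <= Nw d a * Nw d b)%E.
Proof.
move=> d0 bo; rewrite -esumR_conv//; try by move=> k; exact: wt_term_ge0.
apply: le_esum => k _; rewrite EFinM.
apply: (@le_trans _ _ ((wt d k)%:E * ell1 (fun m => a m * b (k - m))%R)%E).
  by apply: lee_wpmul2l; [rewrite lee_fin wt_ge0|exact: csum_cabs].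
rewrite /ell1 -esumRZ ?wt_ge0//; last by move=> m; exact: cabs_ge0.
apply: le_esumR => m; rewrite (cabsM (a m)) [leRHS]mulrACA; apply: ler_wpM2r; last exact: wt_subM.
by apply: mulr_ge0; exact: cabs_ge0.
Qed.

End CircleIntegral.

(** * Uniqueness of Fourier coefficients *)

Section FourierUniqueness.
Variable R : realType.
Local Notation mu := (@lebesgue_measure R).
Local Notation I01 := (`[0%R, 1%R]%classic : set R).
Implicit Types f g : R -> R[i].

Lemma integrable01M (f h : R -> R) : mu.-integrable I01 (EFin \o f) -> continuous h ->
  mu.-integrable I01 (EFin \o (fun x => h x * f x)).
Proof.
move=> fi hc.
have mh : measurable_fun (`[0%R, 1%R]%classic : set (measurableTypeR R)) h.
  by apply: measurable_funTS; exact: measurable_realfun.continuous_measurable_fun.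
have bh : [bounded h x | x in I01].
  have : compact (h @` I01).
    apply: continuous_compact; last exact: segment_compact.
    exact: continuous_subspaceT.
  move=> /compact_bounded [M [Mr HM]]; exists M; split => // N MN x x01.
  by apply: HM => //; exists x.
exact: (integrableMr (@mI01 R) mh bh fi).
Qed.

Lemma cintegrableM f h : cintegrable f -> ccont h ->
  cintegrable (fun x => f x * h x).
Proof.
move=> [f1 f2] [h1 h2]; split.
  rewrite (_ : (fun x => Re (f x * h x)) = fun x => Re (h x) * Re (f x) + -1 * (Im (h x) * Im (f x))).
    apply: integrable01D; first exact: integrable01M.
    by apply: integrable01Z; exact: integrable01M.
  by apply/funext => x; rewrite cReM mulN1r [Re (f x) * _]mulrC [Im (f x) * _]mulrC.
rewrite (_ : (fun x => Im (f x * h x)) = fun x => Im (h x) * Re (f x) + Re (h x) * Im (f x)).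
  by apply: integrable01D; exact: integrable01M.
by apply/funext => x; rewrite cImM [Re (f x) * _]mulrC [Im (f x) * _]mulrC.
Qed.

(** The functions orthogonal to all the characters, shown below to vanish. *)
Definition annihil f := cintegrable f /\ forall k, cint (fun x => f x * @ek R k x) = 0.

Lemma annihilM_ek f k : annihil f -> annihil (fun x => f x * @ek R k x).
Proof.
move=> [fi f0]; split; first by apply: cintegrableM => //; exact: ek_ccont.
move=> m; rewrite -(f0 (k + m)); congr cint.
by apply/funext => x; rewrite ekD mulrA.
Qed.

Lemma annihilD f g : annihil f -> annihil g -> annihil (fun x => f x + g x).
Proof.
move=> [fi f0] [gi g0]; split; first exact: cintegrableD.
move=> k; rewrite -[RHS]addr0 -{1}(f0 k) -(g0 k) -cintD.
- by congr cint; apply/funext => x; rewrite mulrDl.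
- by apply: cintegrableM => //; exact: ek_ccont.
- by apply: cintegrableM => //; exact: ek_ccont.
Qed.

Lemma annihilZ c f : annihil f -> annihil (fun x => c * f x).
Proof.
move=> [fi f0]; split; first exact: cintegrableZ.
move=> k; rewrite -[RHS](mulr0 c) -(f0 k) -cintZ.
- by congr cint; apply/funext => x; rewrite mulrA.
- by apply: cintegrableM => //; exact: ek_ccont.
Qed.

(** All trigonometric polynomials have this property. Those needed are obtained
    from [window] by products and by h -> 1 - h, so closure under these two
    operations is enough. *)
Definition multiplier (h : R -> R) := forall f, annihil f ->
  annihil (fun x => (h x)%:C * f x).

Lemma multiplierM h k : multiplier h -> multiplier k -> multiplier (fun x => h x * k x).
Proof.
move=> Hh Hk f af; have := Hh _ (Hk _ af).
by congr annihil; apply/funext => x; rewrite rmorphM mulrA.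
Qed.

Lemma multiplierB1 h : multiplier h -> multiplier (fun x => 1 - h x).
Proof.
move=> Hh f af; have := annihilD af (annihilZ (-1) (Hh _ af)).
congr annihil; apply/funext => x; rewrite rmorphB rmorph1; ring.
Qed.

Lemma multiplierX h n : multiplier h -> multiplier (fun x => h x ^+ n).
Proof.
move=> Hh; elim: n => [|n IH] f af.
  by move: af; congr annihil; apply/funext => x; rewrite expr0 rmorph1 mul1r.
by have := multiplierM Hh IH af; congr annihil; apply/funext => x; rewrite exprS.
Qed.

(** A trigonometric polynomial of degree one with values in [0, 1], which on
    the period ]0, 1[ is below 1/2 on ]0, b[ and above 1/2 on ]b, 1[. *)
Definition window (b x : R) : R := (2 - 2 * (sin (pi * x) * sin (pi * (b - x)))) / 4.

Lemma windowE b x : window b x =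
  (2 + cos (pi * b)) / 4 - (cos (pi * b) * cos (2 * pi * x) + sin (pi * b) * sin (2 * pi * x)) / 4.
Proof.
have E : cos (pi * b) * cos (2 * pi * x) + sin (pi * b) * sin (2 * pi * x) =
   cos (pi * b) + 2 * (sin (pi * x) * sin (pi * (b - x))).
  have -> : 2 * pi * x = pi * x + pi * x by ring.
  rewrite mulrBr sinB cosD sinD.
  have := cos2Dsin2 (pi * x); set c := cos (pi * x); set s := sin (pi * x).
  move: (cos (pi * b)) (sin (pi * b)) => A B cs.
  have -> : A + 2 * (s * (B * c - A * s)) = A * (c ^+ 2 + s ^+ 2) + 2 * (s * (B * c - A * s)).
    by rewrite cs mulr1.
  ring.
by rewrite E /window; field.
Qed.

Lemma window_multiplier b : multiplier (window b).
Proof.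
move=> f af.
have := annihilD (annihilZ ((2 + cos (pi * b)) / 4)%:C af)
  (annihilD (annihilZ (- (cos (pi * b) -i* sin (pi * b)) / 8%:R) (annihilM_ek 1 af))
   (annihilZ (- (cos (pi * b) +i* sin (pi * b)) / 8%:R) (annihilM_ek (-1) af))).
congr annihil; apply/funext => x.
rewrite windowE.
have e1 : @ek R 1 x = cos (2 * pi * x) +i* sin (2 * pi * x).
  by rewrite /ek /expi mulr1.
have em1 : @ek R (-1) x = cos (2 * pi * x) -i* sin (2 * pi * x).
  by rewrite /ek /expi (_ : 2 * (-1)%:~R * pi * x = - (2 * pi * x)) ?cosN ?sinN//; ring.
set A := cos (pi * b); set B := sin (pi * b).
set C := cos (2 * pi * x) in e1 em1 *; set S := sin (2 * pi * x) in e1 em1 *.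
rewrite e1 em1.
have E8 : (8%:R : R[i])^-1 = (8^-1)%:C by rewrite fmorphV rmorph_nat.
rewrite E8.
case: (f x) => u v; apply/eqP; rewrite eq_complex /=.
by apply/andP; split; apply/eqP; field.
Qed.

Lemma window_cont b : continuous (window b).
Proof.
have sc (c d : R) : continuous (fun x : R => sin (c * x + d)).
  move=> x; apply: (@continuous_comp _ _ _ (fun x => c * x + d) sin); last exact: continuous_sin.
  by apply: cvgD; [apply: cvgMr; exact: cvg_id|exact: cvg_cst].
move=> x; rewrite /window.
have E : (fun x : R => (2 - 2 * (sin (pi * x) * sin (pi * (b - x)))) / 4) =
   (fun x : R => 1 / 2 - 1 / 2 * (sin (pi * x + 0) * sin (- pi * x + pi * b))).
  apply/funext => y; rewrite addr0 (_ : pi * (b - y) = - pi * y + pi * b); last by ring.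
  by field.
rewrite E; apply: cvgB; first exact: cvg_cst.
by apply: cvgMr; apply: cvgM; exact: sc.
Qed.

Lemma bernoulli_le (y : R) n : 0 <= y <= 1 -> 1 - n%:R * y <= (1 - y) ^+ n.
Proof.
move=> /andP[y0 y1]; elim: n => [|n IH]; first by rewrite mul0r subr0 expr0.
rewrite exprS; have := ler_wpM2l (_ : 0 <= 1 - y) IH; rewrite subr_ge0 y1 => /(_ isT).
apply: le_trans; rewrite -natr1.
have : 0 <= n%:R * y * y by nneg.
lra.
Qed.

Lemma bernoulli_ge (y : R) n : 0 <= y -> 1 + n%:R * y <= (1 + y) ^+ n.
Proof.
move=> y0; elim: n => [|n IH]; first by rewrite mul0r addr0 expr0.
rewrite exprS; have := ler_wpM2l (_ : 0 <= 1 + y) IH; rewrite addr_ge0// => /(_ isT).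
apply: le_trans; rewrite -natr1.
have : 0 <= n%:R * y * y by nneg.
lra.
Qed.

(** By Bernoulli's inequality, on [0, 1] these polynomials in t tend to 1 for t
    < 1/2 and to 0 for t > 1/2: composed with [window] they approximate the
    indicator function of an arc. *)
Definition stepfn (t : R) n : R := (1 - t ^+ n) ^+ (2 ^ n).

Lemma stepfn01 t n : 0 <= t <= 1 -> 0 <= stepfn t n <= 1.
Proof.
move=> /andP[t0 t1]; have tn0 : 0 <= t ^+ n by exact: exprn_ge0.
have tn1 : t ^+ n <= 1 by exact: exprn_ile1.
by rewrite /stepfn exprn_ge0 ?subr_ge0//= exprn_ile1 ?subr_ge0// gerBl.
Qed.

Lemma stepfn_cvg1 t : 0 <= t -> t < 2^-1 -> stepfn t @ \oo --> (1 : R).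
Proof.
move=> t0 t1.
have t01 : 0 <= t <= 1 by rewrite t0/=; lra.
apply: (@squeeze_cvgr _ _ _ _ (fun n => 1 - (2 * t) ^+ n) (fun=> 1)).
- apply: nearW => n; have /andP[_ ->] := stepfn01 n t01; rewrite andbT.
  rewrite exprMn -natrX; apply: bernoulli_le; rewrite exprn_ge0//=.
  by apply: exprn_ile1 => //; lra.
- rewrite -[X in _ --> X]subr0; apply: cvgB; first exact: cvg_cst.
  by apply: cvg_expr; rewrite ger0_norm; lra.
- exact: cvg_cst.
Qed.

Lemma stepfn_cvg0 t : 2^-1 < t -> t <= 1 -> stepfn t @ \oo --> (0 : R).
Proof.
move=> t1 t2.
have t0 : 0 <= t by lra.
have t01 : 0 <= t <= 1 by rewrite t0.
apply: (@squeeze_cvgr _ _ _ _ (fun=> 0) (fun n => ((2 * t)^-1) ^+ n)).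
- apply: nearW => n; have /andP[-> _] := stepfn01 n t01; rewrite /=.
  have tn0 : 0 <= t ^+ n by exact: exprn_ge0.
  have tn1 : t ^+ n <= 1 by exact: exprn_ile1.
  have P0 : 0 < (2 * t) ^+ n by apply: exprn_gt0; lra.
  have H : (2 * t) ^+ n <= (1 + t ^+ n) ^+ (2 ^ n).
    have := bernoulli_ge (2 ^ n) tn0; rewrite natrX -exprMn; lra.
  rewrite exprVn -[leRHS]mul1r ler_pdivlMr// /stepfn.
  apply: (le_trans (ler_wpM2l _ H)); first by rewrite exprn_ge0// subr_ge0.
  rewrite -exprMn; apply: exprn_ile1.
    by rewrite mulr_ge0 ?subr_ge0//; lra.
  have : 0 <= t ^+ n * t ^+ n by nneg.
  lra.
- exact: cvg_cst.
- by apply: cvg_expr; rewrite ger0_norm ?invr_ge0 ?invf_lt1; lra.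
Qed.

Lemma window01 b x : 0 <= window b x <= 1.
Proof.
have H : `|sin (pi * x) * sin (pi * (b - x))| <= 1.
  rewrite normrM -[leRHS]mulr1; apply: ler_pM => //; rewrite ler_norml sin_le1 sin_geN1//.
by move: H; rewrite ler_norml /window => /andP[h1 h2]; lra.
Qed.

Lemma window_in b x : 0 < x -> x < b -> b <= 1 -> window b x < 2^-1.
Proof.
move=> x0 xb b1.
have p0 := pi_gt0 R.
have s1 : 0 < sin (pi * x).
  by apply: sin_gt0_pi; rewrite mulr_gt0//= -[ltRHS]mulr1 ltr_pM2l//; lra.
have s2 : 0 < sin (pi * (b - x)).
  by apply: sin_gt0_pi; rewrite mulr_gt0 ?subr_gt0//= -[ltRHS]mulr1 ltr_pM2l//; lra.
by have := mulr_gt0 s1 s2; rewrite /window; lra.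
Qed.

Lemma window_out b x : 0 <= b -> b < x -> x < 1 -> 2^-1 < window b x.
Proof.
move=> b0 bx x1.
have p0 := pi_gt0 R.
have s1 : 0 < sin (pi * x).
  by apply: sin_gt0_pi; rewrite mulr_gt0//=; [rewrite -[ltRHS]mulr1 ltr_pM2l//|]; lra.
have s2 : 0 < sin (pi * (x - b)).
  by apply: sin_gt0_pi; rewrite mulr_gt0 ?subr_gt0//= -[ltRHS]mulr1 ltr_pM2l//; lra.
have := mulr_gt0 s1 s2; rewrite /window.
have -> : pi * (b - x) = - (pi * (x - b)) by ring.
rewrite sinN; lra.
Qed.

(** Dominated convergence, the limit being the indicator function of [0, b]
    outside the three points 0, b and 1. *)
Lemma orth_window (g : R -> R) b : mu.-integrable I01 (EFin \o g) -> 0 <= b -> b <= 1 ->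
  (forall n, \int[mu]_(x in I01) (stepfn (window b x) n * g x) = 0) ->
  \int[mu]_(x in `[0%R, b]) g x = 0.
Proof.
move=> gi b0 b1 H0.
have sc n : continuous (fun x => stepfn (window b x) n).
  move=> x; rewrite /stepfn.
  apply: (@continuous_comp _ _ _ (window b) (fun t => (1 - t ^+ n) ^+ (2 ^ n))).
    exact: window_cont.
  apply: (@continuous_comp _ _ _ (fun t : R => 1 - t ^+ n) (fun t => t ^+ (2 ^ n))).
    by apply: cvgB; [exact: cvg_cst|exact: exprn_continuous].
  exact: exprn_continuous.
have mg := measurable_int mu gi.
pose F n (x : measurableTypeR R) : \bar R := (stepfn (window b x) n * g x)%:E.
pose L (x : measurableTypeR R) : \bar R := ((if x <= b then g x else 0) : R)%:E.
have LE : L = (EFin \o g) \_ `]-oo, b].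
  by apply/funext => x; rewrite /L patchE mem_setE in_itv/=; case: ifP.
have nullset : mu.-negligible [set 0; b; 1].
  apply: negligibleU; first apply: negligibleU.
  - exists [set 0]; split => //; first exact: lebesgue_measure_set1.
  - exists [set b]; split => //; first exact: lebesgue_measure_set1.
  - exists [set 1]; split => //; first exact: lebesgue_measure_set1.
have cvgF : {ae mu, forall x, I01 x -> F ^~ x @ \oo --> L x}.
  apply: negligibleS nullset => x /= Hx.
  apply: contrapT => nx; apply: Hx => /=; rewrite in_itv/= => /andP[x0 x1].
  have x0' : 0 < x by rewrite lt_def x0 andbT; apply/eqP => E; apply: nx; left; left.
  have x1' : x < 1 by rewrite lt_def x1 andbT eq_sym; apply/eqP => E; apply: nx; right.
  have xb : x != b by apply/eqP => E; apply: nx; left; right.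
  rewrite /F /L; apply: cvg_EFin; first by apply: nearW.
  case: (ltgtP x b) xb => // xb _ /=.
    rewrite -[X in _ --> X]mul1r; apply: cvgMl; apply: stepfn_cvg1.
      by have /andP[] := window01 b x.
    exact: window_in.
  rewrite -[X in _ --> X](mul0r (g x)); apply: cvgMl; apply: stepfn_cvg0.
    exact: window_out.
  by have /andP[] := window01 b x.
have domF : {ae mu, forall x n, I01 x -> (`|F n x| <= `|(g x)%:E|)%E}.
  apply: aeW => x n _; rewrite /F /= lee_fin normrM.
  rewrite -[leRHS]mul1r; apply: ler_wpM2r => //.
  by have /andP[s0 s1] := stepfn01 n (window01 b x); rewrite ger0_norm.
have ig : mu.-integrable I01 (fun x => `|(g x)%:E|)%E by exact: (integrable_abse gi).
have [||_ _ D] := @dominated_convergence _ (measurableTypeR R) R mu `[0%R, 1%R]%classic (@mI01 R) F L (fun x => `|(g x)%:E|)%E _ _ cvgF ig domF.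
- by move=> n; exact: measurable_int (integrable01M gi (sc n)).
- apply: (measurable_int mu); rewrite LE; apply/integrable_restrict => //=.
  apply: integrableS gi => //; exact: measurableI.
have Z n : (\int[mu]_(x in I01) F n x = 0)%E.
  have := H0 n; rewrite /Rintegral => E.
  by rewrite -[LHS]fineK ?E//; apply: integrable_fin_num (integrable01M gi (sc n)); exact: (@mI01 R).
have L0 : (\int[mu]_(x in I01) L x = 0)%E.
  apply: (@cvg_unique _ (@ereal_hausdorff R) _ _ _ _ D).
  by apply: cvg_near_cst; apply: nearW => n; exact: Z.
rewrite /Rintegral (_ : (\int[mu]_(x in `[0%R, b]) (g x)%:E = 0)%E)//.
rewrite -[RHS]L0 LE -integral_mkcondr; congr integral.
apply/seteqP; split => x /=; rewrite !in_itv/=.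
  by move=> /andP[x0 xb]; rewrite x0 xb (le_trans xb).
by move=> [/andP[-> _] ->].
Qed.

Lemma annihil_primitive f b : annihil f -> 0 <= b -> b <= 1 ->
  \int[mu]_(x in `[0%R, b]) Re (f x) = 0 /\ \int[mu]_(x in `[0%R, b]) Im (f x) = 0.
Proof.
move=> af b0 b1; have [[f1 f2] _] := af.
have H n : cint (fun x => (stepfn (window b x) n)%:C * f x) = 0.
  have := multiplierX (2 ^ n) (multiplierB1 (multiplierX n (@window_multiplier b))) af.
  case=> _ /(_ 0) <-; congr cint; apply/funext => x.
  by rewrite ek0 mulr1.
split; apply: orth_window => // n; have := H n; rewrite /cint => -[HR HI].
  rewrite -[RHS]HR; apply: eq_Rintegral => x _.
  by rewrite cReM /= mul0r subr0.
rewrite -[RHS]HI; apply: eq_Rintegral => x _.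
by rewrite cImM /= mul0r addr0.
Qed.

Lemma zero_primitive_at (g : R -> R) x : 0 < x < 1 ->
  (forall b, 0 <= b -> b <= 1 -> \int[mu]_(y in `[0%R, b]) g y = 0) ->
  ((fun y => \int[mu]_(z in `[0%R, y]) g z : R)^`())%classic x = 0.
Proof.
move=> /andP[x0 x1] H; rewrite derive1E (@near_eq_derive _ _ _ _ (cst 0)).
  exact: derive_cst.
near=> y; apply: H.
  by apply/ltW; near: y; exact: lt_nbhsr.
by apply/ltW; near: y; exact: lt_nbhsl.
Unshelve. all: by end_near. Qed.

Lemma zero_primitive_cont (g : R -> R) : continuous g ->
  (forall b, 0 <= b -> b <= 1 -> \int[mu]_(y in `[0%R, b]) g y = 0) ->
  forall x, 0 <= x <= 1 -> g x = 0.
Proof.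
move=> gc H.
have inner x : 0 < x < 1 -> g x = 0.
  move=> x01; have /andP[x0 x1] := x01.
  have [_ <-] := continuous_FTC1_closed x1 (integrable01_cont gc) x0 (gc x).
  exact: zero_primitive_at.
have lim0 (F : set_system R) (x : R) : ProperFilter F -> F --> x ->
    (\forall y \near F, 0 < y < 1) -> g x = 0.
  move=> FF Fx Fin; apply: (@cvg_unique _ (@Rhausdorff R) (g @ F)).
    exact: cvg_comp Fx (gc x).
  by apply: cvg_near_cst; apply: filterS Fin => y; exact: inner.
move=> x /andP[]; rewrite le_eqVlt => /orP[/eqP <- _|x0].
  apply: (lim0 (0^'+)); first by apply: cvg_at_right_filter; exact: cvg_id.
  near=> y; apply/andP; split; near: y; first exact: nbhs_right_gt.
  by apply: nbhs_right_lt.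
rewrite le_eqVlt => /orP[/eqP ->|x1]; last by apply: inner; rewrite x0.
apply: (lim0 (1^'-)); first by apply: cvg_at_left_filter; exact: cvg_id.
near=> y; apply/andP; split; near: y; last exact: nbhs_left_lt.
by apply: nbhs_left_gt.
Unshelve. all: by end_near. Qed.

(** The derivative of the primitive is the function itself at almost every
    point, by Lebesgue's differentiation theorem. *)
Lemma zero_primitive_ae (g : R -> R) : mu.-integrable I01 (EFin \o g) ->
  (forall b, 0 <= b -> b <= 1 -> \int[mu]_(y in `[0%R, b]) g y = 0) ->
  {ae mu, forall x, 0 < x < 1 -> g x = 0}.
Proof.
move=> gi H.
pose g1 := g \_ I01.
have g1i : mu.-integrable setT (EFin \o g1).
  rewrite /g1 -restrict_EFin; apply/integrable_restrict => //=.
  by rewrite setTI.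
have lg : locally_integrable [set: R] g1.
  by apply: integrable_locally_restrict => //; exact: (@mI01 R).
have gy (y : R) : mu.-integrable [set` Interval (BLeft 0) (BRight y)] (EFin \o g1).
  by apply: integrableS g1i => //.
have := FTC1 gy lg.
apply: filterS; first exact: (ae_filter_ringOfSetsType mu).
move=> x Hx x01; have /andP[x0 x1] := x01.
have [_] := Hx x0.
have -> : g1 x = g x by rewrite /g1 patchE mem_set//= in_itv/= !ltW.
move=> <-; apply: zero_primitive_at => // b b0 b1.
apply: (etrans _ (H b b0 b1)); apply: eq_Rintegral => y; rewrite inE/= in_itv/= => /andP[y0 yb].
by rewrite /g1 patchE mem_set//= in_itv/= y0 (le_trans yb).
Qed.

Lemma periodicZ (T : Type) (f : R -> T) : periodic1 f -> forall (n : int) x, f (x + n%:~R) = f x.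
Proof.
move=> pf n.
have H (m : nat) x : f (x + m%:R) = f x.
  elim: m => [|m IH]; first by rewrite addr0.
  by rewrite -natr1 addrA pf.
case: n => m x; first exact: H.
by rewrite NegzE -(H m.+1 (x + _)) mulrNz subrK.
Qed.

Lemma floor_rem (x : R) : 0 <= x - (Num.floor x)%:~R < 1.
Proof.
have /andP[h1 h2] := Num.Theory.floor_itv x.
by rewrite subr_ge0 h1 /= ltrBlDl -(intrD _ _ 1).
Qed.

Lemma periodic_ext (T : Type) (f g : R -> T) : periodic1 f -> periodic1 g ->
  (forall x, 0 <= x <= 1 -> f x = g x) -> f = g.
Proof.
move=> pf pg H; apply/funext => x.
have /andP[h1 h2] := floor_rem x.
rewrite -(subrK (Num.floor x)%:~R x) !periodicZ//; apply: H.
by rewrite h1 ltW.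
Qed.

Lemma fhatB f g k : cintegrable f -> cintegrable g ->
  fhat (fun x => f x - g x) k = fhat f k - fhat g k.
Proof.
move=> fi gi; rewrite !fhatE -cintB.
- by congr cint; apply/funext => x; rewrite mulrBl.
- by apply: cintegrableM => //; exact: ek_ccont.
- by apply: cintegrableM => //; exact: ek_ccont.
Qed.

Lemma fhatZ c f k : cintegrable f -> fhat (fun x => c * f x) k = c * fhat f k.
Proof.
move=> fi; rewrite !fhatE -cintZ.
- by congr cint; apply/funext => x; rewrite mulrA.
- by apply: cintegrableM => //; exact: ek_ccont.
Qed.

Lemma fhat_annihil f : cintegrable f -> (forall k, fhat f k = 0) -> annihil f.
Proof.
move=> fi f0; split => // k; rewrite -(f0 (- k)) fhatE.
by rewrite opprK.
Qed.

Lemma fhat_inj_cont f g : periodic1 f -> periodic1 g -> ccont f -> ccont g ->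
  (forall k, fhat f k = fhat g k) -> f = g.
Proof.
move=> pf pg fc gc H.
have fi := ccont_cintegrable fc; have gi := ccont_cintegrable gc.
have hc : ccont (fun x => f x - g x).
  have := ccontD fc (ccontZ (-1) gc); congr ccont.
  by apply/funext => x; rewrite mulN1r.
have ha : annihil (fun x => f x - g x).
  apply: fhat_annihil; first exact: ccont_cintegrable.
  by move=> k; rewrite fhatB// H subrr.
apply: periodic_ext => // x x01; apply/eqP; rewrite -subr_eq0; apply/eqP.
have R0 := zero_primitive_cont hc.1 (fun b b0 b1 => (annihil_primitive ha b0 b1).1) x01.
have I0 := zero_primitive_cont hc.2 (fun b b0 b1 => (annihil_primitive ha b0 b1).2) x01.
by apply/eqP; rewrite eq_complex R0 I0 /= !eqxx.
Qed.

(** Two measures which agree on intervals are equal. *)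
Lemma lebesgue_shift (c : R) (A : set R) : measurable (A : set (measurableTypeR R)) ->
  pushforward mu ((fun x => x + c) : _ -> measurableTypeR R) A = mu A.
Proof.
have mf : measurable_fun [set: measurableTypeR R] ((fun x => x + c) : _ -> measurableTypeR R).
  apply: measurable_realfun.continuous_measurable_fun => x.
  by apply: cvgD; [exact: cvg_id|exact: cvg_cst].
move=> mA; apply/esym/lebesgue_measure_unique => //= _ [[a b]] _ <-.
rewrite /pushforward (_ : _ @^-1` _ = `]a - c, b - c]%classic).
  rewrite !lebesgue_measure_itv/= !lte_fin ltrD2r.
  by case: ifP => // _; rewrite -!EFinD; congr EFin; ring.
by apply/seteqP; split => x /=; rewrite !in_itv/= ltrBlDr lerBrDr.
Qed.

Lemma negligible_shift (c : R) (A : set R) : mu.-negligible A ->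
  mu.-negligible ((fun x => x + c) @^-1` A).
Proof.
move=> [B [mB B0 AB]]; exists ((fun x => x + c) @^-1` B); split.
- have mf : measurable_fun [set: measurableTypeR R] ((fun x => x + c) : _ -> measurableTypeR R).
    apply: measurable_realfun.continuous_measurable_fun => x.
    by apply: cvgD; [exact: cvg_id|exact: cvg_cst].
  by rewrite -[X in measurable X]setTI; exact: mf.
- by rewrite -[RHS]B0 -(lebesgue_shift c mB).
- by move=> x; exact: AB.
Qed.

(** The translates of ]0, 1[ by integers cover the line up to a countable set.
    *)
Lemma periodic_ae (f : R -> R) : periodic1 f -> {ae mu, forall x, 0 < x < 1 -> f x = 0} ->
  {ae mu, forall x, f x = 0}.
Proof.
move=> pf H.
have N1 : mu.-negligible ([set x | ~ (0 < x < 1 -> f x = 0)] `|` [set 0]).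
  apply: negligibleU => //.
  by exists [set 0]; split => //; exact: lebesgue_measure_set1.
have [e] : {e : nat -> int | forall k, exists n, e n = k}.
  exists (fun n => odflt 0 (unpickle n)) => k; exists (pickle k).
  by rewrite pickleK.
move=> He.
apply: negligibleS (negligible_bigcup (fun n => negligible_shift (e n)%:~R N1)).
move=> x /= fx.
have [n En] := He (- Num.floor x).
exists n => //=; rewrite En mulrNz.
have /andP[h1 h2] := floor_rem x.
have [E|E] := eqVneq (x - (Num.floor x)%:~R) 0; first by right.
left; move=> K; apply: fx; rewrite -(subrK (Num.floor x)%:~R x) periodicZ//.
by apply: K; rewrite h2 andbT lt_def E.
Qed.

Lemma fhat_inj_ae f g : periodic1 f -> periodic1 g -> cintegrable f -> ccont g ->
  (forall k, fhat f k = fhat g k) -> {ae mu, forall x, Re (f x) = Re (g x)}.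
Proof.
move=> pf pg fi gc H.
have gi := ccont_cintegrable gc.
have hi : cintegrable (fun x => f x - g x).
  have := cintegrableD fi (cintegrableZ (-1) gi); congr cintegrable.
  by apply/funext => x; rewrite mulN1r.
have ha : annihil (fun x => f x - g x).
  by apply: fhat_annihil => // k; rewrite fhatB// H subrr.
have ph : periodic1 (fun x => Re (f x - g x)) by move=> x; rewrite pf pg.
have := periodic_ae ph (zero_primitive_ae hi.1 (fun b b0 b1 => (annihil_primitive ha b0 b1).1)).
apply: filterS; first exact: (ae_filter_ringOfSetsType mu).
move=> x; rewrite cReD cReN => E.
by apply/eqP; rewrite -subr_eq0; apply/eqP.
Qed.

End FourierUniqueness.

(** * Gevrey norms and weighted sums *)

Lemma powRD_gt0 (R : realType) (x r s : R) : 0 < x -> x `^ (r + s) = x `^ r * x `^ s.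
Proof. by move=> x0; rewrite powRD// (gt_eqF x0) implybT. Qed.

Section RiemannSum.
Variable R : realType.
Variables (p : R).
Hypothesis p1 : 1 < p.

(** With q = p - 1, the mean value estimate (1 + 1/n)^q >= 1 + q ln (1 + 1/n)
    >= 1 + q/(n+1) bounds the general term by a telescoping difference. *)
Lemma powR_tele (n : nat) :
  (n.+2%:R `^ p)^-1 <= (p - 1)^-1 * (n.+1%:R `^ (1 - p) - n.+2%:R `^ (1 - p)) :> R.
Proof.
have q0 : 0 < p - 1 by rewrite subr_gt0.
have a0 : 0 < n.+1%:R :> R by [].
have b0 : 0 < n.+2%:R :> R by [].
rewrite ler_pdivlMl// lerBrDr.
have Eb : (n.+2%:R `^ p)^-1 = n.+2%:R `^ (1 - p) * n.+2%:R^-1 :> R.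
  rewrite -powRN -powR_inv1//.
  rewrite -powRD_gt0//.
  by congr (_ `^ _); ring.
have Ea : n.+1%:R `^ (1 - p) = n.+2%:R `^ (1 - p) * (n.+1%:R / n.+2%:R) `^ (1 - p) :> R.
  by rewrite -powRM ?divr_ge0// mulrCA divff ?mulr1// gt_eqF.
rewrite Eb Ea [leLHS](_ : _ = n.+2%:R `^ (1 - p) * (1 + (p - 1) / n.+2%:R)); last by ring.
rewrite ler_wpM2l ?powR_ge0//.
rewrite /powR gt_eqF ?divr_gt0// (le_trans _ (expR_ge1Dx _))// lerD2l.
rewrite -[1 - p]opprB mulNr -mulrN ler_wpM2l ?(ltW q0)// lerNr.
have -> : n.+1%:R / n.+2%:R = 1 + - n.+2%:R^-1 :> R.
  rewrite -[X in _ = X + _](divff (lt0r_neq0 b0)) -[X in _ = _ - X]mul1r -mulrBl.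
  by rewrite -(natr1 n.+1); congr (_ / _); ring.
by apply: le_ln1Dx; rewrite ltrN2 invf_lt1 ?ltr1n.
Qed.

Lemma sum_powR n : \sum_(0 <= i < n.+1) (i.+1%:R `^ p)^-1 <= 1 + (p - 1)^-1 :> R.
Proof.
have q0 : 0 < (p - 1)^-1 by rewrite invr_gt0 subr_gt0.
suff H : \sum_(0 <= i < n.+1) (i.+1%:R `^ p)^-1 <= 1 + (p - 1)^-1 * (1 - n.+1%:R `^ (1 - p)).
  by rewrite (le_trans H)// lerD2l ger_pMr// gerBl powR_ge0.
elim: n => [|n IH]; first by rewrite big_nat1 !powR1 invr1 subrr mulr0 addr0.
rewrite big_nat_recr//= (le_trans (lerD IH (powR_tele n)))//.
by apply: eq_le_imp; ring.
Qed.

Lemma esum_powR : (esumR (fun n : nat => (n.+1%:R `^ p)^-1)%R <= (1 + (p - 1)^-1 : R)%:E)%E.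
Proof.
have q0 : 0 < (p - 1)^-1 by rewrite invr_gt0 subr_gt0.
have p0 n : (0 <= ((n.+1%:R `^ p)^-1 : R)%:E)%E by rewrite lee_fin invr_ge0 powR_ge0.
rewrite /esumR -nneseries_esumT//.
apply: lime_le; first by apply: is_cvg_nneseries.
apply: nearW => -[|n]; first by rewrite big_geq// lee_fin addr_ge0// ltW.
by rewrite sumEFin lee_fin sum_powR.
Qed.

End RiemannSum.

Section Gevrey.
Variable R : realType.
Implicit Types (a b : int -> R[i]).
Local Notation ab k := (`|(k : int)%:~R : R|).

Lemma jap_ge1 k : 1 <= jap R k.
Proof. by rewrite -[leLHS]sqrtr1 ler_wsqrtr// lerDl sqr_ge0. Qed.

Lemma jap_gt0 k : 0 < jap R k. Proof. exact: lt_le_trans (jap_ge1 k). Qed.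

Lemma jap_ab k : ab k <= jap R k.
Proof. by rewrite -sqrtr_sqr ler_wsqrtr// lerDr. Qed.

Lemma jap_le_om k : jap R k <= om R k.
Proof.
have o0 := ltW (om_gt0 R k).
rewrite -(ger0_norm o0) -sqrtr_sqr ler_wsqrtr// /om -[in leLHS]real_normK ?num_real//.
have := ab_ge0 R k; set x := ab k => x0.
rewrite -subr_ge0 (_ : _ - _ = x *+ 2); last by ring.
by rewrite mulrn_wge0.
Qed.

Lemma om_le_jap k : om R k <= 2 * jap R k.
Proof. by rewrite /om mulr2n mulrDl mul1r lerD ?jap_ge1 ?jap_ab. Qed.

Lemma esumR_int (f : int -> R) : (forall k, 0 <= f k) ->
  esumR f = (esumR (fun n => f (Posz n)) + esumR (fun n => f (Negz n)))%E.
Proof.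
move=> f0.
pose g k := if k is Posz _ then f k else 0.
pose h k := if k is Negz _ then f k else 0.
have -> : f = (fun k => g k + h k) by apply/funext => -[n|n]; rewrite /g/h ?addr0 ?add0r.
rewrite [LHS]esumRD; last first.
- by case=> n //; exact: f0.
- by case=> n //; exact: f0.
congr (_ + _)%E.
  rewrite (@esumR_inj _ _ _ Posz g); first by apply: eq_esum => n _; rewrite /= addr0.
    by move=> m n [].
  by case=> n /=; [exists n|rewrite eqxx].
rewrite (@esumR_inj _ _ _ Negz h); first by apply: eq_esum => n _; rewrite /= add0r.
  by move=> m n [].
by case=> n /=; [rewrite eqxx|exists n].
Qed.

Lemma sum_jap (s : R) : 2^-1 < s ->
  exists2 Z : R, 0 <= Z & (esumR (fun k => (jap R k `^ (2 * s))^-1)%R <= Z%:E)%E.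
Proof.
move=> s2; have p1 : 1 < 2 * s by lra.
have p0 : 0 <= 2 * s by lra.
have q0 : 0 < (2 * s - 1)^-1 by rewrite invr_gt0 subr_gt0.
exists (1 + (1 + (2 * s - 1)^-1) + (1 + (2 * s - 1)^-1)); first by lra.
rewrite esumR_int; last by move=> k; rewrite invr_ge0 powR_ge0.
have le (k : int) (n : nat) : n.+1%:R <= jap R k ->
    (jap R k `^ (2 * s))^-1 <= (n.+1%:R `^ (2 * s))^-1.
  move=> H; rewrite lef_pV2 ?posrE ?powR_gt0 ?jap_gt0//.
  by apply: ge0_ler_powR => //; rewrite nnegrE// ltW// jap_gt0.
rewrite !EFinD; apply: leeD; last first.
  rewrite -EFinD; apply: le_trans (esum_powR p1); apply: le_esumR => n; apply: le.
  by rewrite (le_trans _ (jap_ab _))// NegzE mulrNz normrN ger0_norm.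
rewrite -EFinD.
pose g (n : nat) : R := if n is m.+1 then (m.+1%:R `^ (2 * s))^-1 else 0.
apply: (@le_trans _ _ (esumR (fun n => (if n == 0%N then 1 else 0) + g n))).
  apply: le_esumR => -[|n].
    rewrite /= addr0 invf_le1 ?powR_gt0 ?jap_gt0//.
    by rewrite -[leLHS](powRr0 (jap R 0)) ler_powR ?jap_ge1.
  by rewrite /= add0r; apply: le; rewrite (le_trans _ (jap_ab _))// ger0_norm.
rewrite esumRD; last first.
- by case=> // n; rewrite /g invr_ge0 powR_ge0.
- by case.
apply: leeD.
  apply: ge_esumR => [|t ut]; first by case.
  rewrite lee_fin -big_mkcond/= big_const_seq iter_addr_0 (eq_count (a2 := pred1 0%N))//.
    by have := count_uniq_mem 0%N ut => ->; case: (_ \in _).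
rewrite (@esumR_inj _ _ _ succn g); first exact: esum_powR.
  by move=> m n [].
by case=> /= [|n _]; [rewrite eqxx|exists n].
Qed.

(** The square root of the weight in the Gevrey norm. *)
Definition gw (d s : R) k : R := jap R k `^ s * expR (2 * pi * d * ab k).

(** The Gevrey norm as a function of the coefficients alone. *)
Definition Gn (d s : R) a : \bar R := sqrte (esumR (fun k => (gw d s k * cabs (a k)) ^+ 2)).

Lemma gw_ge0 d s k : 0 <= gw d s k.
Proof. by apply: mulr_ge0; [exact: powR_ge0|exact: expR_ge0]. Qed.

Lemma gwa_ge0 d s a k : 0 <= gw d s k * cabs (a k).
Proof. by apply: mulr_ge0; [exact: gw_ge0|exact: cabs_ge0]. Qed.

Lemma Gn_real_ge0 d s a : 0 <= fine (Gn d s a).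
Proof. by apply: fine_ge0; exact: sqrte_ge0. Qed.

Lemma GnormE d s (f : R -> R[i]) : Gnorm d s f = Gn d s (fhat f).
Proof.
congr sqrte; apply: eq_esum => k _; congr EFin.
rewrite exprMn /gw exprMn -expRM_natl; congr (_ * expR _ * _).
  by rewrite -powR_mulrn ?powR_ge0// -powRrM mulrC.
by rewrite !mulrA -natrM.
Qed.

Lemma Gn_ge0 d s a : (0 <= Gn d s a)%E. Proof. exact: sqrte_ge0. Qed.

Lemma Gn_le d s a (g : R) : 0 <= g ->
  (esumR (fun k => (gw d s k * cabs (a k)) ^+ 2)%R <= (g ^+ 2)%:E)%E -> (Gn d s a <= g%:E)%E.
Proof.
move=> g0 H; rewrite -[g in leRHS]ger0_norm// -[_%:E]/(`|g%:E|%E) -sqrte_sqr lee_sqrt//.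
by rewrite sqre_ge0.
Qed.

Lemma Gn_fin d s a : (Gn d s a < +oo)%E -> Gn d s a = (fine (Gn d s a))%:E.
Proof. by move=> H; rewrite fineK// ge0_fin_numE// Gn_ge0. Qed.

Lemma Gn_sqr d s a : (Gn d s a < +oo)%E ->
  (esumR (fun k => (gw d s k * cabs (a k)) ^+ 2)%R = (fine (Gn d s a) ^+ 2)%:E)%E.
Proof.
move=> H; rewrite EFin_expe -Gn_fin// sqr_sqrte//.
by apply: esumR_ge0 => k; exact: sqr_ge0.
Qed.

Lemma Gn_term d s a k : ((gw d s k * cabs (a k))%:E <= Gn d s a)%E.
Proof.
have [H|] := ltP (Gn d s a) +oo%E; last by rewrite leye_eq => /eqP ->; rewrite leey.
have := esumR_term (fun k => (gw d s k * cabs (a k)) ^+ 2) k.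
rewrite Gn_sqr// lee_fin (Gn_fin H) lee_fin => h.
by rewrite -(@ler_pXn2r _ 2)// nnegrE ?gwa_ge0 ?Gn_real_ge0.
Qed.

(** Cauchy-Schwarz against the sequence of the 1/<k>^s, square summable since s
    > 1/2, the remaining power <k> controlling the factor 1 + |k|. It is used
    in the form x y <= x^2/(2g) + g y^2/2, with g the norm itself. *)
Lemma Nw_Gn (s : R) : 2^-1 < s -> exists2 C : R, 0 < C &
  forall d a, (Nw d a <= C%:E * Gn d (s + 1) a)%E.
Proof.
move=> s2; have [Z Z0 HZ] := sum_jap s2.
exists (2^-1 + 2 * Z); first by lra.
move=> d a; have [H|] := ltP (Gn d (s + 1) a) +oo%E; last first.
  rewrite leye_eq => /eqP ->; rewrite gt0_muley ?leey// lte_fin; lra.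
have g0 : 0 <= fine (Gn d (s + 1) a) by apply: fine_ge0; exact: Gn_ge0.
move: (Gn_sqr H) (Gn_fin H); move: g0; set g := fine _ => g0 Sg Eg.
have [gp|gz] := ltP 0 g; last first.
  have g00 : g = 0 by apply/eqP; rewrite eq_le gz g0.
  have a0 k : cabs (a k) = 0.
    have := Gn_term d (s + 1) a k; rewrite Eg g00 lee_fin => h.
    have gw0 : 0 < gw d (s + 1) k by rewrite mulr_gt0 ?powR_gt0 ?expR_gt0 ?jap_gt0.
    apply/eqP; rewrite eq_le cabs_ge0 andbT.
    by rewrite -(pmulr_rle0 _ gw0).
  rewrite Eg g00 mule0; apply: ge_esumR; first by move=> k; exact: wt_term_ge0.
  by move=> t _; rewrite big1// => k _; rewrite a0 mulr0.
rewrite Eg -EFinM.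
have Hk k : wt d k * cabs (a k) <= (2 * g)^-1 * (gw d (s + 1) k * cabs (a k)) ^+ 2 +
     2 * g * (jap R k `^ (2 * s))^-1.
  have J0 := jap_gt0 k.
  have P0 : 0 < jap R k `^ s by rewrite powR_gt0.
  have E1 : gw d (s + 1) k = jap R k `^ s * (jap R k * expR (2 * pi * d * ab k)).
    by rewrite /gw powRD_gt0// powRr1 ?(ltW J0)// mulrA.
  have E2 : (jap R k `^ (2 * s)) = (jap R k `^ s) ^+ 2.
    by rewrite -powR_mulrn ?powR_ge0// -powRrM mulrC.
  rewrite E1 E2.
  apply: (@le_trans _ _ (2 * (jap R k * expR (2 * pi * d * ab k) * cabs (a k)))).
    rewrite /wt !mulrA; do 2 (apply: ler_wpM2r; first by rewrite ?expR_ge0 ?cabs_ge0).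
    exact: om_le_jap.
  move: P0; set P := jap R k `^ s => P0.
  set y := jap R k * expR _ * _.
  rewrite -mulrA -/y; move: y => y.
  have P1 : P * y * P^-1 = y by rewrite mulrC mulKf// gt_eqF.
  rewrite -{1}P1; move: (P * y) => z.
  have -> : (P ^+ 2)^-1 = P^-1 ^+ 2 by rewrite exprVn.
  move: P^-1 => q.
  rewrite -subr_ge0 (_ : _ - _ = (z - 2 * g * q) ^+ 2 / (2 * g)).
    by rewrite divr_ge0// ?sqr_ge0// mulr_ge0// ltW.
  by field; rewrite gt_eqF.
apply: le_trans (le_esumR Hk) _.
have gg : 0 <= (2 * g)^-1 by rewrite invr_ge0 mulr_ge0// ltW.
have gg' : 0 <= 2 * g by rewrite mulr_ge0// ltW.
have sq k := sqr_ge0 (gw d (s + 1) k * cabs (a k)).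
have pj k : 0 <= (jap R k `^ (2 * s))^-1 by rewrite invr_ge0 powR_ge0.
rewrite esumRD; last first.
- by move=> k; rewrite mulr_ge0.
- by move=> k; rewrite mulr_ge0.
rewrite !esumRZ// Sg -EFinM.
apply: (@le_trans _ _ (((2 * g)^-1 * g ^+ 2)%:E + (2 * g)%:E * Z%:E)%E).
  by apply: leeD => //; apply: lee_wpmul2l.
rewrite -EFinM -EFinD lee_fin; apply: eq_le_imp.
by field; rewrite gt_eqF.
Qed.

(** Powers of <k> are absorbed by a loss of radius, since <k>^s is at most a
    constant times exp(2 pi (d' - d) |k|). *)
Lemma gw_wt (s d d' : R) : 0 <= s -> 0 <= d -> d < d' -> exists2 C : R, 0 < C &
  forall k, gw d s k <= C * wt d' k.
Proof.
move=> s0 d0 dd; pose r := (d' - d) / (s + 1).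
have s1 : 0 < s + 1 by lra.
have r0 : 0 < r by rewrite divr_gt0// subr_gt0.
pose q := (r + 1) / r.
have q0 : 0 < q by rewrite divr_gt0//; lra.
exists (q `^ s); first by rewrite powR_gt0.
move=> k; have e0 : 0 <= expR (2 * pi * r * ab k) by exact: expR_ge0.
have H : jap R k <= q * expR (2 * pi * r * ab k).
  by rewrite (le_trans (jap_le_om k))// om_le_exp.
have J0 := ltW (jap_gt0 k).
apply: (@le_trans _ _ ((q * expR (2 * pi * r * ab k)) `^ s * expR (2 * pi * d * ab k))).
  rewrite ler_wpM2r ?expR_ge0//; apply: ge0_ler_powR => //; rewrite nnegrE//.
  by rewrite mulr_ge0// ltW.
rewrite powRM ?(ltW q0)// -mulrA ler_wpM2l ?powR_ge0// -expRM -expRD.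
apply: (@le_trans _ _ (expR (2 * pi * d' * ab k))); last first.
  by rewrite /wt ler_peMl ?expR_ge0 ?om_ge1.
rewrite ler_expR.
have -> : 2 * pi * r * ab k * s + 2 * pi * d * ab k = 2 * pi * (r * s + d) * ab k by ring.
rewrite ler_wpM2r// ler_wpM2l ?twopi_ge0// -lerBrDr /r mulrAC ler_pdivrMr//.
by rewrite ler_wpM2l ?subr_ge0 ?(ltW dd)// lerDl.
Qed.

(** A sum of squares of nonnegative numbers is at most the square of their sum.
    *)
Lemma Gn_Nw (s d d' : R) : 0 <= s -> 0 <= d -> d < d' -> exists2 C : R, 0 < C &
  forall a, (Gn d s a <= C%:E * Nw d' a)%E.
Proof.
move=> s0 d0 dd; have [C C0 HC] := gw_wt s0 d0 dd; exists C => // a.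
have [H|] := ltP (Nw d' a) +oo%E; last first.
  by rewrite leye_eq => /eqP ->; rewrite gt0_muley ?leey.
rewrite (Nw_fin H) -EFinM.
have N0 : 0 <= fine (Nw d' a) by apply: fine_ge0; exact: Nw_ge0.
have E : esumR (fun k => wt d' k * cabs (a k)) = (fine (Nw d' a))%:E by exact: (Nw_fin H).
have W0 k := wt_term_ge0 d' a k.
apply: Gn_le; first by rewrite mulr_ge0// ltW.
apply: (@le_trans _ _ (esumR (fun k => C ^+ 2 * fine (Nw d' a) * (wt d' k * cabs (a k))))).
  apply: le_esumR => k.
  apply: (@le_trans _ _ ((C * (wt d' k * cabs (a k))) ^+ 2)).
    rewrite lerXn2r// ?nnegrE ?gwa_ge0//; last by rewrite mulrA ler_wpM2r ?cabs_ge0.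
    by rewrite mulr_ge0// ltW.
  have := Nw_term d' a k; rewrite (Nw_fin H) lee_fin => h.
  by rewrite exprMn -mulrA ler_wpM2l ?sqr_ge0// expr2 ler_wpM2r.
rewrite esumRZ//; last by rewrite mulr_ge0 ?sqr_ge0.
by rewrite E -EFinM exprMn expr2 mulrA.
Qed.

(** Part of the gain th - d pays for the factor <k>^3 that makes the sum over k
    converge like that of <k>^-2. *)
Lemma decay_Nw (d th : R) : 0 <= d -> d < th -> exists2 C : R, 0 < C &
  forall a (B : R), 0 <= B ->
    (forall k, expR (2 * pi * th * ab k) * cabs (a k) <= B) -> (Nw d a <= (C * B)%:E)%E.
Proof.
move=> d0 dth.
have m1 : d < (d + th) / 2 by lra.
have m2 : 0 < (th - d) / 2 by lra.
have [C C0 HC] := @gw_wt 3 d ((d + th) / 2) ltac:(lra) d0 m1.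
have [Z Z0 HZ] := @sum_jap 1 ltac:(lra).
pose q := ((th - d) / 2 + 1) / ((th - d) / 2).
have q0 : 0 < q by rewrite divr_gt0//; lra.
have Z1 : 0 < Z + 1 by rewrite ltr_wpDl.
exists (2 * (C * q) * (Z + 1)); first by apply: mulr_gt0 => //; apply: mulr_gt0 => //; exact: mulr_gt0.
move=> a B B0 H.
have K k : wt d k * cabs (a k) <= 2 * (C * q) * B * (jap R k `^ (2 * 1))^-1.
  have J0 := jap_gt0 k.
  have P0 : 0 < jap R k `^ (2 * 1) by rewrite powR_gt0.
  rewrite ler_pdivlMr//.
  have E3 : gw d 3 k = jap R k `^ (2 * 1) * (jap R k * expR (2 * pi * d * ab k)).
    rewrite /gw (_ : 3 = 2 * 1 + 1 :> R); last by ring.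
    by rewrite powRD_gt0// powRr1 ?(ltW J0)// mulrA.
  apply: (@le_trans _ _ (2 * gw d 3 k * cabs (a k))).
    rewrite E3 mulrAC ler_wpM2r ?cabs_ge0// mulrC [leRHS]mulrCA.
    rewrite ler_wpM2l ?(ltW P0)// /wt mulrA ler_wpM2r ?expR_ge0//; exact: om_le_jap.
  rewrite -[leLHS]mulrA -[2 * _ * B]mulrA ler_wpM2l//.
  apply: (@le_trans _ _ (C * wt ((d + th) / 2) k * cabs (a k))).
    by rewrite ler_wpM2r ?cabs_ge0.
  rewrite -[leLHS]mulrA -[leRHS]mulrA ler_wpM2l ?(ltW C0)//.
  apply: (@le_trans _ _ (q * (expR (2 * pi * th * ab k) * cabs (a k)))); last first.
    by rewrite ler_wpM2l ?(ltW q0).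
  rewrite mulrA ler_wpM2r ?cabs_ge0// /wt.
  apply: (@le_trans _ _ (q * expR (2 * pi * ((th - d) / 2) * ab k) * expR (2 * pi * ((d + th) / 2) * ab k))).
    by rewrite ler_wpM2r ?expR_ge0// om_le_exp.
  rewrite -mulrA ler_wpM2l ?(ltW q0)// -expRD ler_expR; apply: eq_le_imp.
  by move: (pi : R) (ab k) => p x; field.
apply: le_trans (le_esumR K) _.
have c0 : 0 <= 2 * (C * q) * B.
  by apply: mulr_ge0 => //; apply: mulr_ge0 => //; apply: mulr_ge0; exact: ltW.
rewrite esumRZ//; last by move=> k; rewrite invr_ge0 powR_ge0.
apply: (@le_trans _ _ ((2 * (C * q) * B)%:E * Z%:E)%E); first exact: lee_wpmul2l.
by rewrite -EFinM lee_fin [leRHS]mulrAC ler_wpM2l// lerDl.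
Qed.

Lemma Nw_Gn_loss (s d d' : R) : 0 <= s -> 0 <= d -> d < d' -> exists2 C : R, 0 < C &
  forall a, (Nw d a <= C%:E * Gn d' s a)%E.
Proof.
move=> s0 d0 dd; have [C C0 HC] := decay_Nw d0 dd; exists C => // a.
have [H|] := ltP (Gn d' s a) +oo%E; last first.
  by rewrite leye_eq => /eqP ->; rewrite gt0_muley ?leey.
rewrite (Gn_fin H) -EFinM; apply: HC => [|k]; first exact: Gn_real_ge0.
have := Gn_term d' s a k; rewrite (Gn_fin H) lee_fin; apply: le_trans.
rewrite ler_wpM2r ?cabs_ge0// /gw ler_peMl ?expR_ge0//.
by rewrite -[leLHS](powRr0 (jap R k)) ler_powR ?jap_ge1.
Qed.

End Gevrey.

(** * Complex limits and Gevrey spaces *)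

Section ComplexFilters.
Variable R : realType.
Implicit Types (z h : R[i]).

Lemma ltcC (x y : R) : (x%:C < y%:C :> R[i]) = (x < y).
Proof. by rewrite ltcR. Qed.

Lemma lt0C (e : R[i]) : 0 < e -> exists2 r : R, 0 < r & e = r%:C.
Proof.
case: e => a b; rewrite ltcE/= => /andP[/eqP -> a0].
by exists a.
Qed.

Lemma dnbhs0CP (P : R[i] -> Prop) :
  (\forall h \near (0 : R[i]^o)^', P h) <->
  exists2 eta : R, 0 < eta & forall h, h != 0 -> cabs h < eta -> P h.
Proof.
split.
- case/nbhs_ballP => e /lt0C[r r0 ->] H; exists r => // h h0 hr; apply: H => //.
  by rewrite -ball_normE /= sub0r normrN normr_cabs ltcC.
- case=> r r0 H; apply/nbhs_ballP; exists r%:C => /=; first by rewrite ltcR.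
  move=> h; rewrite -ball_normE /= sub0r normrN normr_cabs ltcC => hr h0.
  exact: H.
Qed.

Lemma cvg0E (E : R[i] -> \bar R) : (forall h, (0 <= E h)%E) ->
  E h @[h --> (0 : R[i]^o)^'] --> 0%E <->
  forall e : R, 0 < e -> exists2 eta : R, 0 < eta &
    forall h, h != 0 -> cabs h < eta -> (E h <= e%:E)%E.
Proof.
move=> E0; split.
- move=> H e e0; apply/dnbhs0CP; apply: (H [set y | (y <= e%:E)%E]).
  change (nbhs (0 : R) (fun r : R => (r%:E <= e%:E)%E)).
  apply/nbhs_ballP; exists e => // r; rewrite -ball_normE /= sub0r normrN => re.
  by rewrite lee_fin (le_trans (ler_norm r))// ltW.
- move=> H P PP; have {PP} : nbhs (0 : R) (fun r : R => P r%:E) by exact: PP.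
  case/nbhs_ballP => e /= e0 HP.
  have [|eta eta0 Heta] := H (e / 2); first by rewrite divr_gt0.
  apply/dnbhs0CP; exists eta => // h h0 he.
  have := Heta h h0 he; have := E0 h; rewrite /preimage/=.
  case: (E h) => [r|//|//]; rewrite !lee_fin => r0 re; apply: (HP r).
  rewrite -ball_normE /= sub0r normrN ger0_norm// (le_lt_trans re)//.
  by rewrite ltr_pdivrMr// ltr_pMr// ltr1n.
Qed.

Lemma cdiff_derivable (F : R[i] -> R[i]) z l : cdiff F z l ->
  derivable (F : R[i]^o -> R[i]^o) z 1.
Proof.
move=> H; apply/cvg_ex; exists l.
apply/cvgrPdist_le => e /lt0C[r r0 ->].
apply/dnbhs0CP; have [eta eta0 He] := H r r0; exists eta => // h h0 heta.
rewrite distrC /= [h%:A]mulr1 [h + z]addrC normr_cabs lecR.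
by have := He h h0 heta; rewrite mulrC.
Qed.

Lemma cvgnCP (u : nat -> R[i]) l :
  (forall e : R, 0 < e -> exists N, forall n, (N <= n)%N -> cabs (l - u n) <= e) ->
  limn (u : nat -> R[i]^o) = l.
Proof.
move=> H; apply: cvg_lim; first exact: norm_hausdorff.
apply/cvgrPdist_le => e /lt0C[r r0 ->].
have [N HN] := H r r0; exists N => // n /= Nn.
by rewrite normr_cabs lecR HN.
Qed.

End ComplexFilters.

Section Spaces.
Variable R : realType.
Local Notation mu := (@lebesgue_measure R).
Local Notation I01 := (`[0%R, 1%R]%classic : set R).
Implicit Types (a b : int -> R[i]) (f g : R -> R[i]).

Lemma ccont_L2circle f : periodic1 f -> ccont f -> L2circle f.
Proof.
move=> pf [fR fI]; split => //; [exact: measurable_realfun.continuous_measurable_fun..|].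
have fc : continuous (fun x => cabs (f x) ^+ 2).
  rewrite (_ : (fun _ => _) = (fun x => Re (f x) * Re (f x) + Im (f x) * Im (f x))).
    by move=> x; apply: cvgD; apply: cvgM; [exact: fR|exact: fR|exact: fI|exact: fI].
  by apply/funext => x; rewrite cabs_sqr !expr2.
have /integrableP[_] := integrable01_cont fc.
apply: le_lt_trans; apply: eq_le_imp.
by apply: eq_integral => x _ /=; rewrite ger0_norm// sqr_ge0.
Qed.

(** On a set of finite measure, |f| <= 1 + |f|^2. *)
Lemma L2circle_cintegrable f : L2circle f -> cintegrable f.
Proof.
move=> [_ mR mI fi].
have mcc : measurable_fun I01 (fun x => cabs (f x) ^+ 2).
  rewrite (_ : (fun _ => _) = (fun x => Re (f x) ^+ 2 + Im (f x) ^+ 2)); last first.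
    by apply/funext => x; rewrite cabs_sqr.
  by apply: measurable_funTS; apply: measurable_realfun.measurable_funD; apply: measurable_realfun.measurable_funX.
have ic : mu.-integrable I01 (EFin \o (fun x => cabs (f x) ^+ 2)).
  apply/integrableP; split; first exact/measurable_realfun.measurable_EFinP.
  apply: le_lt_trans fi; apply: eq_le_imp.
  by apply: eq_integral => x _ /=; rewrite ger0_norm// sqr_ge0.
have i1 : mu.-integrable I01 (EFin \o (fun x => 1 + cabs (f x) ^+ 2)).
  by apply: integrable01D => //; apply: integrable01_cont; exact: cst_continuous.
have le (y : R) (x : R) : `|y| <= cabs (f x) -> `|y| <= `|1 + cabs (f x) ^+ 2|.
  have := cabs_ge0 (f x); move: (cabs (f x)) => c c0 yc.
  rewrite (le_trans yc)// ger0_norm ?addr_ge0 ?sqr_ge0//.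
  by rewrite -subr_ge0 (_ : _ - _ = (c - 2^-1) ^+ 2 + 3 / 4) ?addr_ge0 ?sqr_ge0//; field.
split; apply: (le_integrable _ _ _ i1) => //; try exact: (@mI01 R).
- by apply/measurable_realfun.measurable_EFinP; exact: measurable_funTS.
- by move=> x _ /=; rewrite lee_fin le// cabs_Re.
- by apply/measurable_realfun.measurable_EFinP; exact: measurable_funTS.
- by move=> x _ /=; rewrite lee_fin le// cabs_Im.
Qed.

(** The Fourier series converges absolutely by the loss of radius, and it has
    the same coefficients as the continuous function f. *)
Lemma GCc_synth d s f : 0 < d -> 0 <= s -> GCc d s f ->
  (forall d', 0 <= d' -> d' < d -> (Nw d' (fhat f) < +oo)%E) /\ f = synth (fhat f).
Proof.
move=> d0 s0 [[L2 Gf] fR fI].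
have H d' : 0 <= d' -> d' < d -> (Nw d' (fhat f) < +oo)%E.
  move=> d'0 dd; have [C C0 HC] := Nw_Gn_loss s0 d'0 dd.
  apply: le_lt_trans (HC _) _; move: Gf; rewrite GnormE => Gf.
  by rewrite (Gn_fin Gf) -EFinM ltry.
split=> //.
have d2 : 0 < d / 2 by rewrite divr_gt0.
have N2 : (Nw (d / 2) (fhat f) < +oo)%E by apply: H; lra.
apply: fhat_inj_cont.
- by case: L2.
- exact: synth_periodic.
- by [].
- exact: synth_ccont N2.
- by move=> k; rewrite (fhat_synth k d2 N2).
Qed.

Lemma fhat_synth_fun a d : 0 < d -> (Nw d a < +oo)%E -> fhat (synth a) = a.
Proof. by move=> d0 Na; apply/funext => k; exact: fhat_synth d0 Na. Qed.

Lemma synth_GCc d d' s a : 0 <= s -> 0 <= d -> d < d' -> (Nw d' a < +oo)%E ->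
  GCc d s (synth a).
Proof.
move=> s0 d0 dd Na; have d'0 : 0 < d' by exact: le_lt_trans dd.
have cc := synth_ccont d'0 Na; split; [split|exact: cc.1|exact: cc.2].
  by apply: ccont_L2circle cc; exact: synth_periodic.
rewrite GnormE (fhat_synth_fun d'0 Na).
have [C C0 HC] := Gn_Nw s0 d0 dd.
by apply: le_lt_trans (HC _) _; rewrite (Nw_fin Na) -EFinM ltry.
Qed.

Lemma is_dx_uniq f g h : is_dx f g -> is_dx f h -> g = h.
Proof.
move=> H1 H2; apply/funext => x.
have [[_ a1] [_ a2]] := H1 x; have [[_ b1] [_ b2]] := H2 x.
by apply/eqP; rewrite eq_complex -a1 -a2 b1 b2 !eqxx.
Qed.

Lemma synthD a b x : summ a -> summ b ->
  synth (fun k => a k + b k) x = synth a x + synth b x.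
Proof.
move=> sa sb; rewrite /synth -csumD; [|exact: synth_summ..].
by apply: eq_csum => k; rewrite mulrDl.
Qed.

Lemma synthZ c a x : summ a -> synth (fun k => c * a k) x = c * synth a x.
Proof.
move=> sa; rewrite /synth -csumZ; last exact: synth_summ.
by apply: eq_csum => k; rewrite mulrA.
Qed.

(** The frequencies at most N in modulus, arranged to compare an unordered sum
    with the symmetric partial sums in the definition of [Ainv]. *)
Definition symlist N : seq int := [seq Posz i | i <- iota 0 N.+1] ++ [seq Negz i | i <- iota 0 N].

Lemma symlist_uniq N : uniq (symlist N).
Proof.
rewrite cat_uniq !map_inj_uniq ?iota_uniq ?andbT//=; [|by move=> x y []..].
by apply/hasPn => k /mapP[i _ ->]; apply/mapP => -[].
Qed.

Lemma mem_symlist N k : (k \in symlist N) = (`|k| <= N)%N.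
Proof.
rewrite mem_cat; case: k => n.
- rewrite mem_map; last by move=> x y [].
  rewrite mem_iota /= add0n ltnS.
  by case: (leqP n N) => //= _; apply/mapP => -[].
- rewrite [X in X || _](_ : _ = false) /=; last by apply/mapP => -[].
  by rewrite mem_map; [rewrite mem_iota|move=> x y []].
Qed.

Lemma sum_symlist N (f : int -> R[i]) : \sum_(k <- symlist N) f k =
  f 0 + \sum_(1 <= k < N.+1) (f k%:Z + f (- k%:Z)).
Proof.
rewrite big_cat !big_map /= big_cons -addrA; congr (_ + _).
rewrite big_split/= big_add1/= !/index_iota !subn0; congr (_ + _).
  by rewrite (iotaDl 1 0) big_map.
rewrite subSS subn0 (iotaDl 1 0) big_map; apply: eq_bigr => i _.
by rewrite NegzE.
Qed.

Lemma csum_sym (f : int -> R[i]) : summ f ->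
  f 0 + limn (fun N : nat => \sum_(1 <= k < N.+1) (f k%:Z + f (- k%:Z)) : R[i]^o) = csum f.
Proof.
move=> sf; suff -> : limn (fun N : nat => \sum_(1 <= k < N.+1) (f k%:Z + f (- k%:Z)) : R[i]^o)
    = csum f - f 0 by rewrite addrC subrK.
apply: cvgnCP => e e0.
have [t ut Ht] := csum_approx sf e0.
exists (\max_(k <- t) `|k|%N)%N => n tn.
have [|_] := Ht _ (symlist_uniq n).
  by move=> k kt; rewrite mem_symlist (leq_trans _ tn)// (big_rem k kt)/= leq_maxl.
by rewrite sum_symlist opprD addrA.
Qed.

End Spaces.

(** * The equation on Fourier coefficients *)

Section Equation.
Variable R : realType.
Implicit Types (a b : int -> R[i]) (f g : R -> R[i]).
Local Notation ab k := (`|(k : int)%:~R : R|).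

Lemma le_Nw_coef d (d' C : R) a b : 0 <= C ->
  (forall k, wt d k * cabs (a k) <= C * (wt d' k * cabs (b k))) ->
  (Nw d' b < +oo)%E -> (Nw d a < +oo)%E.
Proof.
move=> C0 H Nb; apply: le_lt_trans (le_esumR H) _.
rewrite esumRZ//; last by move=> k; exact: wt_term_ge0.
by rewrite -/(Nw d' b) (Nw_fin Nb) -EFinM ltry.
Qed.

Lemma Nw_freq d d' a : d < d' -> (Nw d' a < +oo)%E ->
  (Nw d (fun k => freq R k * a k)%R < +oo)%E.
Proof.
move=> dd; have r0 : 0 < d' - d by rewrite subr_gt0.
apply: (@le_Nw_coef _ _ (8 * ((d' - d + 1) / (d' - d)))).
  by rewrite mulr_ge0// divr_ge0 ?(ltW r0)// addr_ge0 ?(ltW r0).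
move=> k; rewrite cabsM !mulrA ler_wpM2r ?cabs_ge0//.
apply: (@le_trans _ _ (wt d k * (8 * om R k))).
  by rewrite ler_wpM2l ?wt_ge0 ?freq_om.
rewrite mulrCA -!mulrA ler_wpM2l// mulrC !mulrA [leLHS]mulrC mulrA.
apply: (@le_trans _ _ ((d' - d + 1) / (d' - d) * expR (2 * pi * (d' - d) * ab k) * wt d k)).
  by rewrite -/(wt d k) mulrC ler_wpM2r ?wt_ge0// om_le_exp.
apply: eq_le_imp; rewrite /wt mulrCA !mulrA -[LHS]mulrA -expRD [om R k * _]mulrC -!mulrA.
have -> : 2 * (pi * ((d' - d) * ab k)) + 2 * (pi * (d * ab k)) = 2 * (pi * (d' * ab k)) by ring.
by rewrite [om R k * (_ * _)]mulrCA.
Qed.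

Lemma cint0E f : cint f = fhat f 0.
Proof. by rewrite fhatE oppr0; congr cint; apply/funext => x; rewrite ek0 mulr1. Qed.

(** The coefficients of 2 mu(u) u + u_x^2 / 2. *)
Definition quad a k : R[i] := 2 * a 0 * a k +
  2^-1 * convol (fun k => freq R k * a k) (fun k => freq R k * a k) k.

Definition invA a k : R[i] := if k == 0 then a 0 else a k / (2 * pi * k%:~R)%:C ^+ 2.

Lemma invA_le a k : cabs (invA a k) <= cabs (a k).
Proof.
rewrite /invA; case: eqP => [->//|/eqP k0].
rewrite cabsM cabsV cabsX cabsR ler_piMr ?cabs_ge0// invf_le1; last first.
  have k1 : (k%:~R : R) != 0 by rewrite intr_eq0.
  by rewrite exprn_gt0// normr_gt0 !mulf_neq0// gt_eqF// pi_gt0.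
apply: exprn_ege1; rewrite normrM ger0_norm ?twopi_ge0//.
have k1 : 1 <= ab k by rewrite -intr_norm ler1z -gtz0_ge1 normr_gt0.
have p2 : 1 <= 2 * pi :> R by have := pi_ge2 R; lra.
by rewrite (le_trans p2)// ler_peMr// (le_trans _ p2).
Qed.

Lemma Nw_invA d a : (Nw d a < +oo)%E -> (Nw d (invA a) < +oo)%E.
Proof.
apply: (@le_Nw_coef _ _ 1) => // k.
by rewrite mul1r ler_wpM2l ?wt_ge0 ?invA_le.
Qed.

Lemma Ainv_synth a d : 0 < d -> (Nw d a < +oo)%E -> Ainv (synth a) = synth (invA a).
Proof.
move=> d0 Na; apply/funext => x.
have sA : summ (invA a) by apply: Nw_summ (ltW d0) _; exact: Nw_invA.
rewrite /Ainv (fhat_synth_fun d0 Na) /synth -(csum_sym (synth_summ x sA)).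
have -> : invA a 0 * @ek R 0 x = a 0 by rewrite ek0 mulr1.
congr (_ + _); apply: (congr1 (fun u : nat -> R[i]^o => limn u)).
apply/funext => N; apply: eq_big_nat => k /andP[k1 _].
have kz : (k%:Z == 0) = false by case: k k1.
have nkz : (- k%:Z == 0) = false by rewrite oppr_eq0.
rewrite /invA kz nkz /ek; congr (_ + _).
by rewrite mulrNz mulrN rmorphN sqrrN; congr (_ * expi _); rewrite mulrN !mulNr.
Qed.

Lemma convC a b k : convol a b k = convol b a k.
Proof.
rewrite /convol (@csum_reindex _ _ _ (fun m => k - m)).
  by apply: eq_csum => m; rewrite opprB addrCA subrr addr0 mulrC.
by exists (fun m => k - m) => m; rewrite opprB addrCA subrr addr0.
Qed.

(** The Leibniz rule for the square: both placements of the derivative have the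
    same sum by symmetry of the convolution. *)
Lemma conv_freq a k : summ a -> summ (fun k => freq R k * a k) ->
  convol a (fun k => freq R k * a k) k = 2^-1 * freq R k * convol a a k.
Proof.
move=> sa sf.
have E : convol a (fun k => freq R k * a k) k + convol a (fun k => freq R k * a k) k =
         freq R k * convol a a k.
  rewrite {2}convC /convol -csumD; [|exact: (conv_summ k sa sf)|exact: (conv_summ k sf sa)].
  rewrite -csumZ; last exact: (conv_summ k sa sa).
  apply: eq_csum => m.
  have -> : freq R k = freq R m + freq R (k - m).
    rewrite /freq -mulrDl -rmorphD/=; congr (_%:C * _).
    by rewrite -mulrDr -intrD addrCA subrr addr0.
  ring.
by rewrite -mulrA -E; field.
Qed.

Lemma toCD (x y : R) : (x + y)%:C = x%:C + y%:C :> R[i].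
Proof. exact: rmorphD. Qed.

Lemma toCM (x y : R) : (x * y)%:C = x%:C * y%:C :> R[i].
Proof. exact: rmorphM. Qed.

Lemma freqM k m : freq R k * freq R m = (- (4 * pi ^+ 2 * (k%:~R * m%:~R)))%:C.
Proof.
rewrite /freq mulrACA -expr2 sqr_i -rmorphM mulrN1 -rmorphN; congr (_%:C).
by move: (pi : R) => p; ring.
Qed.

(** For k <> 0, freq k / (2 pi k)^2 is i / (2 pi k) and the product of two
    frequencies is - 4 pi^2 m (k - m); together with the Leibniz rule this is
    the symbol [beta], up to sign. *)
Lemma eq_Bil a k : summ a -> summ (fun k => freq R k * a k) ->
  convol a (fun k => freq R k * a k) k + freq R k * invA (quad a) k = - Bil a a k.
Proof.
move=> sa sf; rewrite conv_freq//.
have [->|k0] := eqVneq k 0.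
  rewrite /freq !mulr0 !mul0r mulr0 !mul0r addr0.
  rewrite /Bil (eq_csum (g := fun=> 0)) ?csum0 ?oppr0// => m.
  by rewrite /beta /bsym mulr0 mulr0 invr0 mul0r addr0 mulr0 mul0r.
rewrite /invA (negbTE k0) /quad /convol.
pose q : R[i] := ((2 * pi * k%:~R)^-1)%:C.
have k1 : (2 * pi * k%:~R : R) != 0.
  by rewrite !mulf_neq0 ?intr_eq0// gt_eqF// pi_gt0.
have kC : (2 * pi * k%:~R)%:C != 0 :> R[i] by rewrite fmorph_eq0; exact: k1.
have fq : freq R k / (2 * pi * k%:~R)%:C ^+ 2 = 'i * q.
  have -> : q = (2 * pi * k%:~R)%:C^-1 by exact: fmorphV.
  rewrite /freq; move: (2 * pi * k%:~R)%:C kC => Z Z0.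
  by rewrite expr2 invfM [Z * _]mulrC -mulrA mulVKf.
have Bs : Bil a a k = csum (fun m => - (pi * k%:~R)%:C * 'i * (a m * a (k - m))
    + (- 'i * q * (if m == 0 then 2 * a 0 * a k else 0)
    - 'i * q * (2^-1 * (freq R m * a m * (freq R (k - m) * a (k - m)))))).
  apply: eq_csum => m; rewrite /beta /bsym [freq R m * a m * _]mulrACA freqM.
  pose y : R := - (2 * pi ^+ 2 * (m%:~R * (k - m)%:~R)).
  have Eb : (pi * k%:~R + (2 * pi * k%:~R)^-1 * ((if m == 0 then 2 else 0)
      - 2 * pi ^+ 2 * (m%:~R * (k - m)%:~R)))%:C
      = (pi * k%:~R)%:C + q * ((if m == 0 then 2 else 0 : R)%:C + y%:C) :> R[i].
    by rewrite toCD [X in _ + X = _]toCM toCD.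
  have Ey : 2^-1 * (- (4 * pi ^+ 2 * (m%:~R * (k - m)%:~R)))%:C = y%:C :> R[i].
    apply: (mulfI (_ : 2 != 0)) => //; rewrite mulrA mulfV// mul1r.
    rewrite -[2 in RHS](rmorph_nat (real_complex R) 2) -toCM.
    by congr (_%:C); rewrite /y; move: (pi : R) => p; ring.
  have E0 : (if m == 0 then 2 * a 0 * a k else 0) =
      (if m == 0 then 2 else 0 : R)%:C * (a m * a (k - m)).
    case: eqP => [->|_]; last by rewrite mul0r.
    by rewrite subr0 mulrA (rmorph_nat (real_complex R) 2).
  rewrite Eb E0 [2^-1 * _]mulrA Ey.
  move: (a m * a (k - m)) ((pi * k%:~R)%:C) ((if m == 0 then 2 else 0 : R)%:C) (y%:C) => u v w z.
  by move: ('i : R[i]) => i; ring.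
rewrite Bs.
have [s1 c1] := @summ_pred1 R int 0 (2 * a 0 * a k).
have s2 := conv_summ k sa sa.
have s3 := conv_summ k sf sf.
rewrite csumD; [|exact: summZ|by apply: summD; [exact: summZ|apply: summN; apply: summZ; exact: summZ]].
rewrite csumB; [|exact: summZ|by apply: summZ; exact: summZ].
rewrite !csumZ//; last exact: summZ.
rewrite c1 [freq R k * (_ / _)]mulrCA fq.
have -> : 2^-1 * freq R k = (pi * k%:~R)%:C * 'i.
  rewrite /freq -[2 * pi * _]mulrA toCM (rmorph_nat (real_complex R) 2).
  by rewrite -mulrA mulKf.
by move: ('i : R[i]) => i; ring.
Qed.

(** The left-hand side of the equation is the Fourier series with coefficients
    b - Bil a a. Derivatives being unique, the functions phix and w of the
    definition are the termwise derivatives, and a vanishing Fourier series has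
    vanishing coefficients. *)
Lemma satisfies_eqP d d1 a b : 0 < d -> 0 < d1 ->
  (Nw d a < +oo)%E -> (Nw d1 b < +oo)%E ->
  satisfies_eq (synth a) (synth b) <-> forall k, b k = Bil a a k.
Proof.
move=> d0 d10 Na Nb.
have d20 : 0 < d / 2 by rewrite divr_gt0.
have dd : d / 2 < d by rewrite ltr_pdivrMr// ltr_pMr// ltr1n.
have Nf := Nw_freq dd Na.
have sa := Nw_summ (ltW d0) Na; have sf := Nw_summ (ltW d20) Nf.
have Na2 := le_lt_trans (le_Nw a (ltW dd)) Na.
have Nc : (Nw (d / 2) (convol a (fun k => freq R k * a k)%R) < +oo)%E.
  apply: le_lt_trans (Nw_conv _ (ltW d20) Nf) _.
  by rewrite (Nw_fin Na2) (Nw_fin Nf) -EFinM ltry.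
have Nff : (Nw (d / 2) (convol (fun k => freq R k * a k)%R (fun k => freq R k * a k)%R) < +oo)%E.
  apply: le_lt_trans (Nw_conv _ (ltW d20) Nf) _.
  by rewrite (Nw_fin Nf) -EFinM ltry.
have Nq : (Nw (d / 2) (quad a) < +oo)%E.
  apply: le_lt_trans (NwD _ _ _) _; rewrite !NwZ.
  by rewrite (Nw_fin Na2) (Nw_fin Nff) -!EFinM -EFinD ltry.
have NA := Nw_invA Nq.
have d40 : 0 < d / 2 / 2 by rewrite divr_gt0.
have dd4 : d / 2 / 2 < d / 2 by rewrite ltr_pdivrMr// ltr_pMr// ltr1n.
have NfA := Nw_freq dd4 NA.
have sfA := Nw_summ (ltW d40) NfA.
have sc := Nw_summ (ltW d20) Nc; have sb := Nw_summ (ltW d10) Nb.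
have DX := synth_dx d0 Na.
have EQ : (fun x => 2 * cint (synth a) * synth a x + 2^-1 * synth (fun k => freq R k * a k) x ^+ 2)
    = synth (quad a).
  apply/funext => x; rewrite cint0E (fhat_synth_fun d0 Na) expr2 synthM// synthD.
  - by rewrite !synthZ//; exact: Nw_summ (ltW d20) Nff.
  - exact: summZ.
  - by apply: summZ; exact: Nw_summ (ltW d20) Nff.
have DW : is_dx (Ainv (synth (quad a))) (synth (fun k => freq R k * invA (quad a) k)).
  by rewrite (Ainv_synth d20 Nq); exact: synth_dx d20 NA.
have ER x : synth b x + synth a x * synth (fun k => freq R k * a k) x +
    synth (fun k => freq R k * invA (quad a) k) x =
    synth (fun k => b k - Bil a a k) x.
  rewrite synthM// -synthD// -synthD//; last exact: summD.
  by apply: eq_csum => k; rewrite -addrA eq_Bil.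
split.
- move=> [phix [w [H1 H2 H3]]] k.
  have Ex := is_dx_uniq H1 DX; rewrite Ex EQ in H2 H3.
  have Ew := is_dx_uniq H2 DW; rewrite Ew in H3.
  pose e : R := Num.min d1 (d / 2 / 2).
  have e0 : 0 < e by rewrite lt_min d10.
  have [e1 e2] : e <= d1 /\ e <= d / 2 / 2 by rewrite /e !ge_min !lexx orbT.
  have NR : (Nw e (fun k => b k - Bil a a k)%R < +oo)%E.
    have -> : (fun k => b k - Bil a a k) = (fun k => (b k + convol a (fun k => freq R k * a k) k) +
        freq R k * invA (quad a) k).
      by apply/funext => j; rewrite -addrA eq_Bil.
    apply: le_lt_trans (NwD _ _ _) _; apply: lte_add_pinfty.
      apply: le_lt_trans (NwD _ _ _) _; apply: lte_add_pinfty.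
        by apply: le_lt_trans (le_Nw _ _) Nb.
      by apply: le_lt_trans (le_Nw _ _) Nc; rewrite (le_trans e2)// ltW.
    by apply: le_lt_trans (le_Nw _ _) NfA.
  apply/eqP; rewrite -subr_eq0; apply/eqP.
  rewrite -(fhat_synth k e0 NR) fhatE (_ : (fun _ => _) = fun=> 0 * 0).
    by rewrite cintZ ?mul0r//; apply: ccont_cintegrable; exact: ccont_cst.
  by apply/funext => x; rewrite -ER H3 !mul0r.
- move=> H; exists (synth (fun k => freq R k * a k)), (synth (fun k => freq R k * invA (quad a) k)).
  rewrite EQ; split; [exact: DX|exact: DW|move=> x].
  rewrite ER /synth (eq_csum (g := fun=> 0)) ?csum0// => k.
  by rewrite H subrr mul0r.
Qed.

End Equation.

(** * Holomorphic solutions *)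

Section Solutions.
Variable R : realType.
Implicit Types (a b : int -> R[i]) (f g v : R -> R[i]) (u : R[i] -> R -> R[i]) (t h : R[i]).

(** Compactness of the segment, for a property that is monotone in the bound:
    local bounds give a global one. *)
Lemma bounded_seg (P : nat -> R -> Prop) :
  (forall m n x, (m <= n)%N -> P m x -> P n x) ->
  (forall x, 0 <= x <= 1 -> exists2 eta : R, 0 < eta &
     exists N, forall y, `|y - x| < eta -> P N y) ->
  exists N, forall x, 0 <= x <= 1 -> P N x.
Proof.
move=> mono H.
have := @segment_compact R 0 1.
move/compact_near_coveringP => /(_ nat \oo P _) [].
  move=> x; rewrite /= in_itv/= => /H[eta eta0 [N HN]].
  near=> y n => /=; apply: (mono N).
    by near: n; exists N.
  apply: HN; near: y; apply/nbhs_ballP; exists eta => // y.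
  by rewrite -ball_normE /= distrC.
move=> N _ HN; exists N => x x01; apply: (HN N) => //=.
Unshelve. all: by end_near. Qed.

Lemma cdiff_uniq (f : R[i] -> R[i]) t l l' : cdiff f t l -> cdiff f t l' -> l = l'.
Proof.
move=> H1 H2; apply/eqP; rewrite -subr_eq0; apply/eqP; apply: cabs_eq0.
apply/eqP; rewrite eq_le cabs_ge0 andbT; apply/ler_addgt0Pr => e e0; rewrite add0r.
have e2 : 0 < e / 2 by rewrite divr_gt0.
have [n1 n10 K1] := H1 _ e2; have [n2 n20 K2] := H2 _ e2.
pose m := Num.min n1 n2.
have m0 : 0 < m by rewrite lt_min n10.
have hm : cabs (m / 2)%:C < m :> R.
  by rewrite cabsR ger0_norm ?divr_ge0 ?(ltW m0)// ltr_pdivrMr// ltr_pMr// ltr1n.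
have h0 : (m / 2)%:C != 0 :> R[i] by rewrite fmorph_eq0 gt_eqF// divr_gt0.
have [m1 m2] : m <= n1 /\ m <= n2 by rewrite /m !ge_min !lexx orbT.
have := K1 _ h0 (lt_le_trans hm m1); have := K2 _ h0 (lt_le_trans hm m2).
move: ((_ - _) / _) => q A1 A2.
have -> : l - l' = (q - l') - (q - l) by ring.
by rewrite (le_trans (cabsB _ _))// (splitr e) lerD.
Qed.

Lemma GCc_cintegrable d s f : GCc d s f -> cintegrable f.
Proof. by case=> -[L2 _] _ _; exact: L2circle_cintegrable. Qed.

Lemma fhat_quot f g v h k : cintegrable f -> cintegrable g -> cintegrable v ->
  fhat (fun x => (f x - g x) / h - v x) k = (fhat f k - fhat g k) / h - fhat v k.
Proof.
move=> fi gi vi.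
have di : cintegrable (fun x => f x - g x).
  have := cintegrableD fi (cintegrableZ (-1) gi); congr cintegrable.
  by apply/funext => x; rewrite mulN1r.
have -> : (fun x => (f x - g x) / h - v x) = (fun x => h^-1 * (f x - g x) - v x).
  by apply/funext => x; rewrite mulrC.
rewrite fhatB//; last exact: cintegrableZ.
by rewrite fhatZ// fhatB// mulrC.
Qed.

Lemma gw_ge1 d s k : 0 <= d -> 0 <= s -> 1 <= gw d s k :> R.
Proof.
move=> d0 s0; rewrite -[leLHS]mulr1 ler_pM//.
  by rewrite -[leLHS](powRr0 (jap R k)) ler_powR ?jap_ge1.
by rewrite -[leLHS]expR0 ler_expR !mulr_ge0// pi_ge0.
Qed.

Lemma coef_Gn d s a k : 0 <= d -> 0 <= s -> ((cabs (a k))%:E <= Gn d s a)%E.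
Proof.
move=> d0 s0; apply: le_trans (Gn_term d s a k).
by rewrite lee_fin ler_peMl ?cabs_ge0 ?gw_ge1.
Qed.

(** Every coefficient is bounded by the norm, so differentiability in the norm
    differentiates each of them. *)
Lemma is_dt_coef d s r u t v : 0 <= d -> 0 <= s ->
  (forall t', cabs t' < r -> GCc d s (u t')) -> cabs t < r -> is_dt d s u t v ->
  forall k, cdiff (fun t => fhat (u t) k) t (fhat v k).
Proof.
move=> d0 s0 Hu tr [Gv /cvg0E H] k e e0.
have [n n0 Hn] := H (fun h => sqrte_ge0 _) e e0.
exists (Num.min n (r - cabs t)); first by rewrite lt_min n0 subr_gt0.
move=> h h0; rewrite lt_min => /andP[hn hr].
have thr : cabs (t + h) < r by rewrite (le_lt_trans (cabsD _ _))// -ltrBrDl.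
have := Hn h h0 hn; rewrite GnormE => /(le_trans (coef_Gn _ k d0 s0)).
by rewrite lee_fin fhat_quot//; apply: GCc_cintegrable; [exact: Hu|exact: Hu|exact: Gv].
Qed.

(** Differentiability in a point bounds the function near that point; the loss
    of radius turns the Gevrey norm into [Nw]. *)
Lemma is_dt_bounded d d' s r u t v : 0 <= d -> d < d' -> 0 <= s ->
  (forall t', cabs t' < r -> GCc d' s (u t')) -> cabs t < r -> is_dt d' s u t v ->
  exists2 eta : R, 0 < eta & exists B : R, forall h, cabs h < eta ->
    (Nw d (fhat (u (t + h)%R)) <= B%:E)%E.
Proof.
move=> d0 dd s0 Hu tr [Gv /cvg0E H].
have d'0 : 0 < d' by exact: le_lt_trans dd.
have Nt := (GCc_synth d'0 s0 (Hu t tr)).1 d d0 dd.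
have Nv := (GCc_synth d'0 s0 Gv).1 d d0 dd.
have [C C0 HC] := Nw_Gn_loss s0 d0 dd.
have [n n0 Hn] := H (fun h => sqrte_ge0 _) 1 ltr01.
pose eta := Num.min (Num.min n (r - cabs t)) 1.
have eta0 : 0 < eta by rewrite !lt_min n0 subr_gt0 tr ltr01.
exists eta => //; exists (fine (Nw d (fhat (u t))) + (fine (Nw d (fhat v)) + C)) => h.
rewrite !lt_min => /andP[/andP[hn hr] h1].
have Nt0 : 0 <= fine (Nw d (fhat (u t))) by apply: fine_ge0; exact: Nw_ge0.
have Nv0 : 0 <= fine (Nw d (fhat v)) by apply: fine_ge0; exact: Nw_ge0.
have [->|h0] := eqVneq h 0.
  by rewrite addr0 (Nw_fin Nt) lee_fin lerDl addr_ge0// ltW.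
have thr : cabs (t + h) < r by rewrite (le_lt_trans (cabsD _ _))// -ltrBrDl.
pose w k := (fhat (u (t + h)) k - fhat (u t) k) / h - fhat v k.
have Gw : (Nw d w <= C%:E)%E.
  apply: le_trans (HC w) _; rewrite -[leRHS]mule1; apply: lee_wpmul2l.
    by rewrite lee_fin ltW.
  have := Hn h h0 hn; rewrite GnormE; congr (Gn _ _ _ <= _)%E.
  apply/funext => k; rewrite fhat_quot//; apply: GCc_cintegrable; [exact: Hu|exact: Hu|exact: Gv].
have -> : fhat (u (t + h)) = (fun k => fhat (u t) k + h * (fhat v k + w k)).
  by apply/funext => k; rewrite /w; move: (fhat (u (t + h)) k) (fhat (u t) k) (fhat v k) => A B D; field.
apply: le_trans (NwD _ _ _) _; rewrite NwZ EFinD -Nw_fin//; apply: leeD => //.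
apply: (@le_trans _ _ (1%:E * Nw d (fun k => fhat v k + w k)%R)%E).
  by apply: lee_wpmul2r; [exact: Nw_ge0|rewrite lee_fin ltW].
by rewrite mul1e; apply: le_trans (NwD _ _ _) _; rewrite EFinD -Nw_fin// leeD.
Qed.

(** Both solutions have coefficients satisfying the hypotheses of [uniq_line]
    on the ray through t, with half the radius; the common bound comes from
    local bounds and compactness. *)
Lemma solution_uniq d s r (u0 : R -> R) (u v : R[i] -> R -> R[i]) : 0 < d -> 0 <= s -> 0 < r ->
  holomorphic_solution d s r u0 u -> holomorphic_solution d s r u0 v ->
  forall t, cabs t < r -> forall x, v t x = u t x.
Proof.
move=> d0 s0 r0 [Hu u00 Eu] [Hv v00 Ev] t1 t1r.
have d20 : 0 < d / 2 by rewrite divr_gt0.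
have dd : d / 2 < d by rewrite ltr_pdivrMr// ltr_pMr// ltr1n.
have ray (x : R) : 0 <= x <= 1 -> cabs (x%:C * t1) < r.
  move=> /andP[x0 x1]; rewrite cabsM cabsR ger0_norm//.
  by rewrite (le_lt_trans _ t1r)// ler_piMl// cabs_ge0.
have der w : holomorphic_G d s r w ->
    (forall (t : R[i]) v, cabs t < r -> is_dt d s w t v -> satisfies_eq (w t) v) ->
    forall x : R, 0 <= x <= 1 -> forall k, cdiff (fun t => fhat (w t) k) (x%:C * t1)
      (Bil (fhat (w (x%:C * t1))) (fhat (w (x%:C * t1))) k).
  move=> Hw Ew x x01 k; have tr := ray x x01.
  have [Gw [z Dz]] := Hw _ tr.
  have := is_dt_coef (ltW d0) s0 (fun t' tr' => (Hw t' tr').1) tr Dz k.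
  have [Nw1 Es1] := GCc_synth d0 s0 Gw.
  have [Nz1 Es2] := GCc_synth d0 s0 Dz.1.
  have := Ew _ _ tr Dz; rewrite {1}Es1 {1}Es2.
  by move/(satisfies_eqP d20 d20 (Nw1 _ (ltW d20) dd) (Nz1 _ (ltW d20) dd)) ->.
have bnd w : holomorphic_G d s r w -> exists N : nat, forall x : R, 0 <= x <= 1 ->
    (Nw (d / 2)%R (fhat (w (x%:C * t1)%R)) <= (N%:R : R)%:E)%E.
  move=> Hw; apply: bounded_seg.
    by move=> m n x mn h; rewrite (le_trans h)// lee_fin ler_nat.
  move=> x x01; have tr := ray x x01.
  have [Gw [z Dz]] := Hw _ tr.
  have [eta eta0 [B HB]] := is_dt_bounded (ltW d20) dd s0 (fun t' tr' => (Hw t' tr').1) tr Dz.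
  have c1 : 0 < cabs t1 + 1 by rewrite ltr_wpDl ?cabs_ge0.
  exists (eta / (cabs t1 + 1)); first by rewrite divr_gt0.
  exists (Num.truncn `|B|).+1 => y yx.
  have -> : y%:C * t1 = x%:C * t1 + (y - x)%:C * t1.
    by rewrite -mulrDl -toCD addrCA subrr addr0.
  apply: (@le_trans _ _ B%:E); last first.
    by rewrite lee_fin (le_trans (ler_norm B))// ltW// truncnS_gt.
  apply: HB; rewrite cabsM cabsR; move: yx; rewrite ltr_pdivlMr//; apply: le_lt_trans.
  by rewrite ler_wpM2l// lerDl.
have [N1 B1] := bnd _ Hu; have [N2 B2] := bnd _ Hv.
have M0 : 0 < (maxn N1 N2).+1%:R :> R by [].
have leM (N : nat) (y : \bar R) : (N <= maxn N1 N2)%N -> (y <= (N%:R : R)%:E)%E ->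
    (y <= ((maxn N1 N2).+1%:R : R)%:E)%E.
  by move=> h1 h2; rewrite (le_trans h2)// lee_fin ler_nat leqW.
have U := uniq_line d20 M0 (der _ Hv Ev) (der _ Hu Eu)
  (fun x x01 => leM _ _ (leq_maxr _ _) (B2 x x01)) (fun x x01 => leM _ _ (leq_maxl _ _) (B1 x x01)).
have E k : fhat (v t1) k = fhat (u t1) k.
  have := U _ 1 _ k; rewrite mul1r => /(_ _ _)/eqP.
  rewrite subr_eq0 => H; apply/eqP; apply: H.
    move=> j; rewrite mul0r (_ : v 0 = u 0) ?subrr//.
    by apply/funext => x; rewrite u00 v00.
  by rewrite ler01 lexx.
move=> x.
have [_ ->] := GCc_synth d0 s0 (Hu _ t1r).1; have [_ ->] := GCc_synth d0 s0 (Hv _ t1r).1.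
by have -> : fhat (v t1) = fhat (u t1) by apply/funext.
Qed.

Lemma synth_quot a b c h x : summ a -> summ b -> summ c ->
  synth (fun k => (a k - b k) / h - c k) x = (synth a x - synth b x) / h - synth c x.
Proof.
move=> sa sb sc.
have neg e : summ e -> synth (fun k => - e k) x = - synth e x.
  by move=> se; rewrite /synth -csumN; apply: eq_csum => k; rewrite mulNr.
rewrite synthD; [|by under eq_fun do rewrite mulrC; apply/summZ/summD => //; exact: summN|exact: summN].
rewrite neg// (_ : (fun k => (a k - b k) / h) = (fun k => h^-1 * (a k - b k))); last first.
  by apply/funext => k; rewrite mulrC.
by rewrite synthZ ?synthD ?neg//; [rewrite mulrC|exact: summN|apply: summD => //; exact: summN].
Qed.

Lemma is_dt_deriv_uniq d s r u t v v' : 0 < d -> 0 <= s ->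
  (forall t', cabs t' < r -> GCc d s (u t')) -> cabs t < r ->
  is_dt d s u t v -> is_dt d s u t v' -> v = v'.
Proof.
move=> d0 s0 Hu tr D1 D2.
have [_ ->] := GCc_synth d0 s0 D1.1; have [_ ->] := GCc_synth d0 s0 D2.1.
congr synth; apply/funext => k.
by apply: cdiff_uniq (is_dt_coef (ltW d0) s0 Hu tr D1 k) (is_dt_coef (ltW d0) s0 Hu tr D2 k).
Qed.

Lemma le_mass (c : nat -> int -> R[i]) d d' (r : R) : 0 <= r -> d <= d' ->
  (mass c d r <= mass c d' r)%E.
Proof.
move=> r0 dd; apply: le_esumR => p; apply: ler_wpM2l; first exact: exprn_ge0.
by rewrite ler_wpM2r ?cabs_ge0 ?le_wt.
Qed.

Section Existence.
Variables (D M d s : R) (a0 : int -> R[i]).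
Hypotheses (D0 : 0 < D) (M0 : 0 < M) (a0M : (Nw D a0 <= M%:E)%E).
Hypotheses (d0 : 0 < d) (d1 : d < 1) (s0 : 0 <= s).
Let T := D / growth D M.
Let sol (t : R[i]) := synth (flow a0 t).

Lemma T_gt0 : 0 < T. Proof. by rewrite divr_gt0// growth_gt0. Qed.

(** Half of the distance of |t| to T (1 - d) is left for increments of t, the
    other half is converted into a gain d' - d of radius. *)
Lemma radius_margin t : cabs t < T * (1 - d) -> exists2 d' : R, d < d' < 1 &
  exists2 e : R, 0 < e & cabs t + e <= T * (1 - d').
Proof.
move=> tT; have T0 := T_gt0.
pose e := (T * (1 - d) - cabs t) / 2.
have e0 : 0 < e by rewrite divr_gt0// subr_gt0.
exists (d + e / T).
  rewrite ltrDl divr_gt0//= -ltrBrDl ltr_pdivrMr//.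
  rewrite /e ltr_pdivrMr// mulrC.
  by have := cabs_ge0 t; have : 0 < (1 - d) * T by [rewrite mulr_gt0// subr_gt0]; lra.
exists e => //; rewrite opprD addrA mulrDr mulrN mulrCA mulfV ?gt_eqF// mulr1.
by rewrite /e; lra.
Qed.

Lemma flow_mass d' : 0 <= d' -> d' < 1 ->
  (mass (ucoef a0) (D * d')%R (T * (1 - d'))%R <= (2 * M)%:E)%E.
Proof.
move=> d'0 d'1; have := @ucoef_mass R D M a0 D0 M0 a0M (D * d').
have -> : (D - D * d') / growth D M = T * (1 - d') by rewrite /T; ring.
by apply; [rewrite mulr_ge0// ltW|rewrite gtr_pMr].
Qed.

(** The power series converges in the slightly larger radius D d' and in a
    slightly larger disk; the loss from D d' to D d turns its estimates in [Nw]
    into estimates in the Gevrey norm. *)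
Lemma flow_solution t : cabs t < T * (1 - d) ->
  [/\ GCc (D * d) s (sol t), is_dt (D * d) s sol t (synth (dflow a0 t)) &
      satisfies_eq (sol t) (synth (dflow a0 t))].
Proof.
move=> tT; have [d' /andP[dd d'1] [e e0 te]] := radius_margin tT.
have d'0 : 0 < d' by exact: lt_trans dd.
have Dd0 : 0 < D * d by rewrite mulr_gt0.
have Dd'0 : 0 < D * d' by rewrite mulr_gt0.
have DD : D * d < D * d' by rewrite ltr_pM2l.
have Hm := flow_mass (ltW d'0) d'1.
have r0 : 0 <= T * (1 - d') by rewrite (le_trans _ te)// addr_ge0 ?cabs_ge0// ltW.
have trr h : cabs h <= e -> cabs (t + h) <= T * (1 - d').
  by move=> he; rewrite (le_trans (cabsD _ _))// (le_trans _ te)// lerD2l.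
have Ne h : cabs h <= e -> (Nw (D * d') (flow a0 (t + h)%R) < +oo)%E.
  move=> he; apply: le_lt_trans (flow_Nw r0 (ltW Dd'0) Hm (trr h he)) _; exact: ltry.
have Ne0 : (Nw (D * d') (flow a0 t) < +oo)%E.
  by have := Ne 0; rewrite cabs0 addr0; apply; exact: ltW.
have Nd : (Nw (D * d') (dflow a0 t) < +oo)%E.
  apply: le_lt_trans (dflow_Nw r0 (ltW Dd'0) Hm e0 te) _; exact: ltry.
split.
- exact: synth_GCc s0 (ltW Dd0) DD Ne0.
- split; first exact: synth_GCc s0 (ltW Dd0) DD Nd.
  apply/cvg0E => [h|eps eps0]; first exact: sqrte_ge0.
  have [C C0 HC] := Gn_Nw s0 (ltW Dd0) DD.
  (* the difference quotient converges at the rate L |h| *)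
  pose L : R := C * ((e ^+ 2)^-1 * (2 * M)).
  have L0 : 0 < L by rewrite !mulr_gt0// invr_gt0 exprn_gt0.
  exists (Num.min e (eps / L)); first by rewrite lt_min e0 divr_gt0.
  move=> h h0; rewrite lt_min => /andP[he hL].
  have he' := ltW he.
  rewrite GnormE (_ : (fun x => _) = synth (fun k => (flow a0 (t + h) k - flow a0 t k) / h - dflow a0 t k)).
    have Nq := flow_diff r0 (ltW Dd'0) Hm e0 te he' h0.
    rewrite (fhat_synth_fun Dd'0 (le_lt_trans Nq (ltry _))).
    apply: le_trans (HC _) _; apply: (@le_trans _ _ (C%:E * (cabs h / e ^+ 2 * (2 * M))%:E)%E).
      by apply: lee_wpmul2l => //; rewrite lee_fin ltW.
    rewrite -EFinM lee_fin -[cabs h / _ * _]mulrA mulrCA -/L.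
    by rewrite -ler_pdivlMr// ltW.
  apply/funext => x; rewrite synth_quot//.
  + exact: Nw_summ (ltW Dd'0) (Ne h he').
  + exact: Nw_summ (ltW Dd'0) Ne0.
  + exact: Nw_summ (ltW Dd'0) Nd.
- apply/(satisfies_eqP Dd'0 Dd'0 Ne0 Nd) => k.
  apply: (flow_ode r0 k _ e0 te).
  by apply: le_trans Hm; exact: le_mass r0 (ltW Dd'0).
Qed.

End Existence.

End Solutions.

(** * Real-analytic data *)

Section Analyticity.
Variable R : realType.
Implicit Types (a : nat -> R) (u f : R -> R).

Lemma iter_diffs a n k :
  iter n (@pseries_diffs R) a k = ((k + n) ^_ n)%:R * a (k + n)%N.
Proof.
elim: n k => [|n IH] k; first by rewrite addn0 ffactn0 mul1r.
by rewrite iterS /pseries_diffs IH addSnnS ffactnSr mulrA -natrM mulnC -addSnnS addnK.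
Qed.

Lemma bin_le2 n m : ('C(n, m) <= 2 ^ n)%N.
Proof.
elim: n m => [|n IH] [|m]; rewrite ?bin0 ?bin0n ?expn_gt0// binS expnS mul2n -addnn.
by rewrite leq_add.
Qed.

(** A falling factorial is n! times a binomial coefficient, and a binomial
    coefficient is at most a power of 2. *)
Lemma iter_diffs_bound a (A q : R) n k : 0 <= A -> 0 < q ->
  (forall k, `|a k| * q ^+ k <= A) ->
  `|iter n (@pseries_diffs R) a k| <= A * n`!%:R * (2 / q) ^+ n * (2 / q) ^+ k.
Proof.
move=> A0 q0 Ha; rewrite iter_diffs normrM ger0_norm//.
have qk : 0 < q ^+ (k + n) by rewrite exprn_gt0.
apply: (@le_trans _ _ ((2 ^ (k + n) * n`!)%:R * (A / q ^+ (k + n)))).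
  rewrite ler_pM//; first by rewrite ler_nat -bin_ffact leq_mul ?bin_le2.
  by rewrite ler_pdivlMr// mulrC mulrC.
rewrite natrM natrX -[_ * (2 / q) ^+ k]mulrA -exprD [(n + k)%N]addnC exprMn exprVn.
by apply: eq_le_imp; ring.
Qed.

Lemma geometric_le (c : nat -> R) (y B : R) : 0 <= B ->
  (forall k, `|c k * y ^+ k| <= B * 2^-1 ^+ k) ->
  cvgn (pseries c y) /\ `|limn (pseries c y)| <= 2 * B.
Proof.
move=> B0 H.
have h1 : `|2^-1| < 1 :> R by rewrite ger0_norm// invf_lt1// ltr1n.
have cg : cvgn (series (geometric B (2^-1 : R))) by exact: is_cvg_geometric_series.
have cn : cvgn [normed pseries c y].
  apply: (series_le_cvg _ _ _ cg) => [n|n|n]; [exact: normr_ge0| |exact: H].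
  by rewrite /= mulr_ge0// exprn_ge0// invr_ge0.
split; first exact: normed_cvg.
apply: (le_trans (lim_series_norm cn)).
apply: (le_trans (lim_series_le cn cg H)).
by rewrite (cvg_lim _ (cvg_geometric_series h1))//; apply: eq_le_imp; field.
Qed.

(** The coefficients of a series converging at q = r/2 are at most A/q^k.
    Within q/4 of the centre, the n-fold differentiated series is then
    dominated by A n! (2/q)^n times the geometric series of ratio 1/2. *)
Lemma analytic_local u (x0 : R) a (r : R) : 0 < r ->
  (forall x, `|x - x0| < r -> pseries a (x - x0) @ \oo --> u x) ->
  exists2 eta : R, 0 < eta & exists (S : nat -> R -> R) (A rho : R),
    [/\ 0 < A, 0 < rho,
        forall x, `|x - x0| < eta -> S 0 x = u x,
        forall n (x : R), `|x - x0| < eta -> is_derive x 1 (S n) (S n.+1 x) &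
        forall n x, `|x - x0| < eta -> `|S n x| <= A * n`!%:R * rho ^+ n].
Proof.
move=> r0 H.
pose q := r / 2; have q0 : 0 < q by rewrite divr_gt0.
have qr : q < r by rewrite ltr_pdivrMr// ltr_pMr// ltr1n.
have cq : cvgn (pseries a q).
  apply/cvg_ex; exists (u (x0 + q)); have := H (x0 + q).
  by rewrite addrAC subrr add0r ger0_norm ?(ltW q0)//; apply.
have [K [Kreal Kf]] := cvg_series_bounded cq.
pose A := `|K| + 1; have A0 : 0 < A by rewrite ltr_wpDl.
have Ha k : `|a k| * q ^+ k <= A.
  have KA : K < A by rewrite /A ltr_pwDr// ler_norm.
  by have /= := Kf A KA k I; rewrite normrM normrX (ger0_norm (ltW q0)).
pose eta := q / 4; have eta0 : 0 < eta by rewrite divr_gt0.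
have D n (y : R) : `|y| <= eta -> forall k,
    `|iter n (@pseries_diffs R) a k * y ^+ k| <= A * n`!%:R * (2 / q) ^+ n * 2^-1 ^+ k.
  move=> ye k; rewrite normrM normrX.
  apply: (@le_trans _ _ (A * n`!%:R * (2 / q) ^+ n * (2 / q) ^+ k * eta ^+ k)).
    apply: ler_pM => //; first exact: (iter_diffs_bound n k (ltW A0) q0 Ha).
    by rewrite lerXn2r// nnegrE// ltW.
  rewrite -mulrA -exprMn (_ : 2 / q * eta = 2^-1)//.
  by rewrite /eta; field; rewrite gt_eqF.
have B0 n : 0 <= A * n`!%:R * (2 / q) ^+ n.
  apply: mulr_ge0; first by apply: mulr_ge0 => //; exact: ltW.
  by apply/exprn_ge0/divr_ge0 => //; exact: ltW.
exists eta => //.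
exists (fun n x => limn (pseries (iter n (@pseries_diffs R) a) (x - x0))), (2 * A), (2 / q).
split; [by rewrite mulr_gt0|by rewrite divr_gt0|..].
- move=> x xe; apply/cvg_lim => //; apply: H; rewrite (lt_trans xe)// (lt_trans _ qr)//.
  by rewrite /eta ltr_pdivrMr// ltr_pMr// ltr1n.
- move=> n x xe.
  have ee : `|eta| <= eta by rewrite ger0_norm// ltW.
  have xe' : `|x - x0| < `|eta| by rewrite (ger0_norm (ltW eta0)).
  have P := pseries_snd_diffs (geometric_le (B0 n) (D n _ ee)).1
    (geometric_le (B0 n.+1) (D n.+1 _ ee)).1 (geometric_le (B0 n.+2) (D n.+2 _ ee)).1 xe'.
  have Dx : is_derive x 1 (fun x => x - x0) (1 : R).
    apply: is_deriveP => e e0; exists 1 => // h _ _.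
    rewrite (_ : _ - _ = 0) ?normr0 ?mulr_ge0 ?(ltW e0)//; ring.
  have := @is_derive1_comp R _ (fun x => x - x0) x _ _ P Dx.
  by rewrite mulr1.
- move=> n x xe; have := (geometric_le (B0 n) (D n _ (ltW xe))).2.
  by rewrite !mulrA.
Qed.

Definition nder u n : R -> R := iter n (@derive1 R R^o) u.

(** Derivatives are local: on the disk of convergence the iterated derivatives
    coincide with the differentiated series. *)
Lemma nder_local u x0 (eta : R) (S : nat -> R -> R) :
  (forall x, `|x - x0| < eta -> S 0 x = u x) ->
  (forall n (x : R), `|x - x0| < eta -> is_derive x 1 (S n) (S n.+1 x)) ->
  forall n x, `|x - x0| < eta -> nder u n x = S n x /\ is_derive x 1 (nder u n) (S n.+1 x).
Proof.
move=> S0 DS.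
have main n : (forall x, `|x - x0| < eta -> nder u n x = S n x) ->
    forall x, `|x - x0| < eta -> is_derive x 1 (nder u n) (S n.+1 x).
  move=> E x xe; apply: near_eq_is_derive (DS n x xe).
  apply/nbhs_ballP; exists (eta - `|x - x0|); first by rewrite /= subr_gt0.
  move=> y; rewrite -ball_normE /= distrC ltrBrDr => yx; rewrite E//.
  apply: le_lt_trans yx; rewrite [leLHS](_ : _ = `|(y - x) + (x - x0)|) ?ler_normD//.
  by congr `|_|; ring.
elim=> [|n IH] x xe.
  have E : forall x, `|x - x0| < eta -> nder u 0 x = S 0%N x by move=> y /S0.
  by split; [exact: E|exact: main].
have E y : `|y - x0| < eta -> nder u n.+1 y = S n.+1 y.
  by move=> ye; have [_ [_ <-]] := IH y ye; rewrite -derive1E.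
by split; [exact: E|exact: main].
Qed.

Lemma nder_periodic u n : periodic1 u -> periodic1 (nder u n).
Proof.
move=> pu; elim: n => [//|n IH] x; rewrite /nder !iterS -/(nder u n) /derive1.
suff -> : (fun h => h^-1 *: (nder u n (h + (x + 1)) - nder u n (x + 1)) : R^o) =
  (fun h => h^-1 *: (nder u n (h + x) - nder u n x)) by [].
by apply/funext => h; rewrite IH addrA IH.
Qed.

(** Compactness of a period makes the local Cauchy bounds uniform; a single
    integer N bounds both constants. *)
Lemma analytic_bound u : real_analytic_circle u ->
  (forall n (x : R), is_derive x 1 (nder u n) (nder u n.+1 x)) /\
  exists N : nat, forall x, 0 <= x <= 1 -> forall n,
    `|nder u n x| <= N%:R * n`!%:R * N%:R ^+ n.
Proof.
move=> [pu an].
have loc x0 : exists2 eta : R, 0 < eta & exists (A rho : R),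
    [/\ 0 < A, 0 < rho,
      forall n (x : R), `|x - x0| < eta -> is_derive x 1 (nder u n) (nder u n.+1 x) &
      forall n x, `|x - x0| < eta -> `|nder u n x| <= A * n`!%:R * rho ^+ n].
  have [a [r [r0 H]]] := an x0.
  have [eta eta0 [S [A [rho [A0 rho0 S0 DS BS]]]]] := analytic_local r0 H.
  have L := nder_local S0 DS.
  exists eta => //; exists A, rho; split; [exact: A0|exact: rho0|move=> n x xe..].
    by have [_ D] := L n x xe; have [-> _] := L n.+1 x xe.
  by have [-> _] := L n x xe; exact: BS.
split.
  move=> n x; have [eta eta0 [A [rho [_ _ D _]]]] := loc x.
  by apply: D; rewrite subrr normr0.
apply: bounded_seg.
  move=> m n x mn h j; apply: (le_trans (h j)).
  have mR : m%:R <= n%:R :> R by rewrite ler_nat.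
  by rewrite !ler_pM ?mulr_ge0 ?exprn_ge0// lerXn2r// nnegrE.
move=> x _; have [eta eta0 [A [rho [A0 rho0 _ Bd]]]] := loc x.
exists eta => //; exists (Num.truncn (A + rho)).+1 => y yx n.
have AN : A + rho <= (Num.truncn (A + rho)).+1%:R by rewrite ltW// truncnS_gt.
have [A1 r1] : A <= (Num.truncn (A + rho)).+1%:R /\ rho <= (Num.truncn (A + rho)).+1%:R.
  by split; apply: le_trans AN; rewrite ?lerDl ?lerDr ltW.
apply: (le_trans (Bd n y yx)).
apply: ler_pM; rewrite ?mulr_ge0 ?exprn_ge0 ?(ltW A0) ?(ltW rho0)//.
  by rewrite ler_wpM2r.
by rewrite lerXn2r// nnegrE// ltW.
Qed.

End Analyticity.

Section FourierDecay.
Variable R : realType.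
Implicit Types (u f g : R -> R) (a : int -> R[i]).
Local Notation ab k := (`|(k : int)%:~R : R|).

Lemma toC_dx f g : (forall x : R, is_derive x 1 f (g x)) -> is_dx (toC f) (toC g).
Proof. by move=> D x; split; [exact: D|exact: is_derive_cst]. Qed.

Lemma is_dxM (F f H h : R -> R[i]) : is_dx F f -> is_dx H h ->
  is_dx (fun x => F x * H x) (fun x => f x * H x + F x * h x).
Proof.
move=> DF DH x; have [FR FI] := DF x; have [HR HI] := DH x; split.
- rewrite (_ : (fun _ => _) = (fun y => Re (F y) * Re (H y) - Im (F y) * Im (H y))); last first.
    by apply/funext => y; rewrite cReM.
  have P := is_deriveB (is_deriveM FR HR) (is_deriveM FI HI).
  apply: (is_derive_eq P); rewrite cReD !cReM /GRing.scale/=; ring.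
- rewrite (_ : (fun _ => _) = (fun y => Re (F y) * Im (H y) + Im (F y) * Re (H y))); last first.
    by apply/funext => y; rewrite cImM.
  have P := is_deriveD (is_deriveM FR HI) (is_deriveM FI HR).
  apply: (is_derive_eq P); rewrite cImD !cImM /GRing.scale/=; ring.
Qed.

(** Integration by parts over a period: the boundary terms cancel. *)
Lemma fhat_dx (F f : R -> R[i]) k : periodic1 F -> is_dx F f -> ccont f ->
  fhat f k = freq R k * fhat F k.
Proof.
move=> pF DF cf; have cF := is_dx_ccont DF.
have DP := is_dxM DF (@ek_dx R (- k)).
have ce := @ek_ccont R (- k).
have c1 : ccont (fun x => f x * @ek R (- k) x) by exact: ccontM.
have c2 : ccont (fun x => freq R (- k) * (F x * @ek R (- k) x)) by apply/ccontZ/ccontM.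
have E2 : (fun x => f x * @ek R (- k) x + F x * (freq R (- k) * @ek R (- k) x)) =
    (fun x => f x * @ek R (- k) x + freq R (- k) * (F x * @ek R (- k) x)).
  by apply/funext => x; rewrite mulrCA.
rewrite E2 in DP.
have := cint_dx DP (ccontD c1 c2).
have F10 : F 1 = F 0 by rewrite -(pF 0) add0r.
rewrite cintD; [|exact: ccont_cintegrable..].
rewrite cintZ; last by apply/ccont_cintegrable/ccontM.
rewrite F10 ek1 ek00 subrr -!fhatE => /eqP; rewrite addr_eq0 => /eqP ->.
by rewrite /freq mulrNz mulrN rmorphN !mulNr opprK.
Qed.

Lemma analytic_ccont u : real_analytic_circle u -> ccont (toC u).
Proof.
by move=> /analytic_bound[D _]; apply: is_dx_ccont (toC_dx (D 0%N)).
Qed.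

(** By n integrations by parts, |2 pi k|^n |fhat u k| <= 2 B n! B^n with B = N
    + 1. Multiplication by th^n / n! with th = 1/(2B) gives a geometric series
    on the right and the exponential series on the left. *)
Lemma analytic_decay u : real_analytic_circle u ->
  exists2 th : R, 0 < th & exists2 B : R, 0 <= B &
    forall k, expR (2 * pi * th * ab k) * cabs (fhat (toC u) k) <= B.
Proof.
move=> an; have [D [N HN]] := analytic_bound an.
have cc n : ccont (toC (nder u n)) := is_dx_ccont (toC_dx (D n)).
have step n k : fhat (toC (nder u n)) k = freq R k ^+ n * fhat (toC u) k.
  elim: n => [|n IH]; first by rewrite mul1r.
  rewrite (fhat_dx k _ (toC_dx (D n)) (cc n.+1)) ?IH ?mulrA -?exprS//.
  by move=> x; rewrite /toC nder_periodic//; case: an.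
have bd n k : (2 * pi * ab k) ^+ n * cabs (fhat (toC u) k) <= 2 * (N.+1%:R * n`!%:R * N.+1%:R ^+ n).
  rewrite -cabs_freq -cabsX -cabsM -step fhatE; apply: cint_bound.
    by apply/ccont_cintegrable/ccontM => //; exact: ek_ccont.
  move=> x x01; rewrite cabsM cabs_ek mulr1 cabsR (le_trans (HN x x01 n))//.
  have NN : N%:R <= N.+1%:R :> R by rewrite ler_nat.
  by rewrite !ler_pM ?mulr_ge0 ?exprn_ge0// lerXn2r// nnegrE.
have N0 : 0 < N.+1%:R :> R by [].
pose th : R := (2 * N.+1%:R)^-1.
have th0 : 0 < th by rewrite invr_gt0 mulr_gt0.
exists th => //; exists (4 * N.+1%:R); first by rewrite mulr_ge0.
move=> k; set z := cabs (fhat _ k).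
have z0 : 0 <= z by exact: cabs_ge0.
have X : 2 * pi * th * ab k = th * (2 * pi * ab k) by ring.
have P n : \sum_(0 <= i < n) (exp_coeff (2 * pi * th * ab k) i * z) <=
    4 * N.+1%:R * (1 - 2^-1 ^+ n).
  elim: n => [|n IH]; first by rewrite big_geq// expr0 subrr mulr0.
  rewrite big_nat_recr//= -[leRHS](_ : 4 * N.+1%:R * (1 - 2^-1 ^+ n) + 2 * N.+1%:R * 2^-1 ^+ n = _).
    apply: lerD IH _.
    have n0 : 0 < n`!%:R :> R by rewrite ltr0n fact_gt0.
    rewrite /exp_coeff /= X exprMn mulrAC ler_pdivrMr// -mulrA.
    apply: (@le_trans _ _ (th ^+ n * (2 * (N.+1%:R * n`!%:R * N.+1%:R ^+ n)))).
      by rewrite ler_wpM2l ?bd// exprn_ge0// ltW.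
    rewrite /th invfM exprMn [N.+1%:R^-1 ^+ n]exprVn.
    have Nn : N.+1%:R ^+ n != 0 :> R by rewrite expf_neq0// gt_eqF.
    apply: eq_le_imp.
    have key (x y v w : R) : x != 0 -> y / x * (2 * (w * v * x)) = 2 * w * y * v by move=> x0; field.
    exact: key.
  by rewrite exprS; field.
have C : series (fun i => exp_coeff (2 * pi * th * ab k) i * z) @ \oo --> expR (2 * pi * th * ab k) * z.
  rewrite (_ : series _ = (fun n => series (exp_coeff (2 * pi * th * ab k)) n * z)).
    by apply: cvgMl; exact: is_cvg_series_exp_coeff.
  by apply/funext => n; rewrite /series/= mulr_suml.
rewrite -(cvg_lim _ C)//; apply: limr_le; first by apply/cvg_ex; eexists; exact: C.
apply: nearW => n; apply: (le_trans (P n)).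
by rewrite ler_piMr ?mulr_ge0// gerBl exprn_ge0// invr_ge0.
Qed.

Lemma analytic_GCc u : real_analytic_circle u ->
  exists2 Delta : R, 0 < Delta & forall s, 0 <= s -> G Delta s u.
Proof.
move=> an; have [th th0 [B B0 H]] := analytic_decay an.
have t2 : 0 < th / 2 by rewrite divr_gt0.
exists (th / 2) => // s s0.
have pu : periodic1 (toC u) by move=> x; rewrite /toC (an.1 x).
split; first by apply: ccont_L2circle => //; exact: analytic_ccont.
have N34 : (Nw (th * 3 / 4) (fhat (toC u)) < +oo)%E.
  have [C _ HC] := @decay_Nw R (th * 3 / 4) th ltac:(lra) ltac:(lra).
  exact: le_lt_trans (HC _ _ B0 H) (ltry _).
have [C C0 HC] := @Gn_Nw R s (th / 2) (th * 3 / 4) s0 (ltW t2) ltac:(lra).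
by rewrite GnormE; apply: le_lt_trans (HC _) _; rewrite (Nw_fin N34) -EFinM ltry.
Qed.

(** Conjugation exchanges the characters of frequencies k and - k and fixes a
    real function. *)
Lemma fhat_conj f k : cintegrable (toC f) -> fhat (toC f) (- k) = conjc (fhat (toC f) k).
Proof.
move=> fi; rewrite !fhatE.
have gi := cintegrableM fi (@ek_ccont R (- k)).
have E x : toC f x * @ek R (- - k) x = conjc (toC f x * @ek R (- k) x).
  rewrite opprK /toC /ek /expi mulrNz mulrN !mulNr cosN sinN.
  by apply/eqP; rewrite eq_complex /=; apply/andP; split; apply/eqP; ring.
rewrite (_ : (fun x => _) = (fun x => conjc (toC f x * @ek R (- k) x))); last exact/funext.
move: gi; set g := fun x => _ => gi.
apply/eqP; rewrite eq_complex; apply/andP; split.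
  by apply/eqP; congr Rintegral; apply/funext => x; rewrite /g; case: (_ * _).
have -> : Im (cint (fun x => conjc (g x))) =
    \int[@lebesgue_measure R]_(x in `[0%R, 1%R]) (-1 * Im (g x)).
  by rewrite /cint; congr Rintegral; apply/funext => x; case: (g x) => c d /=; rewrite mulN1r.
by rewrite RintegralZl ?mulN1r//; exact: gi.2.
Qed.

(** The series is equal to its conjugate, by the change of index k -> - k. *)
Lemma synth_real a x : (forall k, a (- k) = conjc (a k)) -> Im (synth a x) = 0.
Proof.
move=> H; have E : synth a x = conjc (synth a x).
  rewrite {1}/synth (@csum_reindex _ _ _ (fun k : int => - k)); last first.
    by exists (fun k : int => - k) => k; rewrite opprK.
  rewrite (eq_csum (g := fun k => conjc (a k * @ek R k x))); last first.
    move=> k; rewrite H /ek /expi mulrNz mulrN !mulNr cosN sinN.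
    by case: (a k) => c d; apply/eqP; rewrite eq_complex /=; apply/andP; split; apply/eqP; ring.
  have EI : rsum (fun k => Im (conjc (a k * @ek R k x))) = - rsum (fun k => Im (a k * @ek R k x)).
    by rewrite -rsumN; apply: eq_rsum => k; case: (_ * _).
  have ER : rsum (fun k => Re (conjc (a k * @ek R k x))) = rsum (fun k => Re (a k * @ek R k x)).
    by apply: eq_rsum => k; case: (_ * _).
  by rewrite /synth /csum ER EI.
move: E; case: (synth a x) => c d [] /eqP; rewrite -subr_eq0 opprK -mulr2n mulrn_eq0/=.
by move/eqP.
Qed.

(** The Fourier series is holomorphic in the strip, real on the real line
    because the function is, and almost everywhere equal to it by uniqueness of
    Fourier coefficients. *)
Lemma G_sub_analytic (Delta s : R) : 0 < Delta -> 0 <= s -> G_sub_A Delta s.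
Proof.
move=> D0 s0 phi [L2 Gf].
have fi := L2circle_cintegrable L2.
pose a := fhat (toC phi).
have Na d : 0 <= d -> d < Delta -> (Nw d a < +oo)%E.
  move=> d0 dD; have [C C0 HC] := Nw_Gn_loss s0 d0 dD.
  apply: le_lt_trans (HC _) _; move: Gf; rewrite GnormE => Gf.
  by rewrite (Gn_fin Gf) -EFinM ltry.
have D2 : 0 < Delta / 2 by rewrite divr_gt0.
have N2 : (Nw (Delta / 2) a < +oo)%E by apply: Na; lra.
have re x : Im (synth a x) = 0 by apply: synth_real => k; exact: fhat_conj.
exists (fun x => Re (synth a x)); split; first split.
- by move=> x; rewrite synth_periodic.
- exists (synthz a); split => [z zD|x]; last first.
    by rewrite -synthE; have := re x; case: (synth a x) => c e /= ->.
  have m : `|Im z| < (`|Im z| + Delta) / 2 by lra.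
  apply: cdiff_derivable; apply: (synthz_cdiff m); apply: Na; last by lra.
  by rewrite divr_ge0// addr_ge0// ltW.
- apply: (@fhat_inj_ae R (toC phi) (synth a)) => //.
  + by case: L2.
  + exact: synth_periodic.
  + exact: synth_ccont D2 N2.
  + by move=> k; rewrite (fhat_synth k D2 N2).
Qed.

Lemma analytic_admissible u : real_analytic_circle u -> exists Delta : R, admissible u Delta.
Proof.
move=> an; have [D D0 H] := analytic_GCc an; exists D; split => // s s0.
by split; [apply: H; lra|apply: G_sub_analytic => //; lra].
Qed.

End FourierDecay.

(** * The Cauchy problem *)

Section CauchyProblem.
Variable R : realType.

Lemma flow0 (a0 : int -> R[i]) : flow a0 0 = a0.
Proof.
apply/funext => k; rewrite /flow -[RHS](summ_pred1 (0 : nat) (a0 k)).2.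
by apply: eq_csum => -[|n] /=; rewrite ?mul1r// expr0n mul0r.
Qed.

Lemma analytic_synth (Delta s : R) (u0 : R -> R) : 0 < Delta -> 0 <= s ->
  real_analytic_circle u0 -> G Delta s u0 -> toC u0 = synth (fhat (toC u0)).
Proof.
move=> D0 s0 an GD; apply: (GCc_synth D0 s0 _).2.
by have [cR cI] := analytic_ccont an; split.
Qed.

Lemma Gnorm_gt0 (Delta s : R) (u0 : R -> R) : 0 < Delta -> 0 <= s ->
  real_analytic_circle u0 -> G Delta s u0 -> (exists x, u0 x != 0) ->
  0 < fine (Gnorm Delta s (toC u0)).
Proof.
move=> D0 s0 an GD [x ux]; rewrite lt_def; apply/andP; split; last first.
  by apply: fine_ge0; exact: sqrte_ge0.
apply: contra ux => /eqP g0.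
have Gf := GD.2; rewrite GnormE in g0 Gf.
have a0 k : fhat (toC u0) k = 0.
  apply: cabs_eq0; apply/eqP; rewrite eq_le cabs_ge0 andbT -lee_fin.
  by apply: le_trans (coef_Gn _ k (ltW D0) s0) _; rewrite (Gn_fin Gf) g0.
have : toC u0 x = 0.
  rewrite (analytic_synth D0 s0 an GD) /synth (eq_csum (g := fun=> 0)) ?csum0// => k.
  by rewrite a0 mul0r.
by move=> [->].
Qed.

End CauchyProblem.

Theorem theorem15 (R : realType) :
  (forall u0 : R -> R, real_analytic_circle u0 ->
     exists Delta : R, admissible u0 Delta) /\
  (forall s Delta : R, 2^-1 < s -> 0 < Delta ->
     exists c : R, 0 < c /\
     forall u0 : R -> R, real_analytic_circle u0 -> admissible u0 Delta ->
       exists T : R,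
         [/\ 0 < T,
             ((exists x, u0 x != 0) ->
                T = c / fine (Gnorm Delta (s + 1) (toC u0))) &
             forall d : R, 0 < d -> d < 1 ->
               exists u : R[i] -> R -> R[i],
                 holomorphic_solution (Delta * d) (s + 1) (T * (1 - d)) u0 u /\
                 forall v : R[i] -> R -> R[i],
                   holomorphic_solution (Delta * d) (s + 1) (T * (1 - d)) u0 v ->
                   forall t : R[i], cabs t < T * (1 - d) ->
                   forall x : R, v t x = u t x]).
Proof.
split; first exact: analytic_admissible.
move=> s D s2 D0; have [C Cp HC] := Nw_Gn s2.
have s10 : 0 <= s + 1 by lra.
(* [growth] is linear in its second argument: replacing C by C g divides the
   lifespan by g. *)
exists (D / growth D C); split; first by rewrite divr_gt0// growth_gt0.
move=> u0 an [_ adm]; have GD := (adm s ltac:(lra)).1.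
have Gf := GD.2; rewrite GnormE in Gf.
pose g := fine (Gnorm D (s + 1) (toC u0)).
have g0 : 0 <= g by apply: fine_ge0; exact: sqrte_ge0.
(* The case g = 0 is that of the zero datum, for which any M > 0 will do. *)
pose M := if 0 < g then C * g else 1.
have M0 : 0 < M by rewrite /M; case: ifP => // gp; rewrite mulr_gt0.
have HM : (Nw D (fhat (toC u0)) <= M%:E)%E.
  apply: (@le_trans _ _ (C * g)%:E).
    apply: le_trans (HC D _) _.
    by rewrite (Gn_fin Gf) -EFinM lee_fin /g GnormE.
  rewrite lee_fin /M; case: ltP => // gn.
  by rewrite (_ : g = 0) ?mulr0//; apply/eqP; rewrite eq_le gn g0.
exists (D / growth D M); split.
- by rewrite divr_gt0// growth_gt0.
- move=> ne; have gp := Gnorm_gt0 D0 s10 an GD ne.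
  have gN : g != 0 by rewrite gt_eqF.
  by rewrite -/g /M gp /growth mulrA invfM mulrA.
- move=> d d0 d1; have Dd : 0 < D * d by rewrite mulr_gt0.
  have S t := @flow_solution R D M d (s + 1) (fhat (toC u0)) D0 M0 HM d0 d1 s10 t.
  have SOL : holomorphic_solution (D * d) (s + 1) (D / growth D M * (1 - d)) u0
      (fun t => synth (flow (fhat (toC u0)) t)).
    split.
    + by move=> t tT; have [G1 G2 _] := S t tT; split => //; exists (synth (dflow (fhat (toC u0)) t)).
    + by move=> x; rewrite flow0 -(analytic_synth D0 s10 an GD).
    + move=> t v tT Dv; have [_ Dw Ew] := S t tT.
      have Hu (t' : R[i]) (tT' : cabs t' < D / growth D M * (1 - d)) : GCc (D * d) (s + 1) (synth (flow (fhat (toC u0)) t')).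
        by have [] := S t' tT'.
      by rewrite (is_dt_deriv_uniq Dd s10 Hu tT Dv Dw).
  exists (fun t => synth (flow (fhat (toC u0)) t)); split => // v Hv.
  apply: (solution_uniq Dd s10 _ SOL Hv).
  by rewrite mulr_gt0 ?subr_gt0// divr_gt0// growth_gt0.
Qed.
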